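(* Consider the RASGP algorithm (described in the context) on $n$ agents over a directed graph $\mathcal G$, under the communication assumption (a)–(e) and the noise assumption given in the context. Suppose that for each $i=1,\dots,n$ the differentiable function $f_i:\mathbb R^d\to\mathbb R$ is $\mu_i$-strongly convex over $\mathbb R^d$ with $\mu_i>0$, and that its gradient is $L_i$-Lipschitz continuous with $L_i>0$, i.e. $\|\nabla f_i(\mathbf z_1)-\nabla f_i(\mathbf z_2)\|\le L_i\|\mathbf z_1-\mathbf z_2\|$ for all $\mathbf z_1,\mathbf z_2\in\mathbb R^d$. Let $\mu=\sum_{i=1}^n\mu_i$, $\sigma^2=\sum_{i=1}^n\sigma_i^2$, and let $\mathbf z^*$ be the unique minimizer of $F(\mathbf z)=\sum_{i=1}^n f_i(\mathbf z)$. Then RASGP with step-size $\alpha(k)=n/(\mu k)$ for $k\ge 1$ and $\alpha(0)=0$ converges to $\mathbf z^*$ with the following asymptotic rate: for all $i=1,\dots,n$, $$\mathbb E\left[\|\mathbf z_i(k)-\mathbf z^*\|^2\right]\le \frac{L_u\sigma^2}{k\mu^2}+O_k\left(\frac1{k^{1.5}}\right),$$ where $O_k(k^{-1.5})$ denotes a term bounded by $C k^{-1.5}$ for all large $k$, with $C$ independent of $k$.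
   Context: Communication model. There are $n$ agents $\mathcal V=\{1,\dots,n\}$ and a fixed directed graph $\mathcal G=(\mathcal V,\mathcal E)$; $(i,j)\in\mathcal E$ means $i$ can send to $j$. $N_i^-,N_i^+$ are the sets of in- and out-neighbors of $i$, and $d_i^+=|N_i^+|$. Time is discrete, $k=0,1,2,\dots$. At each iteration an agent may or may not wake up; an agent $i$ that wakes up at time $k$ sends one message to each $j\in N_i^+$ and processes messages sent to it at earlier times that have arrived. Messages may be lost. If a message sent at time $k_1$ is ready to be processed (by its awake receiver) at time $k_2$, its effective delay is $k_2-k_1\ge 1$; messages that are discarded by the receiver as outdated count as lost and have no effective delay. Communication assumption. (a) $\mathcal G$ is strongly connected and has no self-loops. (b) The delays on each link are bounded above by some $L_{\rm del}\ge1$. (c) Every agent wakes up and performs updates at least once every $L_u\ge 1$ iterations. (d) Each link fails at most $L_f\ge0$ consecutive times. (e) Messages arrive in the order they were sent: if messages are sent from $i$ to $j$ at times $k_1<k_2$ with effective delays $d_1,d_2$, then $k_1+d_1<k_2+d_2$. RASGP algorithm. Agent $i$ keeps $\mathbf x_i,\mathbf z_i,\boldsymbol\phi_i^x\in\mathbb R^d$, $y_i,\phi_i^y\in\mathbb R$, an integer $\kappa_i$, and for every $j\in N_i^-$ variables $\boldsymbol\rho_{ij}^x,\boldsymbol\rho_{ij}^{*x}\in\mathbb R^d$, $\rho_{ij}^y,\rho_{ij}^{*y}\in\mathbb R$ and an integer $\kappa_{ij}$. Initially $y_i=1$, all $\phi$ and $\rho$ variables are $0$, $\kappa_i=\kappa_{ij}=-1$,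 and $\mathbf x_i(0)$ is arbitrary with $\mathbf z_i(0)=\mathbf x_i(0)/y_i(0)$. At iteration $k$, each agent $i$ that wakes up does, in order: 1. $\beta_i(k)=\sum_{t=\kappa_i+1}^k\alpha(t)$; $\mathbf x_i\leftarrow\mathbf x_i-\beta_i(k)\hat{\mathbf g}_i(k)$; $\kappa_i\leftarrow k$. 2. $\boldsymbol\phi_i^x\leftarrow\boldsymbol\phi_i^x+\mathbf x_i/(d_i^++1)$, $\phi_i^y\leftarrow\phi_i^y+y_i/(d_i^++1)$; $\mathbf x_i\leftarrow\mathbf x_i/(d_i^++1)$, $y_i\leftarrow y_i/(d_i^++1)$. 3. Broadcast $(\boldsymbol\phi_i^x,\phi_i^y,\kappa_i)$ to all agents in $N_i^+$. 4. For each message $(\boldsymbol\phi_j^x,\phi_j^y,\kappa_j')$ in its inbox: if $\kappa_j'>\kappa_{ij}$, set $\boldsymbol\rho_{ij}^{*x}\leftarrow\boldsymbol\phi_j^x$, $\rho_{ij}^{*y}\leftarrow\phi_j^y$, $\kappa_{ij}\leftarrow\kappa_j'$. 5. $\mathbf x_i\leftarrow\mathbf x_i+\sum_{j\in N_i^-}(\boldsymbol\rho_{ij}^{*x}-\boldsymbol\rho_{ij}^x)$, $y_i\leftarrow y_i+\sum_{j\in N_i^-}(\rho_{ij}^{*y}-\rho_{ij}^y)$; then $\boldsymbol\rho_{ij}^x\leftarrow\boldsymbol\rho_{ij}^{*x}$, $\rho_{ij}^y\leftarrow\rho_{ij}^{*y}$; $\mathbf z_i\leftarrow\mathbf x_i/y_i$.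 All other variables (and all variables of sleeping agents) are unchanged. A variable with argument $(k)$ denotes its value at the beginning of iteration $k$. Here $\hat{\mathbf g}_i(k)=\nabla f_i(\mathbf z_i(k))+\boldsymbol\varepsilon_i(k)$ is a noisy gradient. Noise assumption. The $\boldsymbol\varepsilon_i(k)$ are independent random vectors (over agents and iterations) with bounded support, $\|\boldsymbol\varepsilon_i(k)\|\le b_i$, with $\mathbb E[\boldsymbol\varepsilon_i(k)]=\mathbf 0$ and $\mathbb E[\|\boldsymbol\varepsilon_i(k)\|^2]\le\sigma_i^2$. $\|\cdot\|$ is the Euclidean norm. *)

(* Defs.v *)
From HB Require Import structures.
From mathcomp Require Import all_boot all_order all_algebra.
From mathcomp Require Import all_classical all_reals all_analysis.

Set Implicit Arguments.
Unset Strict Implicit.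
Unset Printing Implicit Defensive.

Import Order.TTheory GRing.Theory Num.Theory.
Import numFieldNormedType.Exports.

Local Open Scope classical_set_scope.
Local Open Scope ring_scope.

(* The library norm on 'rV[R]_d is the sup norm, hence this definition. *)
Definition enorm (R : realType) (d : nat) (v : 'rV[R]_d) : R :=
  Num.sqrt (\sum_(c < d) v 0 c ^+ 2).

Definition grad (R : realType) (d : nat) (f : 'rV[R]_d -> R) (z : 'rV[R]_d) :
    'rV[R]_d :=
  \row_(c < d) 'D_(delta_mx 0 c) f z.

Definition strongly_convex (R : realType) (d : nat) (m : R)
    (f : 'rV[R]_d -> R) : Prop :=
  forall (z1 z2 : 'rV[R]_d) (t : R), 0 <= t -> t <= 1 ->
    f (t *: z1 + (1 - t) *: z2) <=
    t * f z1 + (1 - t) * f z2 - m / 2 * t * (1 - t) * enorm (z1 - z2) ^+ 2.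

Definition lipschitz_grad (R : realType) (d : nat) (L : R)
    (f : 'rV[R]_d -> R) : Prop :=
  forall z1 z2 : 'rV[R]_d,
    enorm (grad f z1 - grad f z2) <= L * enorm (z1 - z2).

Definition borel_rV (R : realType) (d : nat) : set (set 'rV[R]_d) :=
  <<s @open 'rV[R]_d >>.

Definition random_vector (disp : measure_display) (T : measurableType disp)
    (R : realType) (d : nat) (X : T -> 'rV[R]_d) : Prop :=
  forall A : set 'rV[R]_d, borel_rV A -> measurable (X @^-1` A).

Definition independent_family (disp : measure_display)
    (T : measurableType disp) (R : realType) (P : probability T R) (d : nat)
    (I : eqType) (X : I -> T -> 'rV[R]_d) : Prop :=
  forall (s : seq I) (A : I -> set 'rV[R]_d), uniq s ->
    (forall i, i \in s -> borel_rV (A i)) ->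
    P (\bigcap_(i in [set` s]) (X i @^-1` A i)) =
    (\prod_(i <- s) P (X i @^-1` A i))%E.

Record noise_assumption (disp : measure_display) (T : measurableType disp)
    (R : realType) (P : probability T R) (d n : nat)
    (eps : 'I_n -> nat -> T -> 'rV[R]_d) (b sigma : 'I_n -> R) : Prop :=
  NoiseAssumption {
    noise_random : forall i k, random_vector (eps i k);
    noise_independent :
      independent_family P (fun p : 'I_n * nat => eps p.1 p.2);
    noise_bounded : forall i k, {ae P, forall w, enorm (eps i k w) <= b i};
    noise_mean : forall i k (c : 'I_d), ('E_P[fun w => eps i k w ord0 c] = 0)%E;
    noise_variance : forall i k,
      ('E_P[fun w => (enorm (eps i k w) ^+ 2)%R] <= (sigma i ^+ 2)%:E)%E
  }.

(* [wake i k]: agent [i] wakes up at time [k].  [delay i j k] is the fate of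
   the message sent from [i] to [j] at time [k], and is only relevant when
   [(i, j)] is an edge and [wake i k] holds: [None] if the message is lost
   (which includes the case where the receiver discards it as outdated) and
   [Some l] if its effective delay is [l], i.e. if it is processed by [j], then
   awake, at time [k + l]. *)
Definition processed (n : nat) (E : rel 'I_n) (wake : 'I_n -> nat -> bool)
    (delay : 'I_n -> 'I_n -> nat -> option nat) (i j : 'I_n) (k l : nat) :
    bool :=
  [&& E i j, wake i k & delay i j k == Some l].

Record communication_assumption (n : nat) (E : rel 'I_n)
    (wake : 'I_n -> nat -> bool)
    (delay : 'I_n -> 'I_n -> nat -> option nat) (Ldel Lu Lf : nat) : Prop :=
  CommunicationAssumption {
    comm_effective : forall i j k l, processed E wake delay i j k l ->
      (1 <= l)%N /\ wake j (k + l)%N;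
    comm_connected : forall i j, connect E i j;
    comm_noloop : forall i, ~~ E i i;
    comm_delay : forall i j k l, processed E wake delay i j k l ->
      (l <= Ldel)%N;
    comm_wake : forall i k, exists2 k', (k <= k' < k + Lu)%N & wake i k';
    (* among the messages sent within a window of time over which the link
       delivers nothing, there are at most [Lf] *)
    comm_failure : forall i j k1 k2, E i j ->
      (forall k, (k1 <= k < k2)%N -> wake i k -> delay i j k = None) ->
      (\sum_(k1 <= k < k2) wake i k <= Lf)%N;
    comm_order : forall i j k1 k2 l1 l2, (k1 < k2)%N ->
      processed E wake delay i j k1 l1 -> processed E wake delay i j k2 l2 ->
      (k1 + l1 < k2 + l2)%N
  }.

Record message (R : realType) (d : nat) := Message {
  msg_phix : 'rV[R]_d;
  msg_phiy : R;
  msg_kappa : int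
}.

(* The variables that agent [i] keeps for an in-neighbour [j]; [rhosx] and
   [rhosy] are the starred ones. *)
Record inlink (R : realType) (d : nat) := Inlink {
  rhox : 'rV[R]_d;
  rhosx : 'rV[R]_d;
  rhoy : R;
  rhosy : R;
  kappa_in : int
}.

(* [links] is total on 'I_n, but only its values at in-neighbours are used. *)
Record agent (R : realType) (d n : nat) := Agent {
  vx : 'rV[R]_d;
  vy : R;
  vz : 'rV[R]_d;
  phix : 'rV[R]_d;
  phiy : R;
  kappa : int;
  links : 'I_n -> inlink R d
}.

(* [sent s j t] is the message broadcast by [j] at time [t]; it is a dummy
   value when [j] is asleep at time [t] or when time [t] is still to come. *)
Record system (R : realType) (d n : nat) := System {
  agents : 'I_n -> agent R d n;
  sent : 'I_n -> nat -> message R d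
}.

Definition rasgp_init (R : realType) (d n : nat) (x0 : 'I_n -> 'rV[R]_d) :
    system R d n :=
  {| agents := fun i =>
       {| vx := x0 i; vy := 1; vz := x0 i; phix := 0; phiy := 0; kappa := -1;
          links := fun=> {| rhox := 0; rhosx := 0; rhoy := 0; rhosy := 0;
                            kappa_in := -1 |} |};
     sent := fun _ _ =>
       {| msg_phix := 0; msg_phiy := 0; msg_kappa := -1 |} |}.

(* [g] is the noisy gradient; [beta] collects the step sizes of all iterations
   since the previous wake-up, which took place at time [kappa a] ([-1] if
   there was none). *)
Definition gradient_step (R : realType) (d n : nat) (alpha : nat -> R)
    (k : nat) (g : 'rV[R]_d) (a : agent R d n) : agent R d n :=
  let beta := \sum_(0 <= t < k.+1 | kappa a < t%:Z) alpha t in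
  {| vx := vx a - beta *: g; vy := vy a; vz := vz a;
     phix := phix a; phiy := phiy a; kappa := k%:Z; links := links a |}.

(* [deg] is the out-degree of the agent, which keeps one share for itself. *)
Definition push_step (R : realType) (d n : nat) (deg : nat)
    (a : agent R d n) : agent R d n :=
  let x := (deg.+1%:R)^-1 *: vx a in
  let y := vy a / deg.+1%:R in
  {| vx := x; vy := y; vz := vz a;
     phix := phix a + x; phiy := phiy a + y; kappa := kappa a;
     links := links a |}.

Definition broadcast (R : realType) (d n : nat) (a : agent R d n) :
    message R d :=
  {| msg_phix := phix a; msg_phiy := phiy a; msg_kappa := kappa a |}.

(* A message [m] from [j] is ignored unless it is more recent than the last
   one taken into account. *)
Definition receive (R : realType) (d n : nat) (a : agent R d n) (j : 'I_n)
    (m : message R d) : agent R d n :=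
  if kappa_in (links a j) < msg_kappa m then
    {| vx := vx a; vy := vy a; vz := vz a;
       phix := phix a; phiy := phiy a; kappa := kappa a;
       links := fun j' =>
         if j' == j then
           {| rhox := rhox (links a j); rhosx := msg_phix m;
              rhoy := rhoy (links a j); rhosy := msg_phiy m;
              kappa_in := msg_kappa m |}
         else links a j' |}
  else a.

(* [N] is the set of in-neighbours of the agent. *)
Definition pull_step (R : realType) (d n : nat) (N : {set 'I_n})
    (a : agent R d n) : agent R d n :=
  let x := vx a + \sum_(j in N) (rhosx (links a j) - rhox (links a j)) in
  let y := vy a + \sum_(j in N) (rhosy (links a j) - rhoy (links a j)) in
  {| vx := x; vy := y; vz := y^-1 *: x;
     phix := phix a; phiy := phiy a; kappa := kappa a;
     links := fun j =>
       {| rhox := rhosx (links a j); rhosx := rhosx (links a j);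
          rhoy := rhosy (links a j); rhosy := rhosy (links a j);
          kappa_in := kappa_in (links a j) |} |}.

(* The pairs (sender, sending time) of the messages that [i] processes at
   time [k]. *)
Definition inbox (n : nat) (E : rel 'I_n) (wake : 'I_n -> nat -> bool)
    (delay : 'I_n -> 'I_n -> nat -> option nat) (i : 'I_n) (k : nat) :
    seq ('I_n * nat) :=
  [seq p <- [seq (j, t) | j <- enum 'I_n, t <- iota 0 k] |
    processed E wake delay p.1 i p.2 (k - p.2)%N].

Definition rasgp_step (R : realType) (d n : nat) (E : rel 'I_n)
    (wake : 'I_n -> nat -> bool)
    (delay : 'I_n -> 'I_n -> nat -> option nat) (alpha : nat -> R)
    (f : 'I_n -> 'rV[R]_d -> R) (e : 'I_n -> 'rV[R]_d) (k : nat)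
    (s : system R d n) : system R d n :=
  let pushed i :=
    let a := agents s i in
    push_step #|[set j | E i j]|
      (gradient_step alpha k (grad (f i) (vz a) + e i) a) in
  {| agents := fun i =>
       if wake i k then
         pull_step [set j | E j i]
           (foldl (fun a p => receive a p.1 (sent s p.1 p.2))
              (pushed i) (inbox E wake delay i k))
       else agents s i;
     sent := fun i t =>
       if wake i k && (t == k) then broadcast (pushed i) else sent s i t |}.

(* The state at the beginning of iteration [k], for the noise realization
   [e]. *)
Fixpoint rasgp (R : realType) (d n : nat) (E : rel 'I_n)
    (wake : 'I_n -> nat -> bool)
    (delay : 'I_n -> 'I_n -> nat -> option nat) (alpha : nat -> R)
    (f : 'I_n -> 'rV[R]_d -> R) (x0 : 'I_n -> 'rV[R]_d)
    (e : 'I_n -> nat -> 'rV[R]_d) (k : nat) : system R d n :=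
  if k is k'.+1 then
    rasgp_step E wake delay alpha f (fun i => e i k') k'
      (rasgp E wake delay alpha f x0 e k')
  else rasgp_init x0.

Definition rasgp_z (R : realType) (d n : nat) (E : rel 'I_n)
    (wake : 'I_n -> nat -> bool)
    (delay : 'I_n -> 'I_n -> nat -> option nat) (alpha : nat -> R)
    (f : 'I_n -> 'rV[R]_d -> R) (x0 : 'I_n -> 'rV[R]_d)
    (e : 'I_n -> nat -> 'rV[R]_d) (i : 'I_n) (k : nat) : 'rV[R]_d :=
  vz (agents (rasgp E wake delay alpha f x0 e k) i).

(* Main.v *)
Require Import Defs.
From HB Require Import structures.
From mathcomp Require Import all_boot all_order all_algebra.
From mathcomp Require Import all_classical all_reals all_analysis.
From mathcomp Require Import measurable_realfun.
From mathcomp Require Import ring lra zify.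

(* Let the mass sent over a link but not yet absorbed count as present.  Then
   the mean of all x-mass is conserved by the communication and moves only by
   the gradient steps, and each ratio z_i = x_i / y_i is a convex combination
   of ratios of a bounded number of past iterations.  Every agent's mass reaches
   every other agent within a bounded time, so the spread of the ratios
   contracts geometrically up to the perturbations, which are O(1/k); hence
   z_i(k) is within O(1/k) of the mean.

   As z_i is constant between two wake-ups of i, charging each agent's gradient
   steps one iteration at a time changes the mean by O(1/k) and gives a process
   w(k+1) = w(k) - (1/(mu k)) sum_i grad f_i(z_i(k)) - noise.  Strong convexity
   then yields E|w(k+1) - z*|^2 <= (1 - 2/k) E|w(k) - z*|^2 + O(k^(-5/2)) + the
   variance of the noise.  An agent that wakes up after l <= L_u iterations
   contributes (sum of l step sizes)^2 <= L_u (sum of their squares) to that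
   variance, so on average L_u sigma^2 / (mu k)^2 per iteration. *)

Set Implicit Arguments.
Unset Strict Implicit.
Unset Printing Implicit Defensive.

Import Order.TTheory GRing.Theory Num.Theory.
Import numFieldNormedType.Exports.

Local Open Scope classical_set_scope.
Local Open Scope ring_scope.

(** * Ratio consensus over an unreliable network *)

(** Gradients of strongly convex functions are unbounded, so the size of the perturbations depends
    on the very iterates that consensus should control. The circle is broken by proving consensus up
    to an arbitrary horizon [K], with an error linear in the bound [r] assumed on the iterates
    before [K]. That error is divided by k, so the contraction 1 - 1/(2k) of the gradient step
    eventually dominates it and the radius stops growing. All this holds on each noise path
    separately, uniformly in the path, so every variable whose expectation is taken is bounded.

    The exponent 5/2 takes two rounds. Evaluating the gradients at z_i instead of w costs O(1/k^2)
    in a step, hence O(1/k^2) E|w - z*| in the mean square. Boundedness alone then yields E|w -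
    z*|^2 = O(1/k); so E|w - z*| = O(k^(-1/2)), and in the second round the noise variance is the
    only term of order 1/k^2.

    No conditional expectation occurs: a noise vector is orthogonal to every bounded function of all
    the other noise vectors, which covers both the past and the other agents. *)

Section PushSum.
Variables (R : realFieldType) (n : nat) (E : rel 'I_n).
(* At time [k], agent [j] has absorbed what [i] sent at all times
   [t < tau i j k]. *)
Variables (wake : 'I_n -> nat -> bool) (tau : 'I_n -> 'I_n -> nat -> nat).

Definition outdeg (i : 'I_n) : nat := (\sum_(j | E i j) 1)%N.

Definition keep (i : 'I_n) (k : nat) : R :=
  if wake i k then (outdeg i).+1%:R^-1 else 1.

Definition send (i : 'I_n) (k : nat) : R :=
  if wake i k then (outdeg i).+1%:R^-1 else 0.

(** The block [tau i j k <= t < tau i j k.+1] is what [j] absorbs from [i] during iteration [k].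
    Losses and delays only lengthen later blocks, because the algorithm transmits running sums. *)
Definition inflow (q : 'I_n -> nat -> R) (j : 'I_n) (k : nat) : R :=
  keep j k * q j k +
  \sum_(i | E i j) \sum_(tau i j k <= t < tau i j k.+1) send i t * q i t.

(** [p] is subtracted before the mass is split, as the gradient step precedes the push. The horizon
    [K] is there because bounds on [p] will be known only up to some time. *)
Definition flow (K : nat) (x p : 'I_n -> nat -> R) : Prop :=
  forall j k, (k < K)%N -> x j k.+1 = inflow (fun i t => x i t - p i t) j k.

Definition in_transit (q : 'I_n -> nat -> R) (k : nat) : R :=
  \sum_j \sum_(i | E i j) \sum_(tau i j k <= t < k) send i t * q i t.

Definition total (x p : 'I_n -> nat -> R) (k : nat) : R :=
  \sum_j x j k + in_transit (fun i t => x i t - p i t) k.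

Variables (B Lu : nat).
Hypothesis tau_mono : forall i j k, (tau i j k <= tau i j k.+1)%N.
Hypothesis tau_le : forall i j k, (tau i j k <= k)%N.
Hypothesis tau_lag : forall i j k, E i j -> (k <= tau i j k + B)%N.
Hypothesis wakeP : forall i k, exists2 k', (k <= k' < k + Lu)%N & wake i k'.
Hypothesis connE : forall i j, connect E i j.

Let N : R := n.+1%:R.

Let N_gt0 : 0 < N. Proof. by rewrite ltr0n. Qed.
Let N_ge1 : 1 <= N. Proof. by rewrite ler1n. Qed.

Lemma outdeg_le i : ((outdeg i).+1 <= n.+1)%N.
Proof.
by rewrite ltnS /outdeg sum1_card (leq_trans (max_card _)) ?card_ord.
Qed.

Lemma invN_le i : N^-1 <= (outdeg i).+1%:R^-1 :> R.
Proof. by rewrite lef_pV2 ?posrE ?ltr0n// ler_nat outdeg_le. Qed.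

Lemma invN_gt0 : 0 < N^-1. Proof. by rewrite invr_gt0. Qed.
Lemma invN_le1 : N^-1 <= 1. Proof. by rewrite invf_le1. Qed.

Lemma keep_ge i k : N^-1 <= keep i k.
Proof. by rewrite /keep; case: ifP => _; rewrite ?invN_le ?invN_le1. Qed.

Lemma keep_ge0 i k : 0 <= keep i k.
Proof. exact: le_trans (ltW invN_gt0) (keep_ge i k). Qed.

Lemma send_ge0 i k : 0 <= send i k.
Proof. by rewrite /send; case: ifP => _ //; rewrite invr_ge0 ler0n. Qed.

Lemma send_le1 i k : send i k <= 1.
Proof.
rewrite /send; case: ifP => _; rewrite ?ler01//.
by rewrite invf_le1 ?ltr0n// ler1n.
Qed.

Lemma keepDsend i k : keep i k + (outdeg i)%:R * send i k = 1.
Proof.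
rewrite /keep /send; case: ifP => _; last by rewrite mulr0 addr0.
by rewrite -{1}[_^-1]mul1r -mulrDl addrC natr1 divff// pnatr_eq0.
Qed.

(** The shares newly absorbed and those still under way together make up the old ones and those of
    time [k]; and what a sender keeps plus its [outdeg] shares is all it had after subtracting
    [p]. *)
Lemma totalS K x p k : flow K x p -> (k < K)%N ->
  total x p k.+1 = total x p k - \sum_j p j k.
Proof.
move=> fl kK; rewrite /total /in_transit.
under eq_bigr => j _ do rewrite fl//.
rewrite /inflow big_split/=.
set q := fun i t => x i t - p i t.
have eqT : \sum_j \sum_(i | E i j)
     \sum_(tau i j k <= t < tau i j k.+1) send i t * q i t +
   \sum_j \sum_(i | E i j) \sum_(tau i j k.+1 <= t < k.+1) send i t * q i t
 = \sum_j \sum_(i | E i j) \sum_(tau i j k <= t < k) send i t * q i t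
   + \sum_i (outdeg i)%:R * (send i k * q i k).
  have -> : \sum_i (outdeg i)%:R * (send i k * q i k)
     = \sum_j \sum_(i | E i j) send i k * q i k.
    rewrite (exchange_big_dep xpredT)//=; apply: eq_bigr => i _.
    by rewrite sumr_const mulr_natl /outdeg sum1_card.
  rewrite -!big_split/=; apply: eq_bigr => j _.
  rewrite -!big_split/=; apply: eq_bigr => i Eij.
  rewrite -(big_cat_nat (tau_mono i j k) (tau_le i j k.+1))/=.
  by rewrite big_nat_recr//= tau_le.
rewrite -addrA eqT addrCA [RHS]addrAC [RHS]addrC; congr (_ + _).
rewrite -big_split -sumrB/=; apply: eq_bigr => i _.
by rewrite mulrA -mulrDl keepDsend mul1r.
Qed.

Lemma total0 x p : total x p 0 = \sum_j x j 0%N.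
Proof.
rewrite /total /in_transit [X in _ + X]big1 ?addr0// => j _; rewrite big1// => i _.
by rewrite big_geq.
Qed.

(** An inequality is enough to propagate lower bounds, and the gap between a perturbed quantity and
    a rising ceiling satisfies no more than that. *)
Definition superflow (k0 K : nat) (q : 'I_n -> nat -> R) : Prop :=
  forall j k, (k0 <= k)%N -> (k < K)%N -> inflow q j k <= q j k.+1.

(** * Spreading of nonnegative mass over the graph *)

Section Spread.
Variables (k0 K : nat) (q : 'I_n -> nat -> R).
Hypothesis q_hist : forall i t, (k0 <= t + B)%N -> (t <= k0)%N -> 0 <= q i t.
Hypothesis q_super : superflow k0 K q.

Lemma superflow_ge0 i t : (k0 <= t + B)%N -> (t <= K)%N -> 0 <= q i t.
Proof.
elim/ltn_ind: t i => -[|t] IH i k0t tK.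
  by apply: q_hist => //; lia.
case: (leqP t.+1 k0) => [/q_hist->//|k0t'].
apply: le_trans (q_super _ k0t' tK).
apply: addr_ge0.
  by rewrite mulr_ge0 ?keep_ge0// IH//; lia.
apply: sumr_ge0 => j Eji; rewrite big_nat_cond; apply: sumr_ge0 => s.
have := tau_lag t Eji; have := tau_le j i t.+1.
move=> *; rewrite mulr_ge0 ?send_ge0// IH//; lia.
Qed.

Lemma superflow_keep i k : (k0 <= k)%N -> (k < K)%N ->
  N^-1 * q i k <= q i k.+1.
Proof.
move=> k0k kK; apply: le_trans (q_super _ k0k kK).
rewrite -[leLHS]addr0; apply: lerD.
  by apply: ler_wpM2r (keep_ge _ _); apply: superflow_ge0; lia.
apply: sumr_ge0 => j Eji; rewrite big_nat_cond; apply: sumr_ge0 => s.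
have := tau_lag k Eji; have := tau_le j i k.+1.
move=> *; rewrite mulr_ge0 ?send_ge0// superflow_ge0//; lia.
Qed.

Lemma superflow_send i j k t : (k0 <= k)%N -> (k < K)%N -> E i j ->
  wake i t -> (tau i j k <= t < tau i j k.+1)%N -> N^-1 * q i t <= q j k.+1.
Proof.
move=> k0k kK Eij wit /andP[t1 t2]; apply: le_trans (q_super _ k0k kK).
have pos i' s : E i' j -> (tau i' j k <= s < tau i' j k.+1)%N ->
    0 <= send i' s * q i' s.
  move=> Ei' /andP[s1 s2]; have := tau_lag k Ei'; have := tau_le i' j k.+1.
  move=> *; rewrite mulr_ge0 ?send_ge0// superflow_ge0//; lia.
rewrite -[leLHS]add0r; apply: lerD.
  by rewrite mulr_ge0 ?keep_ge0// superflow_ge0//; lia.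
rewrite (bigD1 i)//= -[leLHS]addr0; apply: lerD; last first.
  apply: sumr_ge0 => i' /andP[Ei' _]; rewrite big_nat_cond.
  by apply: sumr_ge0 => s; rewrite andbT; exact: pos.
rewrite (big_cat_nat t1 (ltnW t2))/= -[leLHS]add0r; apply: lerD.
  rewrite big_nat_cond; apply: sumr_ge0 => s /andP[/andP[s1 s2] _].
  by apply: pos => //; lia.
rewrite big_ltn// -[leLHS]addr0; apply: lerD; last first.
  rewrite big_nat_cond; apply: sumr_ge0 => s /andP[/andP[s1 s2] _].
  by apply: pos => //; lia.
rewrite {1}/send wit ler_wpM2r ?invN_le// superflow_ge0//.
  have := tau_lag k Eij; lia.
have := tau_le i j k.+1; lia.
Qed.

Lemma superflow_keep_iter i k m : (k0 <= k)%N -> (k + m <= K)%N ->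
  N^-1 ^+ m * q i k <= q i (k + m)%N.
Proof.
move=> k0k; elim: m => [|m IH] mK; first by rewrite expr0 mul1r addn0.
rewrite exprS -mulrA addnS; apply: le_trans (superflow_keep _ _ _); try lia.
by rewrite ler_wpM2l ?(ltW invN_gt0)// IH//; lia.
Qed.

(** The least [m] such that [t] is counted as absorbed after iteration [t + m] marks the crossing;
    [tau_lag] bounds it by [B]. *)
Lemma tau_crossing i j t : E i j ->
  exists2 k, (t <= k <= t + B)%N & (tau i j k <= t < tau i j k.+1)%N.
Proof.
move=> Eij.
have Pex : exists m, (t < tau i j (t + m).+1)%N.
  by exists B; have := tau_lag (t + B).+1 Eij; lia.
case: (ex_minnP Pex) => m tm mmin.
have mB : (m <= B)%N by apply: mmin; have := tau_lag (t + B).+1 Eij; lia.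
exists (t + m)%N; first by rewrite leq_addr leq_add2l.
rewrite tm andbT; case: m {mB} tm mmin => [|m] tm mmin.
  by rewrite addn0 tau_le.
rewrite leqNgt addnS; apply/negP => /mmin; lia.
Qed.

(** Room for one edge: less than [Lu] iterations until the sender wakes up, at most [B] until the
    share is absorbed, and the absorbing iteration. *)
Let W := (Lu + B).+1.

Lemma superflow_hop i j t : E i j -> (k0 <= t)%N -> (t + W <= K)%N ->
  N^-1 ^+ W * q i t <= q j (t + W)%N.
Proof.
move=> Eij k0t tW; rewrite /W in tW *.
have [t1 /andP[tt1 t1L] wt1] := wakeP i t.
have [k /andP[t1k kB] cross] := tau_crossing t1 Eij.
have q1 : N^-1 ^+ (t1 - t) * q i t <= q i t1.
  rewrite -{2}(subnKC tt1); apply: superflow_keep_iter => //; lia.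
have q2 : N^-1 * q i t1 <= q j k.+1 by apply: superflow_send => //; lia.
have q3 : N^-1 ^+ (t + W - k.+1) * q j k.+1 <= q j (t + W)%N.
  rewrite -{2}(@subnKC k.+1 (t + W)) /W; last by lia.
  by apply: superflow_keep_iter; lia.
apply: le_trans q3; rewrite /W.
apply: (@le_trans _ _ (N^-1 ^+ (t + (Lu + B).+1 - k.+1) *
   (N^-1 * (N^-1 ^+ (t1 - t) * q i t)))); last first.
  rewrite ler_wpM2l ?exprn_ge0 ?(ltW invN_gt0)//; apply: le_trans q2.
  by rewrite ler_wpM2l ?(ltW invN_gt0).
rewrite !mulrA -exprSr -exprD; apply: ler_wpM2r.
  by apply: superflow_ge0; lia.
by apply: ler_wiXn2l; rewrite ?(ltW invN_gt0) ?invN_le1//; lia.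
Qed.

Lemma superflow_path i p t : path E i p -> (k0 <= t)%N ->
  (t + size p * W <= K)%N ->
  N^-1 ^+ (size p * W) * q i t <= q (last i p) (t + size p * W)%N.
Proof.
elim: p i t => [|j p IH] i t /=.
  by move=> *; rewrite mul0n expr0 mul1r addn0.
move=> /andP[Eij pj] k0t tK.
have := IH j (t + W)%N pj; rewrite mulSn -addnA => IHj.
apply: le_trans (IHj _ _); rewrite /W; try (rewrite /W in tK *; lia).
rewrite exprD mulrAC mulrC ler_wpM2l ?exprn_ge0 ?(ltW invN_gt0)//.
by apply: superflow_hop => //; rewrite /W in tK *; lia.
Qed.

(** A path without repeated vertices has at most [n] edges, so [n * W] iterations suffice to follow
    it; after that the mass is kept in place. Each iteration costs at most a factor [N^-1], whether
    spent keeping or sending. *)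
Lemma superflow_spread i j t k : (k0 <= t)%N -> (t + n * W <= k)%N ->
  (k <= K)%N -> N^-1 ^+ (k - t) * q i t <= q j k.
Proof.
move=> k0t tk kK.
have /connectP[p0 p0p jlast] := connE i j.
rewrite {}jlast; have [p pp up _] := shortenP p0p.
have sp : (size p <= n)%N.
  apply: ltnW; rewrite -[leqRHS]card_ord; have /card_uniqP/= <- := up.
  exact: max_card.
have spW : (size p * W <= n * W)%N by rewrite leq_mul2r sp orbT.
have h1 : N^-1 ^+ (size p * W) * q i t <= q (last i p) (t + size p * W)%N.
  apply: superflow_path => //; apply: leq_trans kK; apply: leq_trans tk.
  by rewrite leq_add2l.
set t' := (t + size p * W)%N in h1 *.
have tt' : (t <= t')%N by exact: leq_addr.
have t'k : (t' <= k)%N by apply: leq_trans tk; rewrite leq_add2l.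
have h2 : N^-1 ^+ (k - t') * q (last i p) t' <= q (last i p) k.
  rewrite -{2}(subnKC t'k); apply: superflow_keep_iter.
    exact: leq_trans tt'.
  by rewrite subnKC.
apply: le_trans h2; apply: (@le_trans _ _ (N^-1 ^+ (k - t') *
   (N^-1 ^+ (size p * W) * q i t))); last first.
  by rewrite ler_wpM2l// exprn_ge0 ?(ltW invN_gt0).
rewrite mulrA -exprD; suff -> : (k - t' + size p * W = k - t)%N by [].
by rewrite /t' subnDA subnK// leq_subRL ?(leq_trans tt').
Qed.

End Spread.

Lemma ler_inflow (q q' : 'I_n -> nat -> R) j k :
  (forall i t, (k <= t + B)%N -> (t <= k)%N -> q i t <= q' i t) ->
  inflow q j k <= inflow q' j k.
Proof.
move=> qq'; apply: lerD.
  by rewrite ler_wpM2l ?keep_ge0 ?qq' ?leq_addr.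
apply: ler_sum => i Eij; rewrite big_nat_cond [leRHS]big_nat_cond.
apply: ler_sum => t /andP[/andP[t1 t2] _].
have := tau_lag k Eij; have := tau_le i j k.+1.
by move=> *; rewrite ler_wpM2l ?send_ge0// qq'//; lia.
Qed.

Lemma inflow_lin (a : R) (q q' : 'I_n -> nat -> R) j k :
  inflow (fun i t => a * q i t - q' i t) j k = a * inflow q j k - inflow q' j k.
Proof.
rewrite /inflow [a * (_ + _)]mulrDr opprD addrACA; congr (_ + _).
  by rewrite mulrBr mulrCA.
rewrite mulr_sumr -sumrB; apply: eq_bigr => i _.
rewrite mulr_sumr -sumrB; apply: eq_bigr => t _.
by rewrite mulrBr mulrCA.
Qed.

Lemma inflow_ext (q q' : 'I_n -> nat -> R) j k :
  (forall i t, q i t = q' i t) -> inflow q j k = inflow q' j k.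
Proof.
move=> qq'; rewrite /inflow qq'; congr (_ + _); apply: eq_bigr => i _.
by apply: eq_bigr => t _; rewrite qq'.
Qed.

Lemma ler_in_transit (q q' : 'I_n -> nat -> R) k :
  (forall i t, (k <= t + B)%N -> (t < k)%N -> q i t <= q' i t) ->
  in_transit q k <= in_transit q' k.
Proof.
move=> qq'; apply: ler_sum => j _; apply: ler_sum => i Eij.
rewrite big_nat_cond [leRHS]big_nat_cond.
apply: ler_sum => t /andP[/andP[t1 t2] _].
have := tau_lag k Eij.
by move=> *; rewrite ler_wpM2l ?send_ge0// qq'//; lia.
Qed.

Lemma in_transitZ (a : R) (q : 'I_n -> nat -> R) k :
  in_transit (fun i t => a * q i t) k = a * in_transit q k.
Proof.
rewrite /in_transit mulr_sumr; apply: eq_bigr => j _.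
rewrite mulr_sumr; apply: eq_bigr => i _.
by rewrite mulr_sumr; apply: eq_bigr => t _; rewrite mulrCA.
Qed.

Lemma in_transit_const_le (a : R) k : 0 <= a ->
  in_transit (fun _ _ => a) k <= (n * n * B)%:R * a.
Proof.
move=> a0; apply: (@le_trans _ _ (\sum_(j < n) \sum_(i < n) B%:R * a)).
  apply: ler_sum => j _; rewrite big_mkcond; apply: ler_sum => i _.
  case: ifPn => [Eij|_]; last by rewrite mulr_ge0.
  apply: (@le_trans _ _ (\sum_(tau i j k <= t < k) a)).
    by apply: ler_sum => t _; rewrite ler_piMl ?send_le1.
  rewrite sumr_const_nat -[leLHS]mulr_natl ler_wpM2r// ler_nat.
  by have := tau_lag k Eij; lia.
by rewrite !sumr_const card_ord -mulrnA -[leLHS]mulr_natl mulrA -natrM.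
Qed.

(** * The weights [y]: bounded, and bounded away from zero *)

Section Ratio.
Variable y : 'I_n -> nat -> R.
Hypothesis y_flow : forall K, flow K y (fun _ _ => 0).
Hypothesis y0 : forall i, y i 0%N = 1.

Let H := (n * (Lu + B).+1)%N.

Lemma y_inflow j k : y j k.+1 = inflow y j k.
Proof.
rewrite (@y_flow k.+1)//; apply: inflow_ext => i t; exact: subr0.
Qed.

Lemma y_superflow K : superflow 0 K y.
Proof. by move=> j k _ _; rewrite y_inflow. Qed.

Lemma y_hist i t : (0 <= t + B)%N -> (t <= 0)%N -> 0 <= y i t.
Proof. by move=> _; rewrite leqn0 => /eqP ->; rewrite y0. Qed.

Lemma y_ge0 i k : 0 <= y i k.
Proof. exact: (superflow_ge0 y_hist (@y_superflow k)). Qed.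

Lemma y_total k : \sum_j y j k + in_transit y k = n%:R.
Proof.
have <- : total y (fun _ _ => 0) k = n%:R.
  elim: k => [|k IH].
    by rewrite total0 (eq_bigr _ (fun i _ => y0 i)) sumr_const card_ord.
  by rewrite (totalS (@y_flow k.+1) (ltnSn k)) big1// subr0.
rewrite /total; congr (_ + _).
by rewrite /in_transit; do 3!apply: eq_bigr => ? _; rewrite subr0.
Qed.

Lemma in_transit_ge0 q k : (forall i t, 0 <= q i t) -> 0 <= in_transit q k.
Proof.
move=> q0; apply: sumr_ge0 => j _; apply: sumr_ge0 => i _.
by apply: sumr_ge0 => t _; rewrite mulr_ge0 ?send_ge0.
Qed.

Lemma y_le i k : y i k <= n%:R.
Proof.
rewrite -(y_total k) (bigD1 i)//= -addrA lerDl addr_ge0//.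
  by apply: sumr_ge0 => j _; exact: y_ge0.
by apply: in_transit_ge0; exact: y_ge0.
Qed.

Let yinv := ((1 + n * B) * n.+1 ^ (H + B))%N.

(** At time [k - H] the total mass [n] consists of [n] agents' weights and at most [n * n * B]
    shares under way, and each weight involved is at most [N ^+ (H + B)] times [y i k] by
    [superflow_spread]. Dividing by [n] gives [yinv]. *)
Lemma y_ge i k : yinv%:R^-1 <= y i k.
Proof.
have yinv_gt0 : (0 < yinv)%N by rewrite muln_gt0 expn_gt0.
have n_gt0 : (0 < n)%N by case: (i) => m; exact: leq_ltn_trans.
rewrite -(ler_pM2l (x := yinv%:R)) ?ltr0n// divff ?pnatr_eq0 -?lt0n//.
rewrite natrM natrX -/N.
(* Too early for a full spread: the initial unit of mass, reduced at most by the factor [N] per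
   iteration, is enough. *)
have [kH|Hk] := ltnP k H.
  have := superflow_keep_iter y_hist (@y_superflow k) i (leq0n 0) (leqnn k).
  rewrite y0 mulr1 add0n => yk.
  apply: (@le_trans _ _ (N ^+ (H + B) * y i k)); last first.
    by rewrite ler_wpM2r ?y_ge0// ler_peMl ?exprn_ge0 ?(ltW N_gt0)// ler1n.
  apply: (@le_trans _ _ (N ^+ (H + B) * N^-1 ^+ k)).
    have -> : (H + B = k + (H + B - k))%N by lia.
    rewrite exprD mulrAC exprVn divff ?mul1r ?exprn_ege1//.
    by rewrite expf_neq0// pnatr_eq0.
  by rewrite ler_wpM2l// exprn_ge0// (ltW N_gt0).
have kk0 : (k = k - H + H)%N by lia.
set k0 := (k - H)%N in kk0.
have yt j t : (k0 <= t + B)%N -> (t <= k0)%N ->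
    y j t <= N ^+ (H + B) * y i k.
  move=> k0t tk0.
  have sp : N^-1 ^+ (k - t) * y j t <= y i k.
    by apply: (superflow_spread y_hist (@y_superflow k)) => //; lia.
  rewrite -(@ler_pM2l _ (N^-1 ^+ (H + B))) ?exprn_gt0 ?invN_gt0//.
  rewrite mulrA -exprMn mulVf ?pnatr_eq0// expr1n mul1r; apply: le_trans sp.
  rewrite ler_wpM2r ?y_ge0//.
  by apply: ler_wiXn2l; rewrite ?(ltW invN_gt0) ?invN_le1//; lia.
set Y := N ^+ (H + B) * y i k in yt *.
have Y0 : 0 <= Y by rewrite mulr_ge0 ?y_ge0// exprn_ge0// (ltW N_gt0).
rewrite -mulrA -/Y -(ler_pM2l (x := n%:R)) ?ltr0n// mulr1 mulrA -natrM.
rewrite -{1}(y_total k0) mulnDr muln1 mulnA natrD mulrDl.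
apply: lerD.
  apply: (@le_trans _ _ (\sum_(j < n) Y)).
    by apply: ler_sum => j _; apply: yt; rewrite ?leq_addr.
  by rewrite sumr_const card_ord mulr_natl.
apply: le_trans (in_transit_const_le k0 Y0).
by apply: ler_in_transit => j t kt /ltnW; exact: yt.
Qed.

Lemma y_gt0 i k : 0 < y i k.
Proof.
by apply: lt_le_trans (y_ge i k); rewrite invr_gt0 ltr0n muln_gt0 expn_gt0.
Qed.

Lemma y_lower : exists2 c, 0 < c & forall i k, c <= y i k.
Proof.
exists yinv%:R^-1; last by move=> i k; exact: y_ge.
by rewrite invr_gt0 ltr0n muln_gt0 expn_gt0.
Qed.

(** The reciprocal contraction rate: spreading costs [N ^+ (H + B)], the weight of the source is at
    least [yinv%:R^-1], and one more factor [N] bounds the weight of the target. *)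
Let etainv := (yinv * n.+1 ^ (H + B).+1)%N.

Lemma etainv_gt0 : (0 < etainv)%N.
Proof. by rewrite !muln_gt0 !expn_gt0. Qed.

(** * Contraction of the ratios in the presence of perturbations *)

Section Perturbed.
Variables (K : nat) (pi : nat -> R).
Hypothesis pi_ge0 : forall t, 0 <= pi t.

Definition psum k : R := \sum_(0 <= t < k) pi t.

Lemma psum_mono a b : (a <= b)%N -> psum a <= psum b.
Proof.
move=> ab; rewrite /psum (big_cat_nat (leq0n a) ab)/= lerDl.
by apply: sumr_ge0 => t _.
Qed.

Lemma psum_S a b : (a < b)%N -> psum a + pi a <= psum b.
Proof.
by move=> ab; apply: le_trans (psum_mono ab); rewrite /psum big_nat_recr.
Qed.

(* [z] plus accumulated perturbation stays below the running maximum: the gap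
   to it, weighted by [y], is moved around like mass and never destroyed. *)
Lemma gap_superflow x p M k0 :
  flow K x p -> (forall i t, (t < K)%N -> `|p i t| <= pi t * y i t) ->
  superflow k0 K
    (fun i t => (M + psum t - psum (k0 - B)) * y i t - x i t).
Proof.
move=> fl pb j k k0k kK; rewrite y_inflow fl// -inflow_lin.
apply: ler_inflow => i t kt tk.
have := pb i t (leq_ltn_trans tk kK); rewrite ler_norml => /andP[p1 p2].
have tS : psum t + pi t <= psum k.+1 by apply: psum_S.
have : (psum t + pi t) * y i t <= psum k.+1 * y i t.
  by rewrite ler_wpM2r ?y_ge0.
move: p1 p2; lra.
Qed.

(** The last [B + 1] times are bounded jointly, since shares sent at any of them may still be under
    way: they are the true state of the system. *)
Definition window x k a b : Prop := forall i t, (k <= t + B)%N -> (t <= k)%N ->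
  a * y i t <= x i t <= b * y i t.

(** By this symmetry only upper bounds need a direct proof. *)
Lemma windowN x k a b : window x k a b ->
  window (fun i t => - x i t) k (- b) (- a).
Proof.
by move=> w i t h1 h2; rewrite !mulNr !lerN2 andbC; exact: w.
Qed.

Lemma flowN K' x p : flow K' x p ->
  flow K' (fun i t => - x i t) (fun i t => - p i t).
Proof.
move=> fl j k kK; rewrite fl// -[LHS]add0r -[X in X - _](mul0r (inflow x j k)).
by rewrite -inflow_lin; apply: inflow_ext => i t; ring.
Qed.

Section OneSided.
Variables (x p : 'I_n -> nat -> R) (k0 : nat) (M : R).
Hypothesis xflow : flow K x p.
Hypothesis p_le : forall i t, (t < K)%N -> `|p i t| <= pi t * y i t.
Hypothesis xM : forall i t, (k0 <= t + B)%N -> (t <= k0)%N ->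
  x i t <= M * y i t.

Let q i t := (M + psum t - psum (k0 - B)) * y i t - x i t.

Let q_ge i t : (k0 <= t + B)%N -> M * y i t - x i t <= q i t.
Proof.
move=> h1; rewrite /q lerD2r ler_wpM2r ?y_ge0// -addrA lerDl subr_ge0.
by apply: psum_mono; lia.
Qed.

Let q_hist i t : (k0 <= t + B)%N -> (t <= k0)%N -> 0 <= q i t.
Proof.
by move=> h1 h2; apply: le_trans (q_ge i h1); rewrite subr_ge0 xM.
Qed.

Let q_super : superflow k0 K q.
Proof. exact: (@gap_superflow x p M k0 xflow p_le). Qed.

Lemma ratio_le j k : (k0 <= k + B)%N -> (k <= K)%N ->
  x j k <= (M + psum k - psum (k0 - B)) * y j k.
Proof.
by move=> k0k kK; rewrite -subr_ge0; apply: (superflow_ge0 q_hist q_super).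
Qed.

(** The gap of agent [i] below the ceiling [M] at time [k0] spreads like mass and keeps every agent
    below the ceiling by a fixed fraction of it. The range of [k] is a whole window, so that the
    argument can be repeated. *)
Lemma ratio_contract i j k : (k0 + H <= k)%N -> (k <= k0 + H + B)%N ->
  (k <= K)%N -> x j k <=
  (M + psum k - psum (k0 - B) - etainv%:R^-1 * (M - x i k0 / y i k0)) * y j k.
Proof.
move=> k1 k2 kK.
have sp : N^-1 ^+ (k - k0) * q i k0 <= q j k.
  by apply: (superflow_spread q_hist q_super).
rewrite mulrBl lerBrDr addrC -lerBrDr.
apply: le_trans sp.
have yi0 : 0 < y i k0 := y_gt0 i k0.
have g0 : 0 <= M - x i k0 / y i k0.
  by rewrite subr_ge0 ler_pdivrMr// xM// leq_addr.
have qi : y i k0 * (M - x i k0 / y i k0) <= q i k0.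
  apply: le_trans (q_ge i (leq_addr _ _)).
  by rewrite mulrBr mulrCA divff ?mulr1 ?gt_eqF// mulrC.
apply: (@le_trans _ _ (N^-1 ^+ (H + B) * (y i k0 * (M - x i k0 / y i k0)))).
  rewrite mulrAC mulrA ler_wpM2r//.
  rewrite /etainv natrM natrX -/N invfM -exprVn exprS.
  set P := N^-1 ^+ (H + B).
  have -> : yinv%:R^-1 * (N^-1 * P) * y j k =
      P * (yinv%:R^-1 * (N^-1 * y j k)) by ring.
  rewrite ler_wpM2l ?exprn_ge0 ?(ltW invN_gt0)// -[leRHS]mulr1.
  apply: ler_pM; rewrite ?invr_ge0//.
  - by rewrite mulr_ge0 ?y_ge0// (ltW invN_gt0).
  - exact: y_ge.
  - rewrite mulrC ler_pdivrMr// mul1r; apply: le_trans (y_le _ _) _.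
    by rewrite ler_nat.
apply: ler_pM => //.
- by rewrite exprn_ge0// (ltW invN_gt0).
- by rewrite mulr_ge0 ?y_ge0.
- by apply: ler_wiXn2l; rewrite ?(ltW invN_gt0) ?invN_le1//; lia.
Qed.

End OneSided.

Section TwoSided.
Variables (x p : 'I_n -> nat -> R).
Hypothesis xflow : flow K x p.
Hypothesis p_le : forall i t, (t < K)%N -> `|p i t| <= pi t * y i t.

Let pN_le i t : (t < K)%N -> `|- p i t| <= pi t * y i t.
Proof. by rewrite normrN; exact: p_le. Qed.

(** Wherever the ratio of agent [i] lies, its distances to the two ends add up to [b - a]; so the
    ends together move inwards by the fraction [etainv%:R^-1] of the length, up to the perturbations
    since the start of the window. *)
Lemma window_contract (i : 'I_n) k0 a b : window x k0 a b ->
  (k0 + (H + B) <= K)%N ->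
  exists a' b', window x (k0 + (H + B)) a' b' /\
    b' - a' = (1 - etainv%:R^-1) * (b - a) +
              2 * (psum (k0 + (H + B)) - psum (k0 - B)).
Proof.
move=> w kK; set e := etainv%:R^-1.
set D := psum (k0 + (H + B)) - psum (k0 - B).
pose z := x i k0 / y i k0.
exists (a - D + e * (z - a)), (b + D - e * (b - z)); split; last by ring.
move=> j t t1 t2.
have tD : psum t <= psum (k0 + (H + B)) by exact: psum_mono.
apply/andP; split; last first.
  apply: le_trans (ratio_contract (M := b) (k0 := k0) xflow p_le _ i j _ _ _) _;
    try lia.
    by move=> i' t' h1 h2; have /andP[] := w i' t' h1 h2.
  by rewrite ler_wpM2r ?y_ge0// /D /z -/e; lra.
rewrite -lerN2.
apply: le_trans (ratio_contract (M := - a) (k0 := k0) (flowN xflow) pN_le _ i j _ _ _) _;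
    try lia.
  by move=> i' t' h1 h2; have /andP[] := windowN w i' h1 h2.
rewrite -[leRHS]mulNr ler_wpM2r ?y_ge0// /D /z -/e mulNr; lra.
Qed.

Lemma window_extend k a b : window x 0 a b -> (k <= K)%N ->
  window x k (a - psum k) (b + psum k).
Proof.
move=> w kK j t t1 t2.
have tD : psum t <= psum k by exact: psum_mono.
have p0 : psum 0 = 0 by rewrite /psum big_geq.
apply/andP; split; last first.
  apply: le_trans (ratio_le (M := b) (k0 := 0) xflow p_le _ j _ _) _; try lia.
    by move=> i' t' h1 h2; have /andP[] := w i' t' h1 h2.
  by rewrite ler_wpM2r ?y_ge0// sub0n p0; lra.
rewrite -lerN2.
apply: le_trans (ratio_le (M := - a) (k0 := 0) (flowN xflow) pN_le _ j _ _) _;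
    try lia.
  by move=> i' t' h1 h2; have /andP[] := windowN w i' h1 h2.
by rewrite -[leRHS]mulNr ler_wpM2r ?y_ge0// sub0n p0; lra.
Qed.

(** The total combines ratios with weights of sum [n]. A share under way stems from [x - p] instead
    of [x], which costs a perturbation of a time between [k - B] and [k]. *)
Lemma window_total k a b : window x k a b -> (k <= K)%N ->
  (a - (psum k - psum (k - B))) * n%:R <= total x p k
    <= (b + (psum k - psum (k - B))) * n%:R.
Proof.
move=> w kK; rewrite -(y_total k) !mulrDr /total.
rewrite -!in_transitZ !mulr_sumr.
have D0 : 0 <= psum k - psum (k - B) by rewrite subr_ge0 psum_mono// leq_subr.
have piD t : (k <= t + B)%N -> (t < k)%N -> pi t <= psum k - psum (k - B).
  move=> h1 h2; have := psum_S h2.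
  have : psum (k - B) <= psum t by apply: psum_mono; lia.
  lra.
apply/andP; split; apply: lerD.
- apply: ler_sum => j _; have /andP[+ _] := w j k (leq_addr _ _) (leqnn k).
  apply: le_trans; rewrite ler_wpM2r ?y_ge0//; lra.
- apply: ler_in_transit => i t h1 h2.
  have /andP[+ _] := w i t h1 (ltnW h2).
  have := p_le i (leq_trans h2 kK); rewrite ler_norml => /andP[_ +].
  have := ler_wpM2r (y_ge0 i t) (piD t h1 h2); lra.
- apply: ler_sum => j _; have /andP[_ +] := w j k (leq_addr _ _) (leqnn k).
  move/le_trans; apply; rewrite ler_wpM2r ?y_ge0//; lra.
- apply: ler_in_transit => i t h1 h2.
  have /andP[_ +] := w i t h1 (ltnW h2).
  have := p_le i (leq_trans h2 kK); rewrite ler_norml => /andP[+ _].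
  have := ler_wpM2r (y_ge0 i t) (piD t h1 h2); lra.
Qed.

End TwoSided.
End Perturbed.

Let harm (Q : R) (t : nat) : R := Q / t.+1%:R.

Let harm_ge0 (Q : R) t : 0 <= Q -> 0 <= harm Q t.
Proof. by move=> Q0; rewrite divr_ge0. Qed.

(** For [t >= k - B] one has [k + 1 <= (B + 1) * (t + 1)], so each of the at most [m + B] terms is
    at most [(B + 1) * Q / (k + 1)]. *)
Lemma psum_harm Q k m : 0 <= Q ->
  psum (harm Q) (k + m) - psum (harm Q) (k - B) <=
  ((m + B) * B.+1)%:R * (Q / k.+1%:R).
Proof.
move=> Q0; rewrite /psum (@big_cat_nat _ _ _ (k - B) 0 (k + m))/=; [|lia|lia].
rewrite addrAC subrr add0r.
apply: (@le_trans _ _ (\sum_(k - B <= t < k + m) B.+1%:R * (Q / k.+1%:R))).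
  rewrite big_nat_cond [leRHS]big_nat_cond; apply: ler_sum.
  move=> t /andP[/andP[t1 _] _]; rewrite /harm mulrCA ler_wpM2l//.
  rewrite ler_pdivlMr ?ltr0n// mulrC ler_pdivrMr ?ltr0n// -natrM ler_nat.
  by nia.
rewrite sumr_const_nat -[leLHS]mulr_natl mulrA -natrM.
rewrite ler_wpM2r ?divr_ge0// ler_nat leq_mul2r; lia.
Qed.

(** Decay of order 1/k is compatible with a fixed contraction every [T] iterations: half of the rate
    pays for the new perturbations, the other half for replacing [k - T] by [k] in the denominator.
    The constant is chosen before the horizon, the flow and [X0], [Q]. *)
Lemma window_shrink : exists2 A : R, 0 <= A & forall K x p (X0 Q : R),
  0 <= X0 -> 0 <= Q -> flow K x p -> (forall i, `|x i 0%N| <= X0) ->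
  (forall i t, (t < K)%N -> `|p i t| <= Q / t.+1%:R * y i t) ->
  forall k, (k <= K)%N -> 'I_n ->
  exists a b, window x k a b /\ b - a <= A * (X0 + Q) / k.+1%:R.
Proof.
pose T := (H + B)%N; pose K0 := (T * (2 * etainv))%N.
pose c := (2 * ((T + B) * B.+1))%N.
pose A := (2 * K0.+1 ^ 2 + 2 * c * etainv)%N.
exists A%:R => // K x p X0 Q X00 Q0 fl x0 pb k kK i.
have eta_gt0 := etainv_gt0.
have e0 : 0 < etainv%:R :> R by rewrite ltr0n.
have h0 := fun t => harm_ge0 t Q0.
have XQ0 : 0 <= X0 + Q by rewrite addr_ge0.
elim/ltn_ind: k kK => k IH kK.
have [kK0|K0k] := ltnP k K0.+1.
  have w0 : window x 0 (- X0) X0.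
    move=> j t _; rewrite leqn0 => /eqP ->; rewrite y0 !mulr1.
    by have := x0 j; rewrite ler_norml.
  have := window_extend h0 fl pb w0 kK => wk.
  exists (- X0 - psum (harm Q) k), (X0 + psum (harm Q) k); split => //.
  have Sk : psum (harm Q) k <= k%:R * Q.
    rewrite mulr_natl -[X in _ *+ X]subn0 -sumr_const_nat /psum.
    apply: ler_sum => t _; rewrite /harm ler_piMr// invf_le1 ?ltr0n//.
    by rewrite ler1n.
  rewrite ler_pdivlMr ?ltr0n//.
  have kX : 0 <= k%:R * X0 by rewrite mulr_ge0.
  have step : X0 + psum (harm Q) k - (- X0 - psum (harm Q) k) <=
      2 * k.+1%:R * (X0 + Q) by rewrite -natr1; lra.
  apply: le_trans (ler_wpM2r _ step) _ => //.
  rewrite -!mulrA [_ * k.+1%:R]mulrC !mulrA ler_wpM2r// -!natrM ler_nat /A.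
  apply: leq_trans (leq_addr _ _); rewrite -mulnA leq_mul2l/=.
  by rewrite expnS expn1 leq_mul.
have Tk : (T <= k)%N.
  apply: leq_trans (ltnW K0k); rewrite /K0.
  by rewrite leq_pmulr// muln_gt0.
pose k0 := (k - T)%N; have kE : (k = k0 + T)%N by rewrite /k0 subnK.
have Tpos : (0 < T)%N.
  by rewrite /T /H addn_gt0 muln_gt0; case: (i) => m /(leq_ltn_trans (leq0n m)) ->.
have [a [b [w ab]]] : exists a b, window x k0 a b /\
    b - a <= A%:R * (X0 + Q) / k0.+1%:R by apply: IH; lia.
have k0K : (k0 + T <= K)%N by rewrite -kE.
have [a' [b' [w' ab'E]]] := window_contract h0 fl pb i w k0K.
exists a', b'; split; first by rewrite kE.
rewrite ab'E -/T; have := psum_harm k0 T Q0.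
set D := psum _ _ - psum _ _ => Dle.
rewrite -/H -/yinv -/etainv.
set e := etainv%:R^-1 : R.
have e1 : e <= 1 by rewrite /e invf_le1// ler1n.
have kk : 2 * etainv%:R * T%:R <= k.+1%:R :> R.
  rewrite -!natrM ler_nat; apply: leq_trans (leqnSn k).
  by rewrite mulnC; apply: leq_trans (ltnW K0k).
set s := (X0 + Q) / k0.+1%:R.
have s0 : 0 <= s by rewrite divr_ge0.
have ab' : b - a <= A%:R * s by rewrite /s mulrA.
have Dle' : 2 * D <= c%:R * s.
  rewrite /c natrM -mulrA ler_wpM2l//; apply: le_trans Dle _.
  by rewrite ler_wpM2l// /s ler_wpM2r ?invr_ge0// lerDr.
have Ac : c%:R <= e / 2 * A%:R.
  rewrite /A natrD mulrDr [X in _ <= _ + X](_ : _ = c%:R).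
    by rewrite lerDr mulr_ge0// divr_ge0// invr_ge0.
  rewrite 2!natrM /e; move: (c%:R) (etainv%:R) e0 => C eta eta0.
  by field; rewrite gt_eqF.
have es : (1 - e / 2) / k0.+1%:R <= k.+1%:R^-1.
  rewrite ler_pdivrMr ?ltr0n// [leRHS]mulrC ler_pdivlMr ?ltr0n//.
  have -> : k0.+1%:R = k.+1%:R - T%:R :> R.
    by rewrite kE -addSn natrD addrK.
  have : T%:R <= e / 2 * k.+1%:R.
    rewrite /e -invfM ler_pdivlMl ?mulr_gt0//. 
    by rewrite [etainv%:R * 2]mulrC.
  lra.
apply: (@le_trans _ _ ((1 - e) * (A%:R * s) + c%:R * s)).
  by apply: lerD => //; rewrite ler_wpM2l// subr_ge0.
apply: (@le_trans _ _ ((1 - e / 2) * A%:R * s)).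
  rewrite [_ * (_ * s)]mulrA -mulrDl ler_wpM2r//; lra.
have -> : (1 - e / 2) * A%:R * s =
    A%:R * (X0 + Q) * ((1 - e / 2) / k0.+1%:R) by rewrite /s; ring.
by rewrite ler_wpM2l// mulr_ge0.
Qed.

Theorem pushsum_consensus : exists2 C : R, 0 <= C & forall K x p (X0 Q : R),
  0 <= X0 -> 0 <= Q -> flow K x p -> (forall i, `|x i 0%N| <= X0) ->
  (forall i t, (t < K)%N -> `|p i t| <= Q / t.+1%:R * y i t) ->
  forall k i, (k <= K)%N ->
  `|x i k / y i k - total x p k / n%:R| <= C * (X0 + Q) / k.+1%:R.
Proof.
have [A A0 shrink] := window_shrink.
exists (A + (B * B.+1)%:R); first by rewrite addr_ge0.
move=> K x p X0 Q X00 Q0 fl x0 pb k i kK.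
have h0 := fun t => harm_ge0 t Q0.
have [a [b [w ab]]] := shrink _ _ _ _ _ X00 Q0 fl x0 pb _ kK i.
have n_gt0 : 0 < n%:R :> R.
  by rewrite ltr0n; case: (i) => m; exact: leq_ltn_trans.
have /andP[t1 t2] := window_total h0 pb w kK.
have /andP[x1 x2] := w i k (leq_addr _ _) (leqnn k).
have yi := y_gt0 i k.
rewrite -ler_pdivlMr// in t1; rewrite -ler_pdivrMr// in t2.
rewrite -ler_pdivlMr// in x1; rewrite -ler_pdivrMr// in x2.
have := psum_harm k 0 Q0; rewrite addn0 add0n => Dle.
have Dle' : psum (harm Q) k - psum (harm Q) (k - B) <=
    (B * B.+1)%:R * (X0 + Q) / k.+1%:R.
  apply: le_trans Dle _; rewrite -mulrA ler_wpM2l//.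
  by rewrite ler_wpM2r ?invr_ge0// lerDr.
have -> : (A + (B * B.+1)%:R) * (X0 + Q) / k.+1%:R =
    A * (X0 + Q) / k.+1%:R + (B * B.+1)%:R * (X0 + Q) / k.+1%:R by ring.
move: ab Dle' t1 t2 x1 x2; rewrite ler_norml.
set U := A * _ / _; set V := _%:R * _ / _.
move: (x i k / y i k) (total x p k / n%:R) => u v *.
by apply/andP; split; lra.
Qed.

End Ratio.

End PushSum.

(** * The network of the algorithm *)

Section Clock.
Variables (n : nat) (E : rel 'I_n) (wake : 'I_n -> nat -> bool).
Variable delay : 'I_n -> 'I_n -> nat -> option nat.

(* One more than the last wake-up time before [k], and [0] if there was none:
   this is [kappa + 1] in the notation of the algorithm. *)
Fixpoint last_wake (i : 'I_n) (k : nat) : nat :=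
  if k is k'.+1 then if wake i k' then k else last_wake i k' else 0.

Lemma last_wake_le i k : (last_wake i k <= k)%N.
Proof. by elim: k => //= k IH; case: ifP => // _; exact: leqW. Qed.

Lemma last_wake_asleep i k t : (last_wake i k <= t < k)%N -> ~~ wake i t.
Proof.
elim: k => [|k IH] /=; first by lia.
case: ifPn => [_|wk]; first by lia.
move=> /andP[t1]; rewrite ltnS leq_eqVlt => /orP[/eqP ->//|t2].
by apply: IH; rewrite t1.
Qed.

(* [kappa_ji + 1], where [kappa_ji] is the stamp kept by [j] for the link from
   [i]; unlike that stamp it visibly does not depend on the noise. *)
Fixpoint absorbed (i j : 'I_n) (k : nat) : nat :=
  if k is k'.+1 then
    if wake j k' then
      maxn (absorbed i j k')
        (\max_(p <- inbox E wake delay j k' | p.1 == i) p.2.+1)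
    else absorbed i j k'
  else 0.

Lemma mem_inbox i k p : (p \in inbox E wake delay i k) =
  (p.2 < k)%N && processed E wake delay p.1 i p.2 (k - p.2)%N.
Proof.
rewrite /inbox mem_filter andbC; congr (_ && _).
apply/allpairsP/idP => [[[j t] /= [_ + ->]]|pk].
  by rewrite mem_iota.
by exists p; rewrite mem_enum mem_iota/= pk; split => //; case: p {pk}.
Qed.

Lemma absorbed_mono i j k : (absorbed i j k <= absorbed i j k.+1)%N.
Proof. by rewrite /=; case: ifP => // _; exact: leq_maxl. Qed.

Lemma absorbed_homo i j : {homo absorbed i j : k l / (k <= l)%N}.
Proof. exact: homo_leq leqnn leq_trans (absorbed_mono i j). Qed.

Lemma absorbed_le i j k : (absorbed i j k <= k)%N.
Proof.
elim: k => //= k IH; case: ifP => _; last exact: leqW.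
rewrite geq_max leqW//=; apply/bigmax_leqP_seq => p + _.
by rewrite mem_inbox => /andP[/leqW].
Qed.

Variables (Ldel Lu Lf : nat).
Hypothesis comm : communication_assumption E wake delay Ldel Lu Lf.

Lemma last_wake_lag i k : (k < last_wake i k + Lu)%N.
Proof.
rewrite ltnNge; apply/negP => kL.
have [k' /andP[k1 k2] wk] := comm_wake comm i (last_wake i k).
have /negP[] // : ~~ wake i k' by apply: (@last_wake_asleep _ k); lia.
Qed.

Lemma wake_count i k m : (m <= \sum_(k <= t < k + m * Lu) wake i t)%N.
Proof.
elim: m => // m IH; rewrite mulSnr addnA.
rewrite (@big_cat_nat _ _ _ (k + m * Lu))/= ?leq_addr// -addn1.
apply: leq_add => //.
have [k' /andP[k1 k2] wk] := comm_wake comm i (k + m * Lu).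
rewrite (@big_cat_nat _ _ _ k')/= ?(ltnW k2)//.
by rewrite (big_ltn k2) wk addnCA leq_addr.
Qed.

Let B := (Lf.+1 * Lu + Ldel)%N.

(** [Lf + 1] wake-ups of the sender fit in [Lf.+1 * Lu] iterations; one of these messages gets
    through, within [Ldel]. Carrying a running sum, it makes up for all previous losses. *)
Lemma absorbed_lag i j k : E i j -> (k <= absorbed i j k + B)%N.
Proof.
move=> Eij; have [kB|Bk] := leqP k B; first exact: leq_trans (leq_addl _ _).
pose k1 := (k - B)%N; pose k2 := (k1 + Lf.+1 * Lu)%N.
have [t [l [t12 wt dt]]] : exists t l,
    [/\ (k1 <= t < k2)%N, wake i t & delay i j t = Some l].
  apply: contrapT => noex.
  have := @comm_failure _ _ _ _ _ _ _ comm i j k1 k2 Eij.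
  rewrite leqNgt (wake_count i k1 Lf.+1) => /(_ _)/negP; apply => //.
  move=> t t12 wt; case dt : (delay i j t) => [l|//].
  by case: noex; exists t, l.
have pr : processed E wake delay i j t l by rewrite /processed Eij wt dt eqxx.
have [l1 wl] := comm_effective comm pr.
have lL := comm_delay comm pr.
have tl : (t.+1 <= absorbed i j (t + l).+1)%N.
  rewrite /= wl leq_max; apply/orP; right.
  by apply: (@leq_bigmax_seq _ _ (fun p => p.1 == i) (fun p => p.2.+1) (i, t));
    rewrite ?mem_inbox//= addKn pr -addn1 leq_add2l l1.
have : (absorbed i j (t + l).+1 <= absorbed i j k)%N.
  apply: absorbed_homo; rewrite /k2 /k1 /B in t12 *; lia.
by rewrite /k1 in t12; lia.
Qed.

End Clock.

(** * The variables of the algorithm as flows of mass *)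

Section Run.
Variables (R : realType) (d n : nat) (E : rel 'I_n).
Variables (wake : 'I_n -> nat -> bool).
Variable delay : 'I_n -> 'I_n -> nat -> option nat.
Variables (alpha : nat -> R) (f : 'I_n -> 'rV[R]_d -> R).
Variables (x0 : 'I_n -> 'rV[R]_d) (e : 'I_n -> nat -> 'rV[R]_d).

Local Notation sys k := (rasgp E wake delay alpha f x0 e k).
Local Notation ag k i := (agents (sys k) i).
Local Notation tau := (absorbed E wake delay).

Definition beta (i : 'I_n) (k : nat) : R :=
  \sum_(last_wake wake i k <= t < k.+1) alpha t.

Definition noisy_grad (i : 'I_n) (k : nat) : 'rV[R]_d :=
  grad (f i) (vz (ag k i)) + e i k.

Definition pert (i : 'I_n) (k : nat) : 'rV[R]_d :=
  if wake i k then beta i k *: noisy_grad i k else 0.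

Let xshare i t : 'rV[R]_d := send R E wake i t *: (vx (ag t i) - pert i t).
Let yshare i t : R := send R E wake i t * vy (ag t i).
Let xsent i k := \sum_(0 <= t < k) xshare i t.
Let ysent i k := \sum_(0 <= t < k) yshare i t.

(** The shares of [j] taken into account are those of times below [T j]. The flag [rs] is false
    between the receptions and the pull, when the starred copies are ahead of the plain ones. *)
Definition link_ok (rs : bool) (a : agent R d n) (T : 'I_n -> nat) : Prop :=
  forall j, [/\ rhosx (links a j) = xsent j (T j),
    rhosy (links a j) = ysent j (T j), kappa_in (links a j) = (T j)%:Z - 1,
    rs -> rhox (links a j) = xsent j (T j) &
    rs -> rhoy (links a j) = ysent j (T j)].

Definition sent_ok (s : system R d n) (i : 'I_n) (t : nat) : Prop :=
  sent s i t = Message (xsent i t.+1) (ysent i t.+1) t%:Z.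

Record run_ok (k : nat) (s : system R d n) : Prop := RunOk {
  ok_kappa : forall i, kappa (agents s i) = (last_wake wake i k)%:Z - 1;
  ok_phix : forall i, phix (agents s i) = xsent i k;
  ok_phiy : forall i, phiy (agents s i) = ysent i k;
  ok_vz : forall i, vz (agents s i) = (vy (agents s i))^-1 *: vx (agents s i);
  ok_sent : forall i t, (t < k)%N -> wake i t -> sent_ok s i t;
  ok_links : forall i, link_ok true (agents s i) (fun j => tau j i k) }.

Lemma link_ok_ext rs a T T' :
  (forall j, T j = T' j) -> link_ok rs a T -> link_ok rs a T'.
Proof. by move=> TT' lok j; rewrite -TT'. Qed.

Lemma receive_fields (a : agent R d n) j m :
  [/\ vx (receive a j m) = vx a, vy (receive a j m) = vy a,
      phix (receive a j m) = phix a, phiy (receive a j m) = phiy a &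
      kappa (receive a j m) = kappa a] /\
  forall j', rhox (links (receive a j m) j') = rhox (links a j') /\
             rhoy (links (receive a j m) j') = rhoy (links a j').
Proof.
rewrite /receive; case: ifP => _; split => //= j'.
by case: eqP => [->|].
Qed.

Lemma foldl_receive_fields (s : system R d n) (l : seq ('I_n * nat)) a :
  let a' := foldl (fun a p => receive a p.1 (sent s p.1 p.2)) a l in
  [/\ vx a' = vx a, vy a' = vy a, phix a' = phix a, phiy a' = phiy a &
      kappa a' = kappa a] /\
  forall j', rhox (links a' j') = rhox (links a j') /\
             rhoy (links a' j') = rhoy (links a j').
Proof.
elim: l a => [|p l IH] a /=; first by split.
have [[-> -> -> -> ->] rl] := IH (receive a p.1 (sent s p.1 p.2)).
have [[-> -> -> -> ->] rr] := receive_fields a p.1 (sent s p.1 p.2).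
by split => // j; have [-> ->] := rl j; exact: rr.
Qed.

(** Outdated messages are ignored and each message carries a running sum, so only the greatest stamp
    per sender matters, whatever the order of processing. *)
Lemma foldl_receive_links (s : system R d n) (l : seq ('I_n * nat)) a T :
  (forall p, p \in l -> sent_ok s p.1 p.2) -> link_ok false a T ->
  link_ok false (foldl (fun a p => receive a p.1 (sent s p.1 p.2)) a l)
    (fun j => maxn (T j) (\max_(p <- l | p.1 == j) p.2.+1)).
Proof.
elim: l a T => [|p l IH] a T sok lok /=.
  by move=> j; rewrite big_nil maxn0; exact: lok.
have lok' : link_ok false (receive a p.1 (sent s p.1 p.2))
    (fun j => maxn (T j) (if p.1 == j then p.2.+1 else 0)).
  have [_ _ kp _ _] := lok p.1.
  rewrite /receive (sok p (mem_head _ _))/= kp.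
  case: ifPn => [lt|ge] j.
    have [sx sy sk _ _] := lok j; rewrite /= eq_sym.
    case: eqP => [<-|_]/=; last by rewrite maxn0.
    by rewrite (maxn_idPr _); [split => //=; lia|lia].
  have [sx sy sk _ _] := lok j.
  case: eqP => [pj|_]; last by rewrite maxn0.
  by rewrite (maxn_idPl _) ?sx//; rewrite -pj; lia.
have sok' q : q \in l -> sent_ok s q.1 q.2.
  by move=> ql; apply: sok; rewrite inE ql orbT.
apply: link_ok_ext (IH _ _ sok' lok') => j.
by rewrite big_cons; case: ifP => _; rewrite ?maxn0 ?maxnA.
Qed.

Lemma outdeg_card i : #|[set j | E i j]| = outdeg E i.
Proof.
rewrite /outdeg sum1_card; apply: eq_card => j.
by apply/idP/idP; rewrite inE.
Qed.

Lemma kappa_beta i k (a : agent R d n) :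
  kappa a = (last_wake wake i k)%:Z - 1 ->
  \sum_(0 <= t < k.+1 | kappa a < t%:Z) alpha t = beta i k.
Proof.
move=> ->; rewrite /beta.
rewrite [RHS](@big_nat_widenl _ _ _ _ 0)//; apply: eq_bigl => t /=.
by lia.
Qed.

(** Everything passed around is a prefix sum of shares: [phix] the sum so far, a message the sum
    including its sending time, and the [rho] variables the sum over times below [absorbed]. *)
Lemma run_invariant k : run_ok k (sys k).
Proof.
elim: k => [|k IH].
  split => //=; rewrite /xsent /ysent.
  - by move=> i; rewrite big_geq.
  - by move=> i; rewrite big_geq.
  - by move=> i; rewrite invr1 scale1r.
  - by move=> i j; rewrite /xsent /ysent /= !big_geq//; split.
pose pushed i := push_step #|[set j | E i j]|
  (gradient_step alpha k (grad (f i) (vz (ag k i)) + e i k) (ag k i)).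
have push_vx i : wake i k -> vx (pushed i) = xshare i k.
  move=> wi; rewrite /= outdeg_card /xshare /send /pert wi.
  by rewrite (kappa_beta (ok_kappa IH i)).
have push_vy i : wake i k -> vy (pushed i) = yshare i k.
  by move=> wi; rewrite /= outdeg_card /yshare /send wi mulrC.
have push_phix i : wake i k -> phix (pushed i) = xsent i k.+1.
  move=> wi; rewrite /xsent big_nat_recr//= -push_vx//=.
  by rewrite (ok_phix IH).
have push_phiy i : wake i k -> phiy (pushed i) = ysent i k.+1.
  move=> wi; rewrite /ysent big_nat_recr//= -push_vy//=.
  by rewrite (ok_phiy IH).
have asleep_x i : ~~ wake i k -> xsent i k.+1 = xsent i k.
  move=> wi; rewrite /xsent big_nat_recr//= /xshare /send (negbTE wi).
  by rewrite scale0r addr0.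
have asleep_y i : ~~ wake i k -> ysent i k.+1 = ysent i k.
  move=> wi; rewrite /ysent big_nat_recr//= /yshare /send (negbTE wi).
  by rewrite mul0r addr0.
have inbox_ok i : forall p, p \in inbox E wake delay i k ->
    sent_ok (sys k) p.1 p.2.
  move=> p; rewrite mem_inbox => /andP[pk /and3P[_ wp _]].
  exact: (ok_sent IH).
have push_links i : link_ok false (pushed i) (fun j => tau j i k).
  by move=> j; have [? ? ? _ _] := ok_links IH i j; split.
have foldF i := foldl_receive_fields (sys k) (inbox E wake delay i k) (pushed i).
have foldL i := foldl_receive_links (inbox_ok i) (push_links i).
split => [i|i|i|i|i t|i] /=; rewrite -/(pushed _).
- case: (boolP (wake i k)) => wi /=; last exact: (ok_kappa IH).
  by have [[_ _ _ _ ->] _] := foldF i; rewrite /=; lia.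
- case: (boolP (wake i k)) => wi /=; last by rewrite asleep_x// (ok_phix IH).
  by have [[_ _ -> _ _] _] := foldF i; rewrite push_phix.
- case: (boolP (wake i k)) => wi /=; last by rewrite asleep_y// (ok_phiy IH).
  by have [[_ _ _ -> _] _] := foldF i; rewrite push_phiy.
- by case: (boolP (wake i k)) => wi; [by []|exact: (ok_vz IH)].
- rewrite ltnS leq_eqVlt => /orP[/eqP->|tk] wi; rewrite /sent_ok/= -/(pushed _).
    by rewrite wi eqxx/= /broadcast push_phix// push_phiy.
  by rewrite (ltn_eqF tk) andbF; exact: (ok_sent IH).
- case: (boolP (wake i k)) => wi /=; last exact: (ok_links IH).
  by move=> j; have [? ? ? _ _] := foldL i j; split.
Qed.

Lemma vzE i k : vz (ag k i) = (vy (ag k i))^-1 *: vx (ag k i).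
Proof. exact: ok_vz (run_invariant k) i. Qed.

Lemma vz_asleep i k : ~~ wake i k -> vz (ag k.+1 i) = vz (ag k i).
Proof. by rewrite /= => /negbTE ->. Qed.

(** What is pulled over a link is a difference of two prefix sums, hence exactly the block of shares
    absorbed at this iteration. *)
Lemma vx_step j k : vx (ag k.+1 j) = keep R E wake j k *: (vx (ag k j) - pert j k) +
  \sum_(i | E i j) \sum_(tau i j k <= t < tau i j k.+1) xshare i t.
Proof.
have ok := run_invariant k; have okS := run_invariant k.+1.
have split_sum i : xsent i (tau i j k.+1) - xsent i (tau i j k) =
    \sum_(tau i j k <= t < tau i j k.+1) xshare i t.
  rewrite /xsent (@big_cat_nat _ _ _ (tau i j k) 0 (tau i j k.+1))//=.
    by rewrite addrAC subrr add0r.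
  exact: absorbed_mono.
have [wj|wj] := boolP (wake j k); last first.
  rewrite /keep /pert [in LHS]/= (negbTE wj).
  rewrite subr0 scale1r big1 ?addr0// => i _.
  by rewrite big_geq//= (negbTE wj).
have := ok_links okS j.
rewrite /keep /pert [in LHS]/= wj /=.
set a := foldl _ _ _ => lk.
rewrite /pull_step/=; congr (_ + _).
  rewrite /a; have [[-> _ _ _ _] _] := foldl_receive_fields (sys k)
    (inbox E wake delay j k) (push_step #|[set i | E j i]|
  (gradient_step alpha k (grad (f j) (vz (ag k j)) + e j k) (ag k j))).
  by rewrite /= outdeg_card (kappa_beta (ok_kappa ok j)).
apply: eq_big => [i|i Eij]; first by rewrite inE.
have [rx _ _ _ _] := lk i.
rewrite -split_sum /= wj; congr (_ - _).
  by move: rx; rewrite /= wj.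
rewrite /a.
have [_ /(_ i)[-> _]] := foldl_receive_fields (sys k)
    (inbox E wake delay j k) (push_step #|[set i | E j i]|
  (gradient_step alpha k (grad (f j) (vz (ag k j)) + e j k) (ag k j))).
by have [_ _ _ /(_ isT) -> _] := ok_links ok j i.
Qed.

Lemma vy_step j k : vy (ag k.+1 j) = keep R E wake j k * vy (ag k j) +
  \sum_(i | E i j) \sum_(tau i j k <= t < tau i j k.+1) yshare i t.
Proof.
have ok := run_invariant k; have okS := run_invariant k.+1.
have split_sum i : ysent i (tau i j k.+1) - ysent i (tau i j k) =
    \sum_(tau i j k <= t < tau i j k.+1) yshare i t.
  rewrite /ysent (@big_cat_nat _ _ _ (tau i j k) 0 (tau i j k.+1))//=.
    by rewrite addrAC subrr add0r.
  exact: absorbed_mono.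
have [wj|wj] := boolP (wake j k); last first.
  rewrite /keep [in LHS]/= (negbTE wj).
  rewrite mul1r big1 ?addr0// => i _.
  by rewrite big_geq//= (negbTE wj).
have := ok_links okS j.
rewrite /keep [in LHS]/= wj /=.
set a := foldl _ _ _ => lk.
rewrite /pull_step/=; congr (_ + _).
  rewrite /a; have [[_ -> _ _ _] _] := foldl_receive_fields (sys k)
    (inbox E wake delay j k) (push_step #|[set i | E j i]|
  (gradient_step alpha k (grad (f j) (vz (ag k j)) + e j k) (ag k j))).
  by rewrite /= outdeg_card mulrC.
apply: eq_big => [i|i Eij]; first by rewrite inE.
have [_ ry _ _ _] := lk i.
rewrite -split_sum /= wj; congr (_ - _).
  by move: ry; rewrite /= wj.
rewrite /a.
have [_ /(_ i)[_ ->]] := foldl_receive_fields (sys k)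
    (inbox E wake delay j k) (push_step #|[set i | E j i]|
  (gradient_step alpha k (grad (f j) (vz (ag k j)) + e j k) (ag k j))).
by have [_ _ _ _ /(_ isT) ->] := ok_links ok j i.
Qed.

Lemma vx_flow K c : flow E wake tau K (fun i k => vx (ag k i) 0 c)
  (fun i k => pert i k 0 c).
Proof.
move=> j k _; rewrite vx_step /inflow !mxE; congr (_ + _).
rewrite summxE; apply: eq_bigr => i _.
by rewrite summxE; apply: eq_bigr => t _; rewrite /xshare !mxE.
Qed.

Lemma vy_flow K : flow E wake tau K (fun i k => vy (ag k i)) (fun _ _ => 0).
Proof.
move=> j k _; rewrite vy_step /inflow subr0; congr (_ + _).
by apply: eq_bigr => i _; apply: eq_bigr => t _; rewrite /yshare subr0.
Qed.

End Run.

(** * Euclidean geometry and gradients *)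

Section Euclid.
Variables (R : realType) (d : nat).
Implicit Types u v w : 'rV[R]_d.

Definition dotp u v : R := \sum_(c < d) u 0 c * v 0 c.

Lemma dotpC u v : dotp u v = dotp v u.
Proof. by apply: eq_bigr => c _; rewrite mulrC. Qed.

Lemma dotpDl u v w : dotp (u + v) w = dotp u w + dotp v w.
Proof. by rewrite -big_split; apply: eq_bigr => c _; rewrite mxE mulrDl. Qed.

Lemma dotpZl a u v : dotp (a *: u) v = a * dotp u v.
Proof. by rewrite mulr_sumr; apply: eq_bigr => c _; rewrite mxE mulrA. Qed.

Lemma dotpNl u v : dotp (- u) v = - dotp u v.
Proof. by rewrite -scaleN1r dotpZl mulN1r. Qed.

Lemma dotpBl u v w : dotp (u - v) w = dotp u w - dotp v w.
Proof. by rewrite dotpDl dotpNl. Qed.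

Lemma dotpDr u v w : dotp u (v + w) = dotp u v + dotp u w.
Proof. by rewrite dotpC dotpDl !(dotpC u). Qed.

Lemma dotpZr a u v : dotp u (a *: v) = a * dotp u v.
Proof. by rewrite dotpC dotpZl dotpC. Qed.

Lemma dotpNr u v : dotp u (- v) = - dotp u v.
Proof. by rewrite dotpC dotpNl dotpC. Qed.

Lemma dotpBr u v w : dotp u (v - w) = dotp u v - dotp u w.
Proof. by rewrite dotpDr dotpNr. Qed.

Lemma dotp_suml I (r : seq I) (P : pred I) (F : I -> 'rV[R]_d) v :
  dotp (\sum_(i <- r | P i) F i) v = \sum_(i <- r | P i) dotp (F i) v.
Proof.
elim/big_rec2: _ => [|i x y _ <-]; last by rewrite dotpDl.
by rewrite /dotp big1// => c _; rewrite mxE mul0r.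
Qed.

Lemma dotp_ge0 u : 0 <= dotp u u.
Proof. by apply: sumr_ge0 => c _; rewrite -expr2 sqr_ge0. Qed.

Lemma sqr_enorm u : enorm u ^+ 2 = dotp u u.
Proof.
rewrite /enorm sqr_sqrtr; first by apply: eq_bigr => c _; rewrite expr2.
by apply: sumr_ge0 => c _; rewrite sqr_ge0.
Qed.

Lemma enorm_ge0 u : 0 <= enorm u. Proof. exact: sqrtr_ge0. Qed.

Lemma enormD_sqr u v :
  enorm (u + v) ^+ 2 = enorm u ^+ 2 + 2 * dotp u v + enorm v ^+ 2.
Proof. by rewrite !sqr_enorm dotpDl !dotpDr (dotpC v u); ring. Qed.

Lemma enormZ a u : enorm (a *: u) = `|a| * enorm u.
Proof.
rewrite -(ger0_norm (enorm_ge0 u)) -normrM -sqrtr_sqr exprMn sqr_enorm.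
rewrite /enorm; congr Num.sqrt; rewrite expr2 -mulrA -dotpZr -dotpZl.
by apply: eq_bigr => c _; rewrite expr2.
Qed.

Lemma enormN u : enorm (- u) = enorm u.
Proof. by rewrite -scaleN1r enormZ normrN normr1 mul1r. Qed.

Lemma enorm0 : enorm (0 : 'rV[R]_d) = 0.
Proof. by rewrite -(scale0r 0) enormZ normr0 mul0r. Qed.

Lemma enormB u v : enorm (u - v) = enorm (v - u).
Proof. by rewrite -opprB enormN. Qed.

Lemma coord_le_enorm u c : `|u 0 c| <= enorm u.
Proof.
rewrite -sqrtr_sqr ler_sqrt; last first.
  by apply: sumr_ge0 => i _; rewrite sqr_ge0.
rewrite (bigD1 c)//= lerDl; apply: sumr_ge0 => i _; exact: sqr_ge0.
Qed.

(** Cauchy-Schwarz, by expanding the square of [enorm v *: u - enorm u *: v]; zero norms are set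
    apart to allow the division. *)
Lemma dotp_le u v : dotp u v <= enorm u * enorm v.
Proof.
have [u0|u0] := eqVneq (enorm u) 0.
  rewrite u0 mul0r /dotp big1// => c _.
  have : `|u 0 c| <= 0 by rewrite -u0 coord_le_enorm.
  by rewrite normr_le0 => /eqP ->; rewrite mul0r.
have [v0|v0] := eqVneq (enorm v) 0.
  rewrite v0 mulr0 /dotp big1// => c _.
  have : `|v 0 c| <= 0 by rewrite -v0 coord_le_enorm.
  by rewrite normr_le0 => /eqP ->; rewrite mulr0.
have uv0 : 0 < 2 * (enorm u * enorm v).
  by rewrite mulr_gt0// mulr_gt0// lt_neqAle enorm_ge0 andbT eq_sym.
have := dotp_ge0 (enorm v *: u - enorm u *: v).
rewrite dotpBl !dotpBr !dotpZl !dotpZr -!sqr_enorm (dotpC v u).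
by move=> h; rewrite -(ler_pM2l uv0); lra.
Qed.

Lemma ler_enormD u v : enorm (u + v) <= enorm u + enorm v.
Proof.
rewrite -(ler_pXn2r (n := 2))// ?nnegrE ?addr_ge0 ?enorm_ge0//.
by rewrite enormD_sqr; have := dotp_le u v; lra.
Qed.

Lemma ler_enormB u v w : enorm (u - w) <= enorm (u - v) + enorm (v - w).
Proof. by apply: le_trans (ler_enormD _ _); rewrite addrA subrK. Qed.

Lemma ler_enorm_sum I (r : seq I) (P : pred I) (F : I -> 'rV[R]_d) :
  enorm (\sum_(i <- r | P i) F i) <= \sum_(i <- r | P i) enorm (F i).
Proof.
elim/big_rec2: _ => [|i x y _ h]; first by rewrite enorm0.
by apply: le_trans (ler_enormD _ _) _; rewrite lerD2l.
Qed.

Lemma enorm_le_sum u : enorm u <= \sum_(c < d) `|u 0 c|.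
Proof.
rewrite {1}(row_sum_delta u); apply: le_trans (ler_enorm_sum _ _ _) _.
apply: ler_sum => c _; rewrite enormZ -[leRHS]mulr1 ler_wpM2l//.
rewrite /enorm (bigD1 c)//= big1 => [|i ic]; last first.
  by rewrite mxE (negbTE ic) andbF expr0n.
by rewrite mxE !eqxx addr0 expr1n sqrtr1.
Qed.

Lemma enorm_bound u (a : R) : (forall c, `|u 0 c| <= a) -> enorm u <= d%:R * a.
Proof.
move=> ua; apply: le_trans (enorm_le_sum u) _.
apply: (@le_trans _ _ (\sum_(c < d) a)); first exact: ler_sum.
by rewrite sumr_const card_ord mulr_natl.
Qed.

End Euclid.

(** * First-order consequences of strong convexity and minimality *)

Section Gradient.
Variables (R : realType) (d : nat).
Implicit Types (f : 'rV[R]_d -> R) (v z : 'rV[R]_d).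

Lemma derive_dotp f z v : differentiable f z -> 'D_v f z = dotp (grad f z) v.
Proof.
move=> df; rewrite deriveE// {1}(row_sum_delta v) linear_sum/=.
apply: eq_bigr => c _; rewrite linearZ/= -deriveE// /grad mxE.
by rewrite mulrC.
Qed.

Lemma difference_quotient f z v : differentiable f z ->
  (fun t : R => t^-1 * (f (t *: v + z) - f z)) @ 0^'+ --> dotp (grad f z) v.
Proof.
move=> df; apply: cvg_dnbhs_at_right; rewrite -derive_dotp//.
exact: (@diff_derivable _ _ _ f z v df).
Qed.

(** Divide the defining inequality by [t] and let [t] decrease to 0. *)
Lemma strongly_convex_grad m f z1 z2 : differentiable f z2 ->
  strongly_convex m f ->
  dotp (grad f z2) (z1 - z2) + m / 2 * enorm (z1 - z2) ^+ 2 <= f z1 - f z2.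
Proof.
move=> df sc; set q := enorm _ ^+ 2; rewrite -lerBrDr.
have cvr : (fun t : R => f z1 - f z2 - m / 2 * (1 - t) * q) @ 0^'+ -->
    f z1 - f z2 - m / 2 * (1 - 0) * q.
  apply: cvg_at_right_filter; apply: cvgB; first exact: cvg_cst.
  apply: cvgMl; apply: cvgMr; apply: cvgB; first exact: cvg_cst.
  exact: cvg_id.
rewrite subr0 mulr1 in cvr.
apply: ler_cvg_to (@difference_quotient f z2 (z1 - z2) df) cvr _.
near=> t.
have t0 : 0 < t by near: t; exact: nbhs_right_gt.
have t1 : t < 1 by near: t; exact: nbhs_right_lt.
rewrite mulrC ler_pdivrMr//.
have := sc z1 z2 t (ltW t0) (ltW t1).
have -> : t *: z1 + (1 - t) *: z2 = t *: (z1 - z2) + z2.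
  by rewrite scalerBr scalerBl scale1r -addrA [- _ + _]addrC.
rewrite -/q; lra.
Unshelve. all: by end_near. Qed.

Lemma strongly_monotone_grad m f z1 z2 : (forall z, differentiable f z) ->
  strongly_convex m f ->
  m * enorm (z1 - z2) ^+ 2 <= dotp (grad f z1 - grad f z2) (z1 - z2).
Proof.
move=> df sc.
have h1 := strongly_convex_grad z1 (df z2) sc.
have h2 := strongly_convex_grad z2 (df z1) sc.
have e2 : dotp (grad f z1) (z2 - z1) = - dotp (grad f z1) (z1 - z2).
  by rewrite -dotpNr opprB.
rewrite dotpBl; rewrite e2 [enorm (z2 - z1)]enormB in h2; lra.
Qed.

(** At a minimizer the right difference quotients of the sum are nonnegative, along [v] as well as
    along [- v]. *)
Lemma grad_sum_min n (f : 'I_n -> 'rV[R]_d -> R) zs :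
  (forall i z, differentiable (f i) z) ->
  (forall z, \sum_(i < n) f i zs <= \sum_(i < n) f i z) ->
  forall v, dotp (\sum_(i < n) grad (f i) zs) v = 0.
Proof.
move=> df hmin.
have pos v : 0 <= dotp (\sum_(i < n) grad (f i) zs) v.
  have cv : (fun t : R => \sum_(i < n) t^-1 * (f i (t *: v + zs) - f i zs)) @ 0^'+
      --> \sum_(i < n) dotp (grad (f i) zs) v.
    by apply: cvg_big => [|i _]; [exact: add_continuous|exact: difference_quotient].
  rewrite dotp_suml; apply: (ler_cvg_to (cvg_cst 0) cv).
  near=> t.
  have t0 : 0 < t by near: t; exact: nbhs_right_gt.
  rewrite -mulr_sumr mulr_ge0 ?invr_ge0 ?(ltW t0)//.
  by rewrite sumrB subr_ge0.
move=> v; apply/eqP; rewrite eq_le pos andbT.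
by have := pos (- v); rewrite dotpNr oppr_ge0.
Unshelve. all: by end_near. Qed.

End Gradient.

(** * Deterministic bounds along a noise path *)

Lemma nat_above (R : realType) (x : R) : exists k : nat, x <= k%:R.
Proof.
exists (Num.bound `|x|); apply: le_trans (ler_norm x) (ltW _).
exact: archi_boundP.
Qed.

Section Path.
Variables (R : realType) (d n : nat) (E : rel 'I_n).
Variables (wake : 'I_n -> nat -> bool).
Variable delay : 'I_n -> 'I_n -> nat -> option nat.
Variables (f : 'I_n -> 'rV[R]_d -> R) (x0 : 'I_n -> 'rV[R]_d).
Variables (Ldel Lu Lf : nat).
Hypothesis n_gt0 : (0 < n)%N.
Hypothesis Lu_gt0 : (0 < Lu)%N.
Hypothesis comm : communication_assumption E wake delay Ldel Lu Lf.

(** * The mean of the mass and the evenly charged process [center] *)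

Section Center.
Variable alpha : nat -> R.

Local Notation sys e k := (rasgp E wake delay alpha f x0 e k).
Local Notation z e i k := (rasgp_z E wake delay alpha f x0 e i k).
Local Notation tau := (absorbed E wake delay).
Local Notation pertur e i k := (pert E wake delay alpha f x0 e i k).
Implicit Type e : 'I_n -> nat -> 'rV[R]_d.

(** The scalars [vy] undergo communication only, so they are the same on all noise paths; the zero
    path serves as representative. *)
Definition weight (i : 'I_n) (k : nat) : R :=
  vy (agents (sys (fun _ _ => 0) k) i).

Lemma weight0 i : weight i 0 = 1. Proof. by []. Qed.

Lemma weight_flow K : flow E wake tau K weight (fun _ _ => 0).
Proof. exact: vy_flow. Qed.

Lemma vy_weight e i k : vy (agents (sys e k) i) = weight i k.
Proof.
elim/ltn_ind: k i => -[//|k] IH j; rewrite /weight !vy_step IH//; congr (_ + _).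
apply: eq_bigr => i _; rewrite big_nat_cond [RHS]big_nat_cond.
apply: eq_bigr => t /andP[/andP[_ t2] _]; rewrite IH//.
exact: leq_trans t2 (absorbed_le _ _ _ _ _ _).
Qed.

Lemma zE e i k : z e i k = (weight i k)^-1 *: vx (agents (sys e k) i).
Proof. by rewrite /rasgp_z vzE vy_weight. Qed.

Lemma z_asleep e i k t : (last_wake wake i k <= t <= k)%N -> z e i t = z e i k.
Proof.
elim: k => [|k IH] /=; first by rewrite leqn0 => /eqP->.
case: (boolP (wake i k)) => wi /andP[t1 t2].
  by congr (z e i _); lia.
rewrite leq_eqVlt in t2; case/orP: t2 => [/eqP->//|t2].
by rewrite IH ?t1// /rasgp_z vz_asleep.
Qed.

Definition mass_mean e (k : nat) : 'rV[R]_d :=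
  \row_c (total E wake tau (fun i k => vx (agents (sys e k) i) 0 c)
            (fun i k => pertur e i k 0 c) k / n%:R).

Lemma mass_mean0 e : mass_mean e 0 = n%:R^-1 *: \sum_i x0 i.
Proof. by apply/rowP => c; rewrite !mxE total0 summxE mulrC. Qed.

Lemma mass_meanS e k :
  mass_mean e k.+1 = mass_mean e k - n%:R^-1 *: \sum_i pertur e i k.
Proof.
apply/rowP => c; rewrite !mxE.
rewrite (@totalS _ _ _ _ _ (@absorbed_mono _ _ _ _) (@absorbed_le _ _ _ _) k.+1)//.
  by rewrite summxE mulrBl [n%:R^-1 * _]mulrC.
exact: vx_flow.
Qed.

Fixpoint center e (k : nat) : 'rV[R]_d :=
  if k is k'.+1 then
    center e k' - (alpha k' / n%:R) *: (\sum_i grad (f i) (z e i k')) -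
    n%:R^-1 *: \sum_(i | wake i k') beta wake alpha i k' *: e i k'
  else n%:R^-1 *: \sum_i x0 i.

(* Agent [i] uses a gradient at its wake-up only, but as [z i] is constant
   between wake-ups the same steps may be charged one iteration at a time;
   [pending] is what [center] has been charged and the agents not yet. *)
Definition pending e i k : 'rV[R]_d :=
  \sum_(last_wake wake i k <= t < k) alpha t *: grad (f i) (z e i t).

Lemma pendingS e i k : pending e i k.+1 =
  pending e i k + alpha k *: grad (f i) (z e i k) -
  (if wake i k then beta wake alpha i k *: grad (f i) (z e i k) else 0).
Proof.
rewrite /pending [last_wake _ _ k.+1]/=; case: (boolP (wake i k)) => wi.
  rewrite big_geq//; apply/esym/eqP; rewrite subr_eq0 /beta scaler_suml.
  rewrite big_nat_recr ?last_wake_le//=; apply/eqP; congr (_ + _).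
  apply: eq_big_nat => t /andP[t1 t2]; rewrite (@z_asleep e i k t)//.
  by rewrite t1 ltnW.
by rewrite big_nat_recr ?last_wake_le//= subr0.
Qed.

(** The two processes are charged the same gradient terms at different times, and the same noise at
    the same times. *)
Lemma center_mass e k :
  center e k = mass_mean e k - n%:R^-1 *: \sum_i pending e i k.
Proof.
elim: k => [|k IH].
  rewrite mass_mean0 [X in _ - _ *: X]big1 ?scaler0 ?subr0// => i _.
  by rewrite /pending big_geq.
rewrite mass_meanS [LHS]/= {}IH.
have -> : \sum_i pending e i k.+1 =
    \sum_i pending e i k + alpha k *: (\sum_i grad (f i) (z e i k)) -
    \sum_i (if wake i k then beta wake alpha i k *: grad (f i) (z e i k) else 0).
  under eq_bigr => i _ do rewrite pendingS.
  by rewrite sumrB big_split/= -scaler_sumr.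
have -> : \sum_i pertur e i k =
    \sum_i (if wake i k then beta wake alpha i k *: grad (f i) (z e i k) else 0)
    + \sum_(i | wake i k) beta wake alpha i k *: e i k.
  rewrite [X in _ + X]big_mkcond -big_split/=; apply: eq_bigr => i _.
  rewrite /pert; case: ifP => _; last by rewrite addr0.
  by rewrite /noisy_grad scalerDr.
move: (mass_mean e k) (\sum_i pending e i k) => m p.
set g := \sum_i grad _ _; set q := \sum_i (if _ then _ else _).
set v := \sum_(i | _) _.
apply/rowP => c; rewrite !mxE; ring.
Qed.

End Center.

(** * Bounds on the iterates, uniform over noise paths *)

Variables (mu L : 'I_n -> R) (zstar : 'rV[R]_d) (b : R).
Hypothesis hdiff : forall i z, differentiable (f i) z.
Hypothesis hmu : forall i, 0 < mu i.
Hypothesis hconvex : forall i, strongly_convex (mu i) (f i).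
Hypothesis hL : forall i, 0 < L i.
Hypothesis hlip : forall i, lipschitz_grad (L i) (f i).
Hypothesis hzstar : forall z, \sum_(i < n) f i zstar <= \sum_(i < n) f i z.
Hypothesis b_ge0 : 0 <= b.

Let mutot := \sum_(i < n) mu i.
Definition stepsize (k : nat) : R :=
  if k == 0%N then 0 else n%:R / (mutot * k%:R).
Local Notation alpha := stepsize.
Let Ltot := \sum_(i < n) L i.
Let G := \sum_(i < n) enorm (grad (f i) zstar).

Local Notation z e i k := (rasgp_z E wake delay alpha f x0 e i k).
Local Notation w e k := (center alpha e k).

Definition noise_le (e : 'I_n -> nat -> 'rV[R]_d) : Prop :=
  forall i k, enorm (e i k) <= b.

Let nR_gt0 : 0 < n%:R :> R. Proof. by rewrite ltr0n. Qed.

Lemma mutot_gt0 : 0 < mutot.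
Proof.
rewrite /mutot (bigD1 (Ordinal n_gt0))//=; apply: ltr_pwDl => //.
by apply: sumr_ge0 => i _; exact: ltW.
Qed.

Lemma Ltot_ge0 : 0 <= Ltot.
Proof. by apply: sumr_ge0 => i _; exact: ltW. Qed.

Lemma L_le i : L i <= Ltot.
Proof.
by rewrite /Ltot (bigD1 i)//= lerDl; apply: sumr_ge0 => j _; exact: ltW.
Qed.

Lemma G_ge0 : 0 <= G.
Proof. by apply: sumr_ge0 => i _; exact: enorm_ge0. Qed.

Lemma grad_growth i u : enorm (grad (f i) u) <= G + Ltot * enorm (u - zstar).
Proof.
rewrite -{1}(subrK (grad (f i) zstar) (grad (f i) u)) addrC.
apply: le_trans (ler_enormD _ _) _; apply: lerD.
  rewrite /G (bigD1 i)//= lerDl; apply: sumr_ge0 => j _; exact: enorm_ge0.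
apply: le_trans (hlip _ _ _) _.
by rewrite ler_wpM2r ?enorm_ge0 ?L_le.
Qed.

Lemma grad_sum_lip (u v : 'I_n -> 'rV[R]_d) r :
  (forall i, enorm (u i - v i) <= r) ->
  enorm (\sum_i (grad (f i) (u i) - grad (f i) (v i))) <= Ltot * r.
Proof.
move=> uv; apply: le_trans (ler_enorm_sum _ _ _) _.
rewrite mulr_suml; apply: ler_sum => i _; apply: le_trans (hlip _ _ _) _.
by rewrite ler_wpM2l// ltW.
Qed.

Let gradF u := \sum_i grad (f i) u.

Lemma gradF_star v : dotp (gradF zstar) v = 0.
Proof. exact: grad_sum_min. Qed.

Lemma gradF_mono u :
  mutot * enorm (u - zstar) ^+ 2 <= dotp (gradF u) (u - zstar).
Proof.
rewrite -[leRHS]subr0 -(gradF_star (u - zstar)) -dotpBl /gradF -sumrB dotp_suml.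
rewrite mulr_suml; apply: ler_sum => i _.
exact: strongly_monotone_grad.
Qed.

Lemma gradF_lip u : enorm (gradF u) <= Ltot * enorm (u - zstar).
Proof.
have -> : gradF u = \sum_i (grad (f i) u - grad (f i) zstar).
  rewrite sumrB -[\sum_i grad (f i) zstar]/(gradF zstar).
  suff -> : gradF zstar = 0 by rewrite subr0.
  apply/rowP => c; have := gradF_star (delta_mx 0 c).
  rewrite /dotp (bigD1 c)//= big1 => [|j jc].
    by rewrite [delta_mx _ _ _ _]mxE !eqxx mulr1 addr0 => ->; rewrite mxE.
  by rewrite [delta_mx _ _ _ _]mxE (negbTE jc) andbF mulr0.
exact: grad_sum_lip.
Qed.

Lemma alpha_ge0 k : 0 <= alpha k.
Proof.
by rewrite /stepsize; case: eqP => // _; rewrite divr_ge0// mulr_ge0// ltW// mutot_gt0.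
Qed.

(** The factor 2 allows [k + 1] in place of [k] in the denominator, so that the bound makes sense at
    time 0. *)
Let ca := 2 * n%:R / mutot.

Lemma ca_ge0 : 0 <= ca.
Proof. by rewrite divr_ge0 ?mulr_ge0// ltW// mutot_gt0. Qed.

Lemma alpha_le k : alpha k <= ca / k.+1%:R.
Proof.
have m0 := mutot_gt0.
rewrite /stepsize; case: eqP => [_|/eqP k0].
  by rewrite divr_ge0// ca_ge0.
have k0' : 0 < k%:R :> R by rewrite ltr0n lt0n.
rewrite invfM mulrA [leRHS](_ : _ = n%:R / mutot * (2 / k.+1%:R)); last first.
  by rewrite /ca; ring.
rewrite ler_wpM2l ?divr_ge0 ?(ltW m0)//.
rewrite ler_pdivlMr ?ltr0n// mulrC ler_pdivrMr//.
by rewrite -natrM ler_nat mul2n -addnn -addn1 leq_add2l lt0n.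
Qed.

Lemma alpha_lag k t : (t <= k)%N -> (k < t + Lu)%N ->
  alpha t <= Lu%:R * ca / k.+1%:R.
Proof.
move=> tk kt; apply: le_trans (alpha_le t) _.
rewrite [leRHS](_ : _ = ca * (Lu%:R / k.+1%:R)); last by ring.
rewrite ler_wpM2l ?ca_ge0//.
rewrite ler_pdivlMr ?ltr0n// mulrC ler_pdivrMr ?ltr0n// -natrM ler_nat.
by nia.
Qed.

(** At most [Lu] step sizes, each at most [Lu * ca / (k + 1)] because its time is less than [Lu]
    iterations old. *)
Let cb := Lu%:R ^+ 2 * ca.

Lemma cb_ge0 : 0 <= cb. Proof. by rewrite mulr_ge0 ?ca_ge0// sqr_ge0. Qed.

Lemma alpha_window i k (a : nat -> R) : (forall t, 0 <= a t <= alpha t) ->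
  \sum_(last_wake wake i k <= t < k.+1) a t <= cb / k.+1%:R.
Proof.
move=> aa; have lw := last_wake_lag comm i k; have lk := last_wake_le wake i k.
apply: (@le_trans _ _ (\sum_(last_wake wake i k <= t < k.+1) (Lu%:R * ca / k.+1%:R))).
  rewrite big_nat_cond [leRHS]big_nat_cond; apply: ler_sum.
  move=> t /andP[/andP[t1 t2] _]; have /andP[_ /le_trans] := aa t; apply.
  by apply: alpha_lag; lia.
rewrite sumr_const_nat -[leLHS]mulr_natl.
rewrite [leRHS](_ : _ = Lu%:R * (Lu%:R * ca / k.+1%:R)); last by rewrite /cb; ring.
have c0 : 0 <= Lu%:R * ca / k.+1%:R.
  by apply: divr_ge0 => //; apply: mulr_ge0 => //; exact: ca_ge0.
rewrite ler_wpM2r// ler_nat; lia.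
Qed.

Lemma beta_le i k : beta wake alpha i k <= cb / k.+1%:R.
Proof. by apply: alpha_window => t; rewrite alpha_ge0 lexx. Qed.

Lemma beta_ge0 i k : 0 <= beta wake alpha i k.
Proof. by apply: sumr_ge0 => t _; exact: alpha_ge0. Qed.

Lemma pert_le e i k r : noise_le e -> enorm (z e i k - zstar) <= r ->
  enorm (pert E wake delay alpha f x0 e i k) <=
  cb / k.+1%:R * (G + Ltot * r + b).
Proof.
move=> eb zr; rewrite /pert; case: ifP => _; last first.
  rewrite enorm0 mulr_ge0 ?divr_ge0 ?cb_ge0// addr_ge0// addr_ge0 ?G_ge0//.
  by rewrite mulr_ge0 ?Ltot_ge0// (le_trans (enorm_ge0 _) zr).
rewrite enormZ ger0_norm ?beta_ge0//.
apply: ler_pM (beta_ge0 _ _) (enorm_ge0 _) (beta_le _ _) _.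
apply: le_trans (ler_enormD _ _) (lerD _ (eb i k)).
apply: le_trans (grad_growth _ _) _.
by rewrite lerD2l ler_wpM2l ?Ltot_ge0.
Qed.

Lemma pending_le e i k r : (forall t, (t < k)%N -> enorm (z e i t - zstar) <= r) ->
  0 <= r -> enorm (pending alpha e i k) <= cb / k.+1%:R * (G + Ltot * r).
Proof.
move=> zr r0; apply: le_trans (ler_enorm_sum _ _ _) _.
have g0 : 0 <= G + Ltot * r by rewrite addr_ge0 ?G_ge0 ?mulr_ge0 ?Ltot_ge0.
apply: (@le_trans _ _ (\sum_(last_wake wake i k <= t < k) alpha t * (G + Ltot * r))).
  rewrite big_nat_cond [leRHS]big_nat_cond; apply: ler_sum.
  move=> t /andP[/andP[_ tk] _]; rewrite enormZ ger0_norm ?alpha_ge0//.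
  rewrite ler_wpM2l ?alpha_ge0//; apply: le_trans (grad_growth _ _) _.
  by rewrite lerD2l ler_wpM2l ?Ltot_ge0 ?zr.
rewrite -mulr_suml ler_wpM2r//; apply: le_trans (beta_le i k).
by rewrite /beta big_nat_recr ?last_wake_le//= lerDl alpha_ge0.
Qed.

(** [C] depends neither on the path nor on [K] and [r], and iterates strictly before [K] control the
    agents at [K] itself: this is the form that an induction on time can use. *)
Lemma tracking : exists2 C, 0 <= C & forall e K r, noise_le e -> 0 <= r ->
  (forall i t, (t < K)%N -> enorm (z e i t - zstar) <= r) ->
  forall i k, (k <= K)%N -> enorm (z e i k - w e k) <= C * (1 + r) / k.+1%:R.
Proof.
have lag : forall i j k, E i j ->
    (k <= absorbed E wake delay i j k + (Lf.+1 * Lu + Ldel))%N.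
  exact: absorbed_lag comm.
have [cy cy0 ycy] := @y_lower R n E wake (absorbed E wake delay)
  _ Lu (@absorbed_mono _ _ _ _) (@absorbed_le _ _ _ _) lag (comm_wake comm)
  (comm_connected comm) _ (weight_flow alpha) (weight0 alpha).
have [C0 C00 cons] := @pushsum_consensus R n E wake (absorbed E wake delay)
  _ Lu (@absorbed_mono _ _ _ _) (@absorbed_le _ _ _ _) lag (comm_wake comm)
  (comm_connected comm) _ (weight_flow alpha) (weight0 alpha).
pose X0 := \sum_i enorm (x0 i).
have X00 : 0 <= X0 by apply: sumr_ge0 => i _; exact: enorm_ge0.
pose g := G + Ltot + b.
have g0 : 0 <= g by rewrite /g !addr_ge0 ?G_ge0 ?Ltot_ge0.
exists (d%:R * C0 * (X0 + cb * g / cy) + cb * g).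
  have D0 : 0 <= cb * g / cy := divr_ge0 (mulr_ge0 cb_ge0 g0) (ltW cy0).
  apply: addr_ge0 (mulr_ge0 cb_ge0 g0).
  by apply: mulr_ge0 (addr_ge0 X00 D0); rewrite mulr_ge0.
move=> e K r eb r0 zr i k kK.
have gr : G + Ltot * r + b <= g * (1 + r).
  rewrite /g; have := G_ge0; have := Ltot_ge0; have := b_ge0 => b0 L0 G0.
  have : 0 <= G * r by exact: mulr_ge0.
  have : 0 <= b * r by exact: mulr_ge0.
  by rewrite mulrDr mulr1 !mulrDl; lra.
have k1 : 0 < k.+1%:R :> R by rewrite ltr0n.
(* Consensus requires perturbations bounded relative to the weights, hence the division by their
   lower bound [cy]. *)
set Q := cb * (g * (1 + r)) / cy.
have Q0 : 0 <= Q.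
  apply: divr_ge0 (ltW cy0); apply: mulr_ge0 cb_ge0 _.
  by rewrite mulr_ge0// addr_ge0.
have zm : enorm (z e i k - mass_mean alpha e k) <=
    d%:R * (C0 * (X0 + Q) / k.+1%:R).
  apply: enorm_bound => c; rewrite !mxE zE mxE mulrC.
  apply: (cons K _ _ X0 Q X00 Q0 (@vx_flow R d n E wake delay alpha f x0 e K c)
    _ _ k i kK) => //.
  - move=> j /=; apply: le_trans (coord_le_enorm _ _) _.
    by rewrite /X0 (bigD1 j)//= lerDl; apply: sumr_ge0 => *; exact: enorm_ge0.
  - move=> j t tK; apply: le_trans (coord_le_enorm _ _) _.
    apply: le_trans (pert_le eb (zr j t tK)) _.
    have -> : Q / t.+1%:R * weight alpha j t =
      cb / t.+1%:R * (g * (1 + r) * (weight alpha j t / cy)) by rewrite /Q; ring.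
    rewrite ler_wpM2l ?divr_ge0 ?cb_ge0//; apply: le_trans gr _.
    have gr0 : 0 <= g * (1 + r) by rewrite mulr_ge0// addr_ge0.
    by apply: ler_peMr => //; rewrite ler_pdivlMr// mul1r.
have mw : enorm (mass_mean alpha e k - w e k) <= cb * (g * (1 + r)) / k.+1%:R.
  rewrite center_mass opprB addrCA subrr addr0 enormZ ger0_norm ?invr_ge0//.
  rewrite ler_pdivrMl//; apply: le_trans (ler_enorm_sum _ _ _) _.
  apply: (@le_trans _ _ (\sum_(j < n) cb * (g * (1 + r)) / k.+1%:R)).
    apply: ler_sum => j _.
    apply: le_trans (pending_le (r := r) _ r0) _.
      by move=> t tk; apply: zr; exact: leq_trans tk kK.
    rewrite mulrAC ler_wpM2r ?invr_ge0// ler_wpM2l ?cb_ge0//.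
    by apply: le_trans gr; rewrite lerDl.
  by rewrite sumr_const card_ord mulr_natl.
apply: le_trans (ler_enormB _ (mass_mean alpha e k) _) _.
apply: le_trans (lerD zm mw) _.
have -> : d%:R * (C0 * (X0 + Q) / k.+1%:R) + cb * (g * (1 + r)) / k.+1%:R =
  (d%:R * C0 * (X0 + Q) + cb * g * (1 + r)) / k.+1%:R by ring.
rewrite ler_wpM2r ?invr_ge0// [leRHS]mulrDl lerD2r -[leRHS]mulrA.
rewrite ler_wpM2l ?mulr_ge0// mulrDl.
apply: lerD; first by rewrite ler_peMr// lerDl.
by rewrite /Q le_eqVlt; apply/orP; left; apply/eqP; ring.
Qed.

Let a k := alpha k / n%:R.

Lemma a_ge0 k : 0 <= a k.
Proof. by rewrite divr_ge0// alpha_ge0. Qed.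

Lemma a_eq k : (0 < k)%N -> a k = (mutot * k%:R)^-1.
Proof.
rewrite /a /stepsize lt0n => /negbTE ->.
by rewrite mulrAC divff ?mul1r// gt_eqF.
Qed.

Let descent u k := u - zstar - a k *: gradF u.

Lemma descent_sqr u k : enorm (descent u k) ^+ 2 <=
  (1 - 2 * a k * mutot + (a k * Ltot) ^+ 2) * enorm (u - zstar) ^+ 2.
Proof.
rewrite /descent enormD_sqr dotpNr dotpZr enormN enormZ ger0_norm ?a_ge0//.
have h1 := ler_wpM2l (a_ge0 k) (gradF_mono u).
rewrite dotpC in h1.
have h2 : (a k * enorm (gradF u)) ^+ 2 <= (a k * Ltot * enorm (u - zstar)) ^+ 2.
  have h3 : a k * enorm (gradF u) <= a k * Ltot * enorm (u - zstar).
    by rewrite -mulrA ler_wpM2l ?a_ge0 ?gradF_lip.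
  have h4 : 0 <= a k * enorm (gradF u) by rewrite mulr_ge0 ?a_ge0 ?enorm_ge0.
  by rewrite ler_pXn2r ?nnegrE ?(le_trans h4 h3).
rewrite [(_ * enorm (u - zstar)) ^+ 2]exprMn in h2.
by lra.
Qed.

Lemma descent_expand u k : enorm (descent u k) <= (1 + a k * Ltot) * enorm (u - zstar).
Proof.
apply: le_trans (ler_enormD _ _) _.
rewrite enormN enormZ ger0_norm ?a_ge0// mulrDl mul1r lerD2l -mulrA.
by rewrite ler_wpM2l ?a_ge0 ?gradF_lip.
Qed.

Let kap := Ltot ^+ 2 / mutot ^+ 2.

Lemma descent_sqr_k u k : (0 < k)%N -> enorm (descent u k) ^+ 2 <=
  (1 - 2 / k%:R + kap / k%:R ^+ 2) * enorm (u - zstar) ^+ 2.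
Proof.
move=> k0; apply: le_trans (descent_sqr u k) _.
have kR : k%:R != 0 :> R by rewrite pnatr_eq0 -lt0n.
have mR : mutot != 0 by rewrite gt_eqF// mutot_gt0.
rewrite le_eqVlt; apply/orP; left; apply/eqP; congr (_ * _).
by rewrite (a_eq k0) /kap; field; rewrite mR kR.
Qed.

(** Beyond [kap] the factor of the square is at most [1 - 1/k], hence at most the square of
    [1 - 1/(2k)]. Half of the gain is given up, which is harmless for boundedness. *)
Lemma descent_contract u k : (0 < k)%N -> kap <= k%:R ->
  enorm (descent u k) <= (1 - (2 * k%:R)^-1) * enorm (u - zstar).
Proof.
move=> k0 kk; have kR : 0 < k%:R :> R by rewrite ltr0n.
have k1 : 1 <= k%:R :> R by rewrite ler1n.
have i1 : (2 * k%:R)^-1 <= 1 :> R.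
  by rewrite invf_le1 ?mulr_gt0//; lra.
rewrite -(ler_pXn2r (n := 2))// ?nnegrE ?enorm_ge0 ?mulr_ge0 ?enorm_ge0 ?subr_ge0//.
apply: le_trans (descent_sqr_k u k0) _; rewrite exprMn ler_wpM2r ?sqr_ge0//.
have h : kap / k%:R ^+ 2 <= k%:R^-1.
  rewrite ler_pdivrMr ?exprn_gt0// expr2 mulrA mulVf ?mul1r// gt_eqF//.
have -> : (1 - (2 * k%:R)^-1) ^+ 2 = 1 - k%:R^-1 + (2 * k%:R)^-1 ^+ 2 :> R.
  by field; rewrite gt_eqF.
have := sqr_ge0 ((2 * k%:R)^-1 : R); lra.
Qed.

Let mismatch e k := \sum_i (grad (f i) (z e i k) - grad (f i) (w e k)).

Lemma center_step e k : w e k.+1 - zstar =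
  descent (w e k) k - a k *: mismatch e k -
  n%:R^-1 *: \sum_(i | wake i k) beta wake alpha i k *: e i k.
Proof.
rewrite /= /descent /mismatch sumrB -/(gradF (w e k)).
apply/rowP => c; rewrite /a !mxE; ring.
Qed.

Lemma noise_step_le e k : noise_le e ->
  enorm (n%:R^-1 *: \sum_(i | wake i k) beta wake alpha i k *: e i k) <=
  cb * b / k.+1%:R.
Proof.
move=> eb; rewrite enormZ ger0_norm ?invr_ge0// ler_pdivrMl//.
apply: le_trans (ler_enorm_sum _ _ _) _.
rewrite big_mkcond; apply: (@le_trans _ _ (\sum_(j < n) cb * b / k.+1%:R)).
  apply: ler_sum => j _; case: ifP => _; last first.
    by apply: divr_ge0 => //; exact: mulr_ge0 cb_ge0 b_ge0.
  rewrite enormZ ger0_norm ?beta_ge0// mulrAC.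
  exact: ler_pM (beta_ge0 _ _) (enorm_ge0 _) (beta_le _ _) (eb _ _).
by rewrite sumr_const card_ord mulr_natl.
Qed.

Lemma center_step_le e k delta : noise_le e ->
  (forall i, enorm (z e i k - w e k) <= delta) ->
  enorm (w e k.+1 - zstar) <=
  enorm (descent (w e k) k) + a k * Ltot * delta + cb * b / k.+1%:R.
Proof.
move=> eb zw; rewrite center_step.
apply: le_trans (ler_enormD _ _) _; rewrite enormN.
apply: lerD (noise_step_le k eb).
apply: le_trans (ler_enormD _ _) _; rewrite enormN enormZ ger0_norm ?a_ge0//.
by rewrite lerD2l -mulrA ler_wpM2l ?a_ge0// grad_sum_lip.
Qed.

Lemma a_le k : a k <= ca.
Proof.
apply: le_trans (ler_wpM2r _ (alpha_le k)) _; first by rewrite invr_ge0.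
rewrite -mulrA -[leRHS]mulr1 ler_wpM2l ?ca_ge0// -invfM -natrM.
by rewrite invf_le1 ?ler1n ?ltr0n muln_gt0.
Qed.

(** A crude bound growing with [K], used to start the induction for the uniform one; what matters is
    that [r] is common to all noise paths. *)
Lemma bounded_prefix K : exists2 r, 0 <= r & forall e, noise_le e ->
  forall k, (k <= K)%N ->
  enorm (w e k - zstar) <= r /\ forall i, enorm (z e i k - zstar) <= r.
Proof.
have [C C0 track] := tracking.
elim: K => [|K [r r0 IH]].
  exists (enorm (n%:R^-1 *: (\sum_i x0 i) - zstar) + \sum_i enorm (x0 i - zstar)).
    by rewrite addr_ge0 ?enorm_ge0// sumr_ge0// => *; exact: enorm_ge0.
  move=> e eb k; rewrite leqn0 => /eqP ->; split.
    by rewrite lerDl sumr_ge0// => *; exact: enorm_ge0.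
  move=> i; rewrite [\sum_(j < n) enorm _](bigD1 i)//= -[z e i 0]/(x0 i).
  have h1 := enorm_ge0 (n%:R^-1 *: (\sum_i x0 i) - zstar).
  have h2 : 0 <= \sum_(j | j != i) enorm (x0 j - zstar).
    by apply: sumr_ge0 => *; exact: enorm_ge0.
  lra.
pose r1 := (1 + ca * Ltot) * r + ca * Ltot * (C * (1 + r)) + cb * b.
have r10 : 0 <= r1.
  have cL0 : 0 <= ca * Ltot := mulr_ge0 ca_ge0 Ltot_ge0.
  apply: addr_ge0 (mulr_ge0 cb_ge0 b_ge0); apply: addr_ge0.
    exact: mulr_ge0 (addr_ge0 ler01 cL0) r0.
  exact: mulr_ge0 cL0 (mulr_ge0 C0 (addr_ge0 ler01 r0)).
have Cr : 0 <= C * (1 + r) by rewrite mulr_ge0 ?addr_ge0.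
have Cr' k : C * (1 + r) / k.+1%:R <= C * (1 + r).
  by rewrite ler_piMr// invf_le1 ?ltr0n// ler1n.
have r1C : 0 <= r1 + C * (1 + r) := addr_ge0 r10 Cr.
exists (r + (r1 + C * (1 + r))); first by rewrite addr_ge0.
move=> e eb k; rewrite leq_eqVlt ltnS => /orP[/eqP->|kK]; last first.
  have [wr zr] := IH e eb k kK; split => [|i].
    by apply: le_trans wr _; rewrite lerDl.
  by apply: le_trans (zr i) _; rewrite lerDl.
have zr i t : (t < K.+1)%N -> enorm (z e i t - zstar) <= r.
  by rewrite ltnS => tK; have [_] := IH e eb t tK.
have tr i k' : (k' <= K.+1)%N -> enorm (z e i k' - w e k') <= C * (1 + r).
  by move=> k'K; apply: le_trans (track e K.+1 r eb r0 zr i k' k'K) (Cr' _).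
have w1 : enorm (w e K.+1 - zstar) <= r1.
  apply: le_trans (center_step_le eb (fun i => tr i K (leqnSn K))) _.
  have [wK _] := IH e eb K (leqnn K).
  apply: lerD; first apply: lerD.
  - apply: le_trans (descent_expand _ _) _; apply: ler_pM => //.
    + by apply: addr_ge0 => //; apply: mulr_ge0; [exact: a_ge0|exact: Ltot_ge0].
    + exact: enorm_ge0.
    + by rewrite lerD2l ler_wpM2r ?Ltot_ge0 ?a_le.
  - by rewrite ler_wpM2r// ler_wpM2r ?Ltot_ge0 ?a_le.
  - rewrite ler_piMr ?invf_le1 ?ltr0n ?ler1n//.
    exact: mulr_ge0 cb_ge0 b_ge0.
split; first by apply: le_trans w1 _; rewrite addrCA lerDl addr_ge0.
move=> i; apply: le_trans (ler_enormB _ (w e K.+1) _) _.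
rewrite addrC; apply: le_trans (lerD w1 (tr i K.+1 (leqnn _))) _.
by rewrite lerDr.
Qed.

(** At radius [r] the contraction gains [r / (2k)], while disagreement and noise each cost at most
    [r / (4k)]; so the center never leaves the ball. *)
Theorem iterates_bounded : exists2 r, 0 <= r & forall e, noise_le e ->
  forall k, enorm (w e k - zstar) <= r /\ forall i, enorm (z e i k - zstar) <= r.
Proof.
have [C C0 track] := tracking.
(* [kap] makes [descent_contract] available, [12 * C * Ltot / mutot] keeps the disagreement below
   [r / (4k)], and [3 * C] keeps the agents within [r] of the center. *)
have [K0 hK0] := nat_above (1 + kap + 12 * C * Ltot / mutot + 3 * C).
have m0 := mutot_gt0; have L0 := Ltot_ge0.
have kap0 : 0 <= kap by rewrite divr_ge0 ?sqr_ge0.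
have q0 : 0 <= 12 * C * Ltot / mutot.
  by apply: divr_ge0 (ltW m0); rewrite !mulr_ge0.
have [r0 r00 pre] := bounded_prefix K0.
(* The last term keeps the noise below [r / (4k)], and [1 <= r] turns the tracking constant
   [C * (1 + 2 * r)] into [3 * C * r]. *)
pose r := 1 + r0 + 4 * (cb * b).
have cbb : 0 <= cb * b := mulr_ge0 cb_ge0 b_ge0.
have r1 : 1 <= r by rewrite /r; lra.
have rr0 : r0 <= r by rewrite /r; lra.
exists (2 * r); first by lra.
move=> e eb.
suff H k : enorm (w e k - zstar) <= r /\
    forall i, enorm (z e i k - zstar) <= 2 * r.
  by move=> k; have [wr zr] := H k; split => //; lra.
elim/ltn_ind: k => k IH.
have [kK0|K0k] := leqP k K0.
  have [wr zr] := pre e eb k kK0; split; first lra.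
  by move=> i; have := zr i; lra.
case: k K0k IH => // k K0k IH.
have zr i t : (t < k.+1)%N -> enorm (z e i t - zstar) <= 2 * r.
  by move=> tk; have [_] := IH t tk.
have r20 : 0 <= 2 * r by lra.
have kK : K0%:R <= k%:R :> R by rewrite ler_nat -ltnS.
have k0 : (0 < k)%N.
  by rewrite lt0n; apply/negP => /eqP k0; move: kK; rewrite k0; lra.
have kR : 0 < k%:R :> R by rewrite ltr0n.
have tr i k' : (k' <= k.+1)%N -> enorm (z e i k' - w e k') <= 3 * C * r / k'.+1%:R.
  move=> k'k; apply: le_trans (track e k.+1 (2 * r) eb r20 zr i k' k'k) _.
  rewrite ler_wpM2r ?invr_ge0// [3 * C]mulrC -mulrA ler_wpM2l//; lra.
have w1 : enorm (w e k.+1 - zstar) <= r.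
  apply: le_trans (center_step_le eb (fun i => tr i k (leqnSn k))) _.
  have [wk _] := IH k (ltnSn k).
  have kk : kap <= k%:R by lra.
  have d1 := descent_contract (w e k) k0 kk.
  have k1 : 1 <= k%:R :> R by rewrite ler1n.
  have i1 : (2 * k%:R)^-1 <= 1 :> R.
    by rewrite invf_le1 ?mulr_gt0//; lra.
  have d2 : (1 - (2 * k%:R)^-1) * enorm (w e k - zstar) <= r - r / 2 / k%:R.
    apply: le_trans (ler_wpM2l _ wk) _; first by rewrite subr_ge0.
    by rewrite invfM; lra.
  have d3 : cb * b / k.+1%:R <= r / 4 / k%:R.
    apply: (@le_trans _ _ (cb * b / k%:R)).
      by rewrite ler_wpM2l// lef_pV2 ?posrE ?ltr0n// ler_nat.
    by rewrite ler_wpM2r ?invr_ge0 ?(ltW kR)//; rewrite /r; lra.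
  have d4 : a k * Ltot * (3 * C * r / k.+1%:R) <= r / 4 / k%:R.
    have -> : a k * Ltot * (3 * C * r / k.+1%:R) =
        r / 4 / k%:R * (12 * C * Ltot / mutot / k.+1%:R).
      by rewrite (a_eq k0); field; rewrite !gt_eqF ?ltr0n.
    rewrite ler_piMr ?divr_ge0 ?(ltW kR)//; first lra.
    rewrite ler_pdivrMr ?ltr0n// mul1r -natr1; lra.
  apply: le_trans (lerD (lerD (le_trans d1 d2) d4) d3) _.
  by rewrite le_eqVlt; apply/orP; left; apply/eqP; field; rewrite gt_eqF.
split => // i; apply: le_trans (ler_enormB _ (w e k.+1) _) _.
rewrite [2 * r](_ : _ = r + r); last by ring.
apply: lerD w1; apply: le_trans (tr i k.+1 (leqnn _)) _.
rewrite ler_pdivrMr ?ltr0n// mulrC ler_wpM2l//; first lra.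
by rewrite -natr1 -natr1; lra.
Qed.

Theorem agents_track : exists2 C, 0 <= C & forall e, noise_le e ->
  forall i k, enorm (z e i k - w e k) <= C / k.+1%:R.
Proof.
have [C C0 track] := tracking; have [r r0 bd] := iterates_bounded.
exists (C * (1 + r)); first by rewrite mulr_ge0 ?addr_ge0.
move=> e eb i k; apply: (track e k r eb r0) => // j t _.
by have [_] := bd e eb t.
Qed.

(** The step without its fresh noise: this part depends only on the noise of times before [k]. *)
Definition drift e k : 'rV[R]_d :=
  w e k - zstar - a k *: \sum_i grad (f i) (z e i k).

Lemma center_drift e k : w e k.+1 - zstar =
  drift e k - n%:R^-1 *: \sum_(i | wake i k) beta wake alpha i k *: e i k.
Proof. by rewrite /drift /= addrAC; congr (_ - _); rewrite addrAC. Qed.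

(** Evaluating the gradients at the agents' points changes the step by O(1/k^2). The resulting cross
    term is left linear in the distance to the minimizer, to be estimated once a first rate is
    known. *)
Theorem drift_le : exists2 C, 0 <= C & forall e, noise_le e ->
  forall k, (0 < k)%N -> enorm (drift e k) ^+ 2 <=
  (1 - 2 / k%:R) * enorm (w e k - zstar) ^+ 2 +
  C / k%:R ^+ 2 * (enorm (w e k - zstar) ^+ 2 + enorm (w e k - zstar)) +
  C / k%:R ^+ 3.
Proof.
have [C C0 track] := agents_track.
have m0 := mutot_gt0; have L0 := Ltot_ge0; have ca0 := ca_ge0.
have kap0 : 0 <= kap by rewrite divr_ge0 ?sqr_ge0.
pose S := Ltot * C / mutot.
have S0 : 0 <= S by apply: divr_ge0 (ltW m0); rewrite mulr_ge0.
have cL0 : 0 <= ca * Ltot by exact: mulr_ge0.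
pose C1 := 2 * (1 + ca * Ltot) * S.
have C10 : 0 <= C1.
  by apply: mulr_ge0 S0; apply: mulr_ge0 (addr_ge0 ler01 cL0).
exists (kap + C1 + S ^+ 2); first exact: addr_ge0 (addr_ge0 kap0 C10) (sqr_ge0 S).
move=> e eb k k0; set r := enorm (w e k - zstar).
have r0 : 0 <= r by exact: enorm_ge0.
have kR : 0 < k%:R :> R by rewrite ltr0n.
have k1 : 1 <= k%:R :> R by rewrite ler1n.
have -> : drift e k = descent (w e k) k + - (a k *: mismatch e k).
  rewrite /drift /descent /mismatch sumrB -/(gradF (w e k)).
  by rewrite scalerBr opprB addrA subrK.
rewrite enormD_sqr enormN.
set s := a k *: mismatch e k.
have sS : enorm s <= S / k%:R ^+ 2.
  rewrite /s enormZ ger0_norm ?a_ge0// (a_eq k0).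
  have -> : S / k%:R ^+ 2 = (mutot * k%:R)^-1 * (Ltot * (C / k%:R)).
    by rewrite /S; field; rewrite !gt_eqF.
  rewrite ler_wpM2l ?invr_ge0 ?mulr_ge0 ?(ltW m0)//; apply: grad_sum_lip => i.
  apply: le_trans (track e eb i k) _.
  by rewrite ler_wpM2l// lef_pV2 ?posrE ?ltr0n// ler_nat.
have dd : 2 * dotp (descent (w e k) k) (- s) <= C1 / k%:R ^+ 2 * r.
  have h1 := dotp_le (descent (w e k) k) (- s); rewrite enormN in h1.
  have h2 : enorm (descent (w e k) k) * enorm s <=
      ((1 + ca * Ltot) * r) * (S / k%:R ^+ 2).
    apply: ler_pM; rewrite ?enorm_ge0//.
    apply: le_trans (descent_expand _ _) _; rewrite ler_wpM2r//.
    by rewrite lerD2l ler_wpM2r ?a_le.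
  have -> : C1 / k%:R ^+ 2 * r = 2 * (((1 + ca * Ltot) * r) * (S / k%:R ^+ 2)).
    by rewrite /C1; ring.
  lra.
have i2 : 0 <= (k%:R ^+ 2)^-1 :> R by rewrite invr_ge0 exprn_ge0// ltW.
have i3 : 0 <= (k%:R ^+ 3)^-1 :> R by rewrite invr_ge0 exprn_ge0// ltW.
have Sk : 0 <= S / k%:R ^+ 2 := mulr_ge0 S0 i2.
have ss : enorm s ^+ 2 <= S ^+ 2 / k%:R ^+ 3.
  apply: (@le_trans _ _ ((S / k%:R ^+ 2) ^+ 2)).
    by rewrite ler_pXn2r ?nnegrE ?enorm_ge0.
  rewrite expr_div_n -exprM ler_wpM2l ?sqr_ge0//.
  rewrite lef_pV2 ?posrE ?exprn_gt0//.
  by rewrite [X in _ <= X]exprS ler_peMl// exprn_ge0// ltW.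
have d1 := descent_sqr_k (w e k) k0.
rewrite -/r in d1.
(* Slack that lets the single constant [kap + C1 + S ^+ 2] replace the three separate ones. *)
have e1 : 0 <= (C1 + S ^+ 2) / k%:R ^+ 2 * r ^+ 2.
  exact: mulr_ge0 (mulr_ge0 (addr_ge0 C10 (sqr_ge0 S)) i2) (sqr_ge0 r).
have e2 : 0 <= (kap + S ^+ 2) / k%:R ^+ 2 * r.
  exact: mulr_ge0 (mulr_ge0 (addr_ge0 kap0 (sqr_ge0 S)) i2) r0.
have e3 : 0 <= (kap + C1) / k%:R ^+ 3 := mulr_ge0 (addr_ge0 kap0 C10) i3.
apply: le_trans (lerD (lerD d1 dd) ss) _; rewrite -subr_ge0.
move: (addr_ge0 (addr_ge0 e1 e2) e3).
rewrite [X in 0 <= X -> _](_ : _ = (1 - 2 / k%:R) * r ^+ 2 +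
  (kap + C1 + S ^+ 2) / k%:R ^+ 2 * (r ^+ 2 + r) +
  (kap + C1 + S ^+ 2) / k%:R ^+ 3 -
  ((1 - 2 / k%:R + kap / k%:R ^+ 2) * r ^+ 2 +
   C1 / k%:R ^+ 2 * r + S ^+ 2 / k%:R ^+ 3))//.
by ring.
Qed.

End Path.

(** * Measurability and independence *)

Section VectorMeasurability.
Variables (disp : measure_display) (T : measurableType disp).
Variables (R : realType) (d : nat).
Implicit Types X Y : T -> 'rV[R]_d.

(** [T] is kept general because it will also be the sample space with a smaller sigma-algebra, to
    express dependence on part of the noise. *)
Definition mvec X : Prop :=
  forall c, measurable_fun setT (fun w => X w 0 c).

Lemma mvec_cst v : mvec (fun=> v).
Proof. by move=> c; exact: measurable_cst. Qed.

Lemma mvecD X Y : mvec X -> mvec Y -> mvec (fun w => X w + Y w).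
Proof.
move=> mX mY c; under eq_fun do rewrite mxE.
by apply: measurable_funD; [exact: mX|exact: mY].
Qed.

Lemma mvecZ (a : R) X : mvec X -> mvec (fun w => a *: X w).
Proof.
move=> mX c; under eq_fun do rewrite mxE.
by apply: measurable_funM; [exact: measurable_cst|exact: mX].
Qed.

Lemma mvecB X Y : mvec X -> mvec Y -> mvec (fun w => X w - Y w).
Proof.
move=> mX mY; have -> : (fun w => X w - Y w) = (fun w => X w + (-1) *: Y w).
  by apply/funext => w; rewrite scaleN1r.
by apply: mvecD => //; exact: mvecZ.
Qed.

Lemma mvec_sum I (r : seq I) (Q : pred I) (F : I -> T -> 'rV[R]_d) :
  (forall i, Q i -> mvec (F i)) -> mvec (fun w => \sum_(i <- r | Q i) F i w).
Proof.
move=> mF; elim: r => [|i r IH].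
  have -> : (fun w => \sum_(i <- [::] | Q i) F i w) = fun=> 0.
    by apply/funext => w; rewrite big_nil.
  exact: mvec_cst.
have [Qi|Qi] := boolP (Q i); last first.
  rewrite [X in mvec X](_ : _ = fun w => \sum_(j <- r | Q j) F j w)//.
  by apply/funext => w; rewrite big_cons (negbTE Qi).
rewrite [X in mvec X](_ : _ = fun w => F i w + \sum_(j <- r | Q j) F j w).
  by apply: mvecD => //; exact: mF.
by apply/funext => w; rewrite big_cons Qi.
Qed.

Lemma measurable_enorm X : mvec X -> measurable_fun setT (fun w => enorm (X w)).
Proof.
move=> mX; rewrite /enorm.
have : measurable_fun setT (Num.sqrt : R -> R).
  by apply: continuous_measurable_fun; exact: sqrt_continuous.
move/measurableT_comp; apply; apply: measurable_sum => c.
by apply: measurable_funX; exact: mX.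
Qed.

(** An open set is the union of the boxes it contains with rational centre and radius [m.+1%:R^-1],
    which are countably many. *)
Lemma mvec_open X (U : set 'rV[R]_d) : mvec X -> open U -> measurable (X @^-1` U).
Proof.
move=> mX oU.
pose box (q : 'rV[rat]_d) (m : nat) : set 'rV[R]_d :=
  [set v | forall c, `|v 0 c - ratr (q 0 c)| < m.+1%:R^-1].
have -> : X @^-1` U =
    \bigcup_(qm : 'rV[rat]_d * nat)
      (if `[< box qm.1 qm.2 `<=` U >] then X @^-1` (box qm.1 qm.2) else set0).
  apply/seteqP; split => [w Uw|w [qm _]]; last first.
    by case: ifPn => // /asboolP sub; exact: sub.
  have /nbhs_ballP[e /= e0 sub] := open_nbhs_nbhs (conj oU Uw).
  have [m hm] : exists m, 2 * m.+1%:R^-1 < e.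
    have e2 : 0 < e / 2 by rewrite divr_gt0.
    have [m _ /(_ m (leqnn m)) hm] := near_infty_natSinv_lt (PosNum e2).
    by exists m; rewrite mulrC -ltr_pdivlMr.
  have m0 : 0 < m.+1%:R^-1 :> R by rewrite invr_gt0 ltr0n.
  have ex c : exists q : rat, `|X w 0 c - ratr q| < m.+1%:R^-1.
    have lt : X w 0 c - m.+1%:R^-1 < X w 0 c + m.+1%:R^-1.
      by apply: (@lt_trans _ _ (X w 0 c)); rewrite ?gtrBl ?ltrDl.
    have [q] := rat_in_itvoo lt; rewrite in_itv/= => /andP[q1 q2].
    by exists q; rewrite distrC ltr_distl q1 q2.
  have [q hq] := choice ex.
  exists (\row_c q c, m) => //=.
  case: ifPn => [_ /= c|/asboolP[]]; first by rewrite mxE.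
  move=> v hv; apply: sub; split => // i c; rewrite ord1.
  have := hv c; have := hq c; rewrite mxE => h1 h2.
  apply: le_lt_trans hm.
  rewrite -(subrK (ratr (q c)) (X w 0 c)) -addrA.
  apply: le_trans (ler_normD _ _) _; rewrite mulr_natl mulr2n.
  by apply: lerD; apply: ltW => //; rewrite distrC.
apply: countable_bigcupT_measurable => [|qm]; first exact: countableP.
case: ifPn => // _.
have -> : X @^-1` box qm.1 qm.2 = \bigcap_(c in [set: 'I_d])
    ((fun w => X w 0 c) @^-1` [set x | `|x - ratr (qm.1 0 c)| < qm.2.+1%:R^-1]).
  by apply/seteqP; split => w /= h c; [move=> _; exact: h|exact: (h c I)].
apply: fin_bigcap_measurable => [|c _]; first exact: finite_finset.
rewrite -[X in measurable X]setTI.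
apply: mX => //.
set q : R := ratr _; set r : R := _^-1.
have -> : [set x : R | `|x - q| < r] = `]q - r, q + r[%classic.
  by apply/seteqP; split => x /=; rewrite in_itv/= ltr_distl.
exact: measurable_itv.
Qed.

Lemma measurable_continuous_comp X (g : 'rV[R]_d -> R) :
  mvec X -> continuous g -> measurable_fun setT (g \o X).
Proof.
move=> mX cg; apply: (measurability _ (RGenOpens.measurableE R)) => //.
move=> _ [_ [a [b ->] <-]]; rewrite setTI comp_preimage.
apply: mvec_open => //; move/continuousP: cg; apply.
exact: interval_open.
Qed.

Lemma random_vector_mvec X : random_vector X -> mvec X.
Proof.
move=> rX c; apply: (measurability _ (RGenOpens.measurableE R)) => //.
move=> _ [_ [a [b ->] <-]]; rewrite setTI.
have cc : continuous (fun v : 'rV[R]_d => v 0 c) by exact: coord_continuous.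
apply: (rX ((fun v : 'rV[R]_d => v 0 c) @^-1` `]a, b[%classic)).
apply: sub_sigma_algebra; move/continuousP: cc; apply.
exact: interval_open.
Qed.

End VectorMeasurability.

(** * Real-valued expectation of bounded random variables *)

Section BoundedExpectation.
Variables (disp : measure_display) (T : measurableType disp) (R : realType).
Variable P : probability T R.
Implicit Types X Y : T -> R.

Definition rbounded (S : Type) (X : S -> R) : Prop :=
  exists M, forall w, `|X w| <= M.

Definition bdd_rv X : Prop := measurable_fun setT X /\ rbounded X.

Definition EE X : R := \int[P]_w X w.

Lemma bdd_rv_cst a : bdd_rv (fun=> a).
Proof. by split; [exact: measurable_cst|exists `|a|]. Qed.

Lemma bdd_rvD X Y : bdd_rv X -> bdd_rv Y -> bdd_rv (fun w => X w + Y w).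
Proof.
move=> [mX [M hM]] [mY [N hN]]; split; first exact: measurable_funD.
by exists (M + N) => w; apply: le_trans (ler_normD _ _) (lerD _ _).
Qed.

Lemma bdd_rvM X Y : bdd_rv X -> bdd_rv Y -> bdd_rv (fun w => X w * Y w).
Proof.
move=> [mX [M hM]] [mY [N hN]]; split; first exact: measurable_funM.
by exists (M * N) => w; rewrite normrM ler_pM.
Qed.

Lemma bdd_rvZ a X : bdd_rv X -> bdd_rv (fun w => a * X w).
Proof. by move=> bX; apply: bdd_rvM => //; exact: bdd_rv_cst. Qed.

Lemma bdd_rvB X Y : bdd_rv X -> bdd_rv Y -> bdd_rv (fun w => X w - Y w).
Proof.
move=> bX bY; rewrite [X in bdd_rv X](_ : _ = fun w => X w + (-1) * Y w).
  by apply: bdd_rvD => //; exact: bdd_rvZ.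
by apply/funext => w; rewrite mulN1r.
Qed.

Lemma bdd_rv_sum I (r : seq I) (Q : pred I) (F : I -> T -> R) :
  (forall i, bdd_rv (F i)) -> bdd_rv (fun w => \sum_(i <- r | Q i) F i w).
Proof.
move=> bF; elim: r => [|i r IH].
  have -> : (fun w => \sum_(i <- [::] | Q i) F i w) = fun=> 0.
    by apply/funext => w; rewrite big_nil.
  exact: bdd_rv_cst.
have [Qi|Qi] := boolP (Q i); last first.
  rewrite [X in bdd_rv X](_ : _ = fun w => \sum_(j <- r | Q j) F j w)//.
  by apply/funext => w; rewrite big_cons (negbTE Qi).
rewrite [X in bdd_rv X](_ : _ = fun w => F i w + \sum_(j <- r | Q j) F j w).
  exact: bdd_rvD.
by apply/funext => w; rewrite big_cons Qi.
Qed.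

Lemma bdd_rv_indic (A : set T) : measurable A -> bdd_rv (\1_A : T -> R).
Proof.
move=> mA; split; first exact: measurable_indic.
by exists 1 => w; rewrite indicE; case: (_ \in _); rewrite ?normr1 ?normr0.
Qed.

Lemma bdd_rv_integrable X : bdd_rv X -> P.-integrable setT (EFin \o X).
Proof.
move=> [mX [M hM]].
have PT : (P setT < +oo)%E by rewrite probability_setT ltry.
have icst : P.-integrable setT (EFin \o (cst M : T -> R)).
  exact: finite_measure_integrable_cst.
apply: le_integrable icst => //; first exact/measurable_EFinP.
move=> w _ /=; rewrite lee_fin; apply: le_trans (hM w) _.
exact: ler_norm.
Qed.

Lemma EE_cst a : EE (fun=> a) = a.
Proof. by rewrite /EE /Rintegral integral_cst//= probability_setT mule1. Qed.

Lemma EED X Y : bdd_rv X -> bdd_rv Y -> EE (fun w => X w + Y w) = EE X + EE Y.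
Proof. by move=> bX bY; rewrite /EE RintegralD//; exact: bdd_rv_integrable. Qed.

Lemma EEZ a X : bdd_rv X -> EE (fun w => a * X w) = a * EE X.
Proof. by move=> bX; rewrite /EE RintegralZl//; exact: bdd_rv_integrable. Qed.

Lemma EEB X Y : bdd_rv X -> bdd_rv Y -> EE (fun w => X w - Y w) = EE X - EE Y.
Proof. by move=> bX bY; rewrite /EE RintegralB//; exact: bdd_rv_integrable. Qed.

Lemma EE_sum I (r : seq I) (Q : pred I) (F : I -> T -> R) :
  (forall i, bdd_rv (F i)) ->
  EE (fun w => \sum_(i <- r | Q i) F i w) = \sum_(i <- r | Q i) EE (F i).
Proof.
move=> bF; elim: r => [|i r IH].
  rewrite big_nil -[RHS](EE_cst 0); congr EE.
  by apply/funext => w; rewrite big_nil.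
rewrite big_cons -IH; case: ifP => Qi.
  rewrite -EED//; last exact: bdd_rv_sum.
  by congr EE; apply/funext => w; rewrite big_cons Qi.
by congr EE; apply/funext => w; rewrite big_cons Qi.
Qed.

Lemma ler_EE X Y : bdd_rv X -> bdd_rv Y -> (forall w, X w <= Y w) -> EE X <= EE Y.
Proof.
by move=> bX bY XY; apply: le_Rintegral => //; exact: bdd_rv_integrable.
Qed.

Lemma EE_dist X Y a : bdd_rv X -> bdd_rv Y -> (forall w, `|X w - Y w| <= a) ->
  `|EE X - EE Y| <= a.
Proof.
move=> bX bY XY; rewrite ler_distl; apply/andP; split.
  rewrite -[a]EE_cst -EEB//; last exact: bdd_rv_cst.
  apply: ler_EE => //; first by apply: bdd_rvB => //; exact: bdd_rv_cst.
  by move=> w; have := XY w; rewrite ler_distl => /andP[].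
rewrite -[a]EE_cst -EED//; last exact: bdd_rv_cst.
apply: ler_EE => //; first by apply: bdd_rvD => //; exact: bdd_rv_cst.
by move=> w; have := XY w; rewrite ler_distl => /andP[].
Qed.

Lemma EE_indic (A : set T) : measurable A -> EE (\1_A : T -> R) = fine (P A).
Proof. by move=> mA; rewrite /EE /Rintegral integral_indic// setIT. Qed.

Lemma expectation_EE X : bdd_rv X -> ('E_P[X] = (EE X)%:E)%E.
Proof.
move=> bX; rewrite unlock /EE /Rintegral fineK//.
exact: integrable_fin_num (bdd_rv_integrable bX).
Qed.

End BoundedExpectation.

(** Half-open cells of width [a] starting at [- M], each represented by its left end. Independence
    speaks of events; such step functions carry it over to expectations of products. *)
Lemma discretize (R : realType) (M a : R) : 0 < a -> exists N (c : 'I_N -> R)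
    (I : 'I_N -> set R), (forall j, measurable (I j)) /\
  forall x, `|x| <= M -> `|x - \sum_(j < N) c j * \1_(I j) x| <= a.
Proof.
move=> a0; have [N hN] : exists N : nat, 2 * M / a < N%:R.
  exists (Num.bound `|2 * M / a|); apply: le_lt_trans (ler_norm _) _.
  exact: archi_boundP.
exists N, (fun j => - M + j%:R * a),
  (fun j => `[- M + j%:R * a, - M + j.+1%:R * a[%classic).
split=> [j|x]; first exact: measurable_itv.
rewrite ler_norml => /andP[x1 x2].
have {x2 hN} xN : x < - M + N%:R * a.
  by move: hN; rewrite ltr_pdivrMr//; lra.
suff H m : (x < - M + m%:R * a -> 0 <= x - \sum_(j < m) (- M + j%:R * a) *
        \1_(`[- M + j%:R * a, - M + j.+1%:R * a[%classic) x <= a) /\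
    (- M + m%:R * a <= x -> \sum_(j < m) (- M + j%:R * a) *
        \1_(`[- M + j%:R * a, - M + j.+1%:R * a[%classic) x = 0).
  have [/(_ xN)/andP[h1 h2] _] := H N.
  by rewrite ger0_norm.
elim: m => [|m [IH1 IH2]].
  by split => [|_]; rewrite ?big_ord0//; lra.
have mm : m.+1%:R * a = m%:R * a + a by rewrite -natr1 mulrDl mul1r.
split=> [xm|xm]; rewrite big_ord_recr/= indicE.
  have [xlt|xge] := ltP x (- M + m%:R * a).
    rewrite memNset ?mulr0 ?addr0; first exact: IH1.
    by rewrite /= in_itv/= leNgt xlt.
  rewrite mem_set ?mulr1 ?IH2 ?add0r//; last by rewrite /= in_itv/= xge xm.
  by apply/andP; split; lra.
rewrite memNset ?mulr0 ?addr0; first by apply: IH2; lra.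
by rewrite /= in_itv/= ltNge xm andbF.
Qed.

(** * Orthogonality of a centred noise vector to functions of the others *)

Section Independence.
Variables (disp : measure_display) (T : measurableType disp) (R : realType).
Variables (P : probability T R) (d : nat) (I : eqType) (X : I -> T -> 'rV[R]_d).
Hypothesis rX : forall i, random_vector (X i).
Hypothesis indX : independent_family P X.
Variable p : I.

Let borelI A B : @borel_rV R d A -> borel_rV B -> borel_rV (A `&` B).
Proof.
exact: (@measurableI _ (g_sigma_algebraType (@open 'rV[R]_d))).
Qed.

Let borelT : @borel_rV R d setT.
Proof. exact: (@measurableT _ (g_sigma_algebraType (@open 'rV[R]_d))). Qed.

(** A pi-system generating the sigma-algebra of all the vectors except [X p]. *)
Definition other_cylinders : set (set T) := [set G | exists (s : seq I) (A : I -> set 'rV[R]_d),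
  [/\ uniq s, p \notin s, forall i, i \in s -> @borel_rV R d (A i) &
      G = \bigcap_(i in [set` s]) X i @^-1` A i]].

Let rX_meas (s : seq I) (A : I -> set 'rV[R]_d) : (forall i, i \in s -> @borel_rV R d (A i)) ->
  measurable (\bigcap_(i in [set` s]) X i @^-1` A i).
Proof.
move=> bA; apply: fin_bigcap_measurable => [|i si].
  exact: finite_seq.
by apply: rX; exact: bA.
Qed.

Lemma other_cylinders_measurable : other_cylinders `<=` measurable.
Proof. by move=> _ [s [A [_ _ bA ->]]]; exact: rX_meas. Qed.

Lemma other_cylinders_setI : setI_closed other_cylinders.
Proof.
move=> _ _ [s [A [us ps bA ->]]] [s' [A' [us' ps' bA' ->]]].
exists (undup (s ++ s')), (fun i => (if i \in s then A i else setT) `&`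
  (if i \in s' then A' i else setT)); split.
- exact: undup_uniq.
- by rewrite mem_undup mem_cat negb_or ps.
- by move=> i _; apply: borelI; case: ifPn => // si; [exact: bA|exact: bA'].
- apply/seteqP; split => [w [h h'] i /= _|w h].
    by split; case: ifPn => //; [exact: h|exact: h'].
  split => i /= si; have := h i; rewrite /= mem_undup mem_cat si ?orbT/=.
    by move=> /(_ isT)[].
  by move=> /(_ isT)[].
Qed.

Lemma other_cylinders1 q (A : set 'rV[R]_d) : q != p -> borel_rV A ->
  other_cylinders (X q @^-1` A).
Proof.
move=> qp bA; exists [:: q], (fun=> A); split => //.
- by rewrite inE eq_sym.
- by rewrite set_cons1 bigcap_set1.
Qed.

Lemma other_cylindersT : other_cylinders setT.
Proof.
exists [::], (fun=> setT); split => //.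
by rewrite set_nil bigcap_set0.
Qed.

(** Both sides are finite measures of [G], a restriction of [P] and a multiple of [P]; independence
    makes them agree on the pi-system, hence on what it generates. *)
Lemma indep_other (G : set T) (A : set 'rV[R]_d) : borel_rV A ->
  <<s other_cylinders >> G ->
  fine (P (G `&` X p @^-1` A)) = fine (P G) * fine (P (X p @^-1` A)).
Proof.
move=> bA sG; have mA : measurable (X p @^-1` A) by exact: rX.
have fA : P (X p @^-1` A) \is a fin_num by exact: fin_num_measure.
have r0 : 0 <= fine (P (X p @^-1` A)) by rewrite fine_ge0.
pose m1 : {measure set T -> \bar R} := mrestr P mA.
pose m2 : {measure set T -> \bar R} := mscale (NngNum r0) P.
have m1E S : m1 S = P (S `&` X p @^-1` A) by [].
have m2E S : m2 S = (P (X p @^-1` A) * P S)%E by rewrite -[in RHS](fineK fA).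
have E : m1 G = m2 G.
  apply: (@g_sigma_algebra_measure_unique _ _ _ other_cylinders
    other_cylinders_measurable (fun=> setT) _ _ m1 m2 other_cylinders_setI) => //.
  - by move=> _; exact: other_cylindersT.
  - by rewrite bigcup_const.
  - move=> _ [s [A' [us ps bA' ->]]].
    rewrite m1E m2E.
    have := @indX (p :: s) (fun i => if i == p then A else A' i).
    rewrite /= ps us => /(_ isT).
    rewrite big_cons eqxx => H.
    have -> : \bigcap_(i in [set` s]) X i @^-1` A' i `&` X p @^-1` A =
      \bigcap_(i in [set` p :: s]) X i @^-1` (if i == p then A else A' i).
      apply/seteqP; split => [w [h1 h2] i /=|w h].
        rewrite inE => /orP[/eqP->|si]; first by rewrite eqxx.
        case: eqP => [->//|_]; exact: h1.
      split; last by have := h p; rewrite /= mem_head eqxx; exact.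
      move=> i /= si; have := h i; rewrite /= inE si orbT => /(_ isT).
      by case: eqP => // ip; move: ps; rewrite -ip si.
    rewrite H; last first.
      move=> i; rewrite inE => /orP[/eqP->|si]; first by rewrite eqxx.
      by case: eqP => // _; exact: bA'.
    congr (_ * _)%E.
    rewrite indX//; apply: eq_big_seq => i si; case: eqP => // ip.
    by move: ps; rewrite -ip si.
  - by move=> _; rewrite m1E setTI ltey_eq fA.
have sub : <<s other_cylinders >> `<=` measurable.
  apply: smallest_sub; first exact: sigma_algebra_measurable.
  exact: other_cylinders_measurable.
move: E; rewrite m1E m2E => ->.
by rewrite fineM ?fin_num_measure//; [rewrite mulrC|exact: sub].
Qed.

Let borel_coord c (S : set R) : measurable S ->
  borel_rV ((fun v : 'rV[R]_d => v 0 c) @^-1` S).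
Proof.
move=> mS.
have rid : random_vector (T := g_sigma_algebraType (@open 'rV[R]_d)) (@id 'rV[R]_d).
  by [].
by have := random_vector_mvec rid c measurableT mS; rewrite setTI.
Qed.

Let other_sub : <<s other_cylinders >> `<=` measurable.
Proof.
apply: smallest_sub; first exact: sigma_algebra_measurable.
exact: other_cylinders_measurable.
Qed.

Let small_eq0 (a b : R) : (forall e, 0 < e -> `|a| <= b * e) -> a = 0.
Proof.
move=> h; apply/eqP; rewrite -normr_le0 leNgt; apply/negP => a0.
have b0 : 0 < `|b| + 1 by rewrite ltr_wpDl.
have e0 : 0 < `|a| / 2 / (`|b| + 1) by rewrite !divr_gt0.
have h1 := h _ e0.
have h2 : b * (`|a| / 2 / (`|b| + 1)) <= `|a| / 2.
  rewrite mulrCA ler_piMr ?divr_ge0// ler_pdivrMr// mul1r.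
  by apply: le_trans (ler_norm b) _; rewrite lerDl.
lra.
Qed.

Lemma bdd_rv_other (Z : T -> R) :
  measurable_fun (T := g_sigma_algebraType other_cylinders) setT Z ->
  rbounded Z -> bdd_rv Z.
Proof.
move=> mZ bZ; split => // _ S mS; rewrite setTI.
by apply: other_sub; have := mZ measurableT S mS; rewrite setTI.
Qed.

Variable c : 'I_d.
Let Y w := X p w 0 c.
Hypothesis bY : rbounded Y.
Hypothesis EY : EE P Y = 0.

Let mY : bdd_rv Y.
Proof. by split => //; exact: random_vector_mvec. Qed.

(** [Y] is replaced by a step function [Ya] of itself: [indep_other] factors the expectation cell by
    cell, and the mean of [Ya] is at most [a] in absolute value since [Y] is centred. *)
Let EE_indic_other G : <<s other_cylinders >> G ->
  EE P (fun w => \1_G w * Y w) = 0.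
Proof.
move=> sG; have mG : measurable G := other_sub sG.
have b1 := bdd_rv_indic R mG.
have [M hM] := bY.
apply: (@small_eq0 _ 2) => a a0.
have [N [k [J [mJ hJ]]]] := discretize M a0.
pose Yj j : T -> R := \1_(Y @^-1` J j).
have mYj j : measurable (Y @^-1` J j).
  by have := mY.1 measurableT (J j) (mJ j); rewrite setTI.
have bYj j : bdd_rv (Yj j) by exact: bdd_rv_indic.
pose Ya w := \sum_(j < N) k j * Yj j w.
have bYa : bdd_rv Ya by apply: bdd_rv_sum => j; exact: bdd_rvZ.
have YYa w : `|Y w - Ya w| <= a.
  suff -> : Ya w = \sum_(j < N) k j * \1_(J j) (Y w) by exact: hJ.
  by apply: eq_bigr => j _.
have EYa : `|EE P Ya| <= a.
  by rewrite -[EE P Ya]subr0 -EY distrC; exact: EE_dist.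
have EGa : EE P (fun w => \1_G w * Ya w) = fine (P G) * EE P Ya.
  rewrite [X in EE P X](_ : _ = fun w => \sum_(j < N) k j * (\1_G w * Yj j w)).
    rewrite EE_sum; last by move=> j; apply: bdd_rvZ; exact: bdd_rvM.
    rewrite /Ya EE_sum; last by move=> j; exact: bdd_rvZ.
    rewrite mulr_sumr; apply: eq_bigr => j _.
    rewrite EEZ; last exact: bdd_rvM.
    rewrite EEZ// mulrCA; congr (_ * _).
    rewrite [X in EE P X](_ : _ = \1_(G `&` Y @^-1` J j)).
      rewrite !EE_indic//; last exact: measurableI.
      exact: (@indep_other G _ (borel_coord c (mJ j)) sG).
    by apply/funext => w; rewrite /Yj indicI.
  by apply/funext => w; rewrite /Ya mulr_sumr; apply: eq_bigr => j _; rewrite mulrCA.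
have G1 : fine (P G) <= 1.
  by rewrite -lee_fin fineK ?fin_num_measure// probability_le1.
have G0 : 0 <= fine (P G) by rewrite fine_ge0.
have h1 : `|EE P (fun w => \1_G w * Y w) - EE P (fun w => \1_G w * Ya w)| <= a.
  apply: EE_dist; [exact: bdd_rvM|exact: bdd_rvM|].
  move=> w; rewrite -mulrBr normrM indicE; case: (_ \in _).
    by rewrite normr1 mul1r.
  by rewrite normr0 mul0r ltW.
have h2 : `|EE P (fun w => \1_G w * Ya w)| <= a.
  rewrite EGa normrM (ger0_norm G0); apply: le_trans EYa.
  by rewrite ler_piMl.
rewrite -(subrK (EE P (fun w => \1_G w * Ya w)) (EE P (fun w => \1_G w * Y w))).
by apply: le_trans (ler_normD _ _) _; rewrite mulr_natl mulr2n lerD.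
Qed.

(** Here [Z] is discretized; its cells are events of the sigma-algebra of the others, so
    [EE_indic_other] kills every term. *)
Lemma EE_indep0 (Z : T -> R) :
  measurable_fun (T := g_sigma_algebraType other_cylinders) setT Z ->
  rbounded Z -> EE P (fun w => Z w * Y w) = 0.
Proof.
move=> mZ bZ; have bdZ := bdd_rv_other mZ bZ.
have [MZ hMZ] := bZ; have [M hM] := bY.
apply: (@small_eq0 _ M) => a a0.
have [N [k [J [mJ hJ]]]] := discretize MZ a0.
have sZj j : <<s other_cylinders >> (Z @^-1` J j).
  by have := mZ measurableT (J j) (mJ j); rewrite setTI.
pose Zj j : T -> R := \1_(Z @^-1` J j).
have bZj j : bdd_rv (Zj j) by apply: bdd_rv_indic; apply: other_sub.
pose Za w := \sum_(j < N) k j * Zj j w.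
have bZa : bdd_rv Za by apply: bdd_rv_sum => j; exact: bdd_rvZ.
have ZZa w : `|Z w - Za w| <= a.
  suff -> : Za w = \sum_(j < N) k j * \1_(J j) (Z w) by exact: hJ.
  by apply: eq_bigr => j _.
have EZa : EE P (fun w => Za w * Y w) = 0.
  rewrite [X in EE P X](_ : _ = fun w => \sum_(j < N) k j * (Zj j w * Y w)).
    rewrite EE_sum; last by move=> j; apply: bdd_rvZ; exact: bdd_rvM.
    rewrite big1// => j _; rewrite EEZ; last exact: bdd_rvM.
    by rewrite EE_indic_other ?mulr0.
  by apply/funext => w; rewrite /Za mulr_suml; apply: eq_bigr => j _; rewrite mulrA.
rewrite -[X in `|X|]subr0 -EZa; apply: EE_dist; [exact: bdd_rvM|exact: bdd_rvM|].
by move=> w; rewrite -mulrBl normrM mulrC ler_pM.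
Qed.

End Independence.

(** * Measurability of the states and scalar recursions *)

(** Neighbourhoods come from the sup norm, which [enorm_bound] compares with [enorm] at the cost of
    a factor [d]. *)
Lemma lipschitz_grad_continuous (R : realType) (d : nat) (L : R)
    (f : 'rV[R]_d -> R) (c : 'I_d) :
  0 < L -> lipschitz_grad L f -> continuous (fun z => grad f z 0 c).
Proof.
move=> L0 lf x; apply/(@cvgrPdist_le _ _ _ _ (nbhs_filter x)) => e e0.
have Ld0 : 0 < L * d.+1%:R by rewrite mulr_gt0.
apply/nbhs_ballP; exists (e / (L * d.+1%:R)); first by rewrite /= divr_gt0.
move=> y [_ hy] /=.
have -> : grad f x 0 c - grad f y 0 c = (grad f x - grad f y) 0 c by rewrite !mxE.
apply: le_trans (coord_le_enorm _ _) _; apply: le_trans (lf _ _) _.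
have xy : enorm (x - y) <= d%:R * (e / (L * d.+1%:R)).
  by apply: enorm_bound => c'; rewrite !mxE; have := ltW (hy 0 c').
apply: le_trans (ler_wpM2l (ltW L0) xy) _.
have -> : L * (d%:R * (e / (L * d.+1%:R))) = e * (d%:R / d.+1%:R).
  by field; rewrite ?addr_eq0 !gt_eqF ?ltr0n.
by rewrite ler_piMr ?(ltW e0)// ler_pdivrMr ?ltr0n// mul1r ler_nat.
Qed.

Section StateMeasurability.
Variables (disp : measure_display) (T : measurableType disp).
Variables (R : realType) (d n : nat) (E : rel 'I_n).
Variables (wake : 'I_n -> nat -> bool).
Variable delay : 'I_n -> 'I_n -> nat -> option nat.
Variables (alpha : nat -> R) (f : 'I_n -> 'rV[R]_d -> R).
Variables (x0 : 'I_n -> 'rV[R]_d) (L : 'I_n -> R).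
Hypothesis hL : forall i, 0 < L i.
Hypothesis hlip : forall i, lipschitz_grad (L i) (f i).
Variables (eps : 'I_n -> nat -> T -> 'rV[R]_d) (K : nat).
Hypothesis eps_mvec : forall i t, (t < K)%N -> mvec (eps i t).

Let path (w : T) i t := eps i t w.

Lemma mvec_grad i (X : T -> 'rV[R]_d) : mvec X -> mvec (fun w => grad (f i) (X w)).
Proof.
move=> mX c; apply: (@measurable_continuous_comp _ _ _ _ X (fun z => grad (f i) z 0 c)) => //.
exact: lipschitz_grad_continuous.
Qed.

Let vx_z k i :
  mvec (fun w => vx (agents (rasgp E wake delay alpha f x0 (path w) k) i)) ->
  mvec (fun w => rasgp_z E wake delay alpha f x0 (path w) i k).
Proof.
move=> mx; rewrite [X in mvec X](_ : _ = fun w =>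
  (weight E wake delay f x0 alpha i k)^-1 *:
  vx (agents (rasgp E wake delay alpha f x0 (path w) k) i)).
  exact: mvecZ.
by apply/funext => w; rewrite zE.
Qed.

Let vx_pert k i : (k < K)%N ->
  mvec (fun w => vx (agents (rasgp E wake delay alpha f x0 (path w) k) i)) ->
  mvec (fun w => vx (agents (rasgp E wake delay alpha f x0 (path w) k) i) -
    pert E wake delay alpha f x0 (path w) i k).
Proof.
move=> kK mx; apply: mvecB => //; rewrite /pert; case: (wake i k).
  apply: mvecZ; apply: mvecD; last exact: eps_mvec.
  by apply: mvec_grad; exact: vx_z.
exact: mvec_cst.
Qed.

(** Only the noise before [K] is assumed measurable, so this applies to a sigma-algebra that omits a
    noise vector of time [K]. *)
Lemma mvec_vx k i : (k <= K)%N ->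
  mvec (fun w => vx (agents (rasgp E wake delay alpha f x0 (path w) k) i)).
Proof.
elim/ltn_ind: k i => -[|k] IH j kK; first exact: mvec_cst.
under [X in mvec X]eq_fun do rewrite vx_step.
apply: mvecD.
  by apply: mvecZ; apply: vx_pert => //; apply: IH => //; exact: ltnW.
apply: mvec_sum => i _.
rewrite [X in mvec X](_ : _ = fun w => \sum_(absorbed E wake delay i j k <= t < absorbed E wake delay i j k.+1 | (t < k.+1)%N)
   send R E wake i t *: (vx (agents (rasgp E wake delay alpha f x0 (path w) t) i) -
    pert E wake delay alpha f x0 (path w) i t)).
  apply: mvec_sum => t tk; apply: mvecZ; apply: vx_pert.
    exact: leq_trans tk kK.
  by apply: IH => //; apply: leq_trans kK; exact: ltnW.
apply/funext => w; rewrite big_nat_cond [RHS]big_nat_cond; apply: eq_bigl => t.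
rewrite andbT; case: andP => // -[t1 t2].
by rewrite (leq_trans t2 (absorbed_le E wake delay i j k.+1)).
Qed.

Lemma mvec_z k i : (k <= K)%N ->
  mvec (fun w => rasgp_z E wake delay alpha f x0 (path w) i k).
Proof. by move=> kK; apply: vx_z; exact: mvec_vx. Qed.

Lemma mvec_center k : (k <= K)%N ->
  mvec (fun w => center E wake delay f x0 alpha (path w) k).
Proof.
elim: k => [|k IH] kK; first exact: mvec_cst.
apply: mvecB; last first.
  by apply: mvecZ; apply: mvec_sum => i _; apply: mvecZ; exact: eps_mvec.
apply: mvecB; first by apply: IH; exact: ltnW.
apply: mvecZ; apply: mvec_sum => i _; apply: mvec_grad; apply: mvec_z.
exact: ltnW.
Qed.

End StateMeasurability.

(** * Decay of scalar recursions with factor 1 - 2/k *)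

Section Sequences.
Variable R : realType.
Implicit Types (u : nat -> R) (c C : R).

(** [C' / x] dominates the recursion because [(x - 2) / x ^+ 2 + 1 / x ^+ 2 <= 1 / (x + 1)]. *)
Lemma harmonic_decay u C : 0 <= C -> (forall k, 0 <= u k) ->
  (forall k, (0 < k)%N -> u k.+1 <= (1 - 2 / k%:R) * u k + C / k%:R ^+ 2) ->
  exists2 C', 0 <= C' & forall k, (0 < k)%N -> u k <= C' / k%:R.
Proof.
move=> C0 u0 hu; pose C' := u 1%N + 2 * C.
have C'0 : 0 <= C' by rewrite addr_ge0 ?mulr_ge0.
exists C' => // -[//|k _]; elim: k => [|k IH].
  by rewrite divr1 /C' lerDl mulr_ge0.
apply: le_trans (hu _ (ltn0Sn k)) _.
(* At time 1 the factor is [-1], so that time is treated apart. *)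
have [->|k0] := posnP k.
  by rewrite !divr1 expr1n divr1; have := u0 1%N; rewrite /C'; lra.
set x : R := k.+1%:R.
have x2 : 2 <= x by rewrite /x ler_nat.
have -> : k.+2%:R = x + 1 :> R by rewrite /x -natr1.
have x0 : 0 < x by lra.
have h : (1 - 2 / x) * u k.+1 <= (1 - 2 / x) * (C' / x).
  by apply: ler_wpM2l => //; rewrite subr_ge0 ler_pdivrMr// mul1r.
have CC : C <= C' by rewrite /C'; have := u0 1%N; lra.
have h2 : C / x ^+ 2 <= C' / x ^+ 2.
  by rewrite ler_wpM2r// invr_ge0 exprn_ge0// ltW.
apply: le_trans (lerD h h2) _.
have -> : (1 - 2 / x) * (C' / x) + C' / x ^+ 2 = C' * ((x - 1) / x ^+ 2).
  by field; rewrite gt_eqF.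
rewrite ler_wpM2l// ler_pdivrMr ?exprn_gt0// mulrC ler_pdivlMr; last by lra.
lra.
Qed.

(** The leading constant [c] is reproduced without loss, as in [harmonic_decay]. For the remainder,
    the 2 of the factor exceeds the exponent 3/2, and the spare 1/2 pays for [C <= C' / 2]. *)
Lemma half_power_decay u c C : 0 <= c -> 0 <= C -> (forall k, 0 <= u k) ->
  (forall k, (0 < k)%N -> u k.+1 <= (1 - 2 / k%:R) * u k + c / k%:R ^+ 2 +
     C / (k%:R ^+ 2 * Num.sqrt k%:R)) ->
  exists2 C', 0 <= C' &
    forall k, (0 < k)%N -> u k <= c / k%:R + C' / (k%:R * Num.sqrt k%:R).
Proof.
move=> c0 C0 u0 hu; pose C' := u 1%N + 4 * (c + C).
have u10 := u0 1%N.
have C'0 : 0 <= C' by rewrite /C'; lra.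
exists C' => // -[//|k _]; elim: k => [|k IH].
  by rewrite sqrtr1 mulr1 !divr1 /C'; lra.
apply: le_trans (hu _ (ltn0Sn k)) _.
have [->|k0] := posnP k.
  rewrite sqrtr1 !expr1n mulr1 !divr1.
  have s2 : Num.sqrt 2 <= 2 :> R.
    by rewrite -[leRHS]ger0_norm// -sqrtr_sqr ler_sqrt// expr2; lra.
  have s20 : 0 < 2 * Num.sqrt 2 :> R by rewrite mulr_gt0// sqrtr_gt0.
  have : C' / 4 <= C' / (2 * Num.sqrt 2).
    by rewrite ler_wpM2l// lef_pV2 ?posrE//; lra.
  by rewrite /C'; lra.
set x : R := k.+1%:R.
have x2 : 2 <= x by rewrite /x ler_nat.
have -> : k.+2%:R = x + 1 :> R by rewrite /x -natr1.
have x0 : 0 < x by lra.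
set s := Num.sqrt x; set t := Num.sqrt (x + 1).
have s0 : 0 < s by rewrite sqrtr_gt0.
have t0 : 0 < t by rewrite sqrtr_gt0; lra.
have sx : s ^+ 2 = x by rewrite sqr_sqrtr// ltW.
have tx : t ^+ 2 = x + 1 by rewrite sqr_sqrtr//; lra.
have h : (1 - 2 / x) * u k.+1 <= (1 - 2 / x) * (c / x + C' / (x * s)).
  by apply: ler_wpM2l => //; rewrite subr_ge0 ler_pdivrMr// mul1r.
have CC : C <= C' / 2 by rewrite /C'; lra.
have h2 : C / (x ^+ 2 * s) <= C' / 2 / (x ^+ 2 * s).
  by rewrite ler_wpM2r// invr_ge0 mulr_ge0 ?exprn_ge0 ?ltW.
have hc : (1 - 2 / x) * (c / x) + c / x ^+ 2 <= c / (x + 1).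
  have -> : (1 - 2 / x) * (c / x) + c / x ^+ 2 = c * ((x - 1) / x ^+ 2).
    by field; rewrite gt_eqF.
  rewrite ler_wpM2l// ler_pdivrMr ?exprn_gt0// mulrC ler_pdivlMr; last by lra.
  lra.
have hC : (1 - 2 / x) * (C' / (x * s)) + C' / 2 / (x ^+ 2 * s) <= C' / ((x + 1) * t).
  have -> : (1 - 2 / x) * (C' / (x * s)) + C' / 2 / (x ^+ 2 * s) =
      C' * ((x - 3 / 2) / (x ^+ 2 * s)).
    by field; rewrite !gt_eqF.
  rewrite ler_wpM2l// ler_pdivrMr; last by rewrite mulr_gt0 ?exprn_gt0.
  rewrite [leRHS]mulrC ler_pdivlMr; last by rewrite mulr_gt0//; lra.
  rewrite -(ler_pXn2r (n := 2))// ?nnegrE.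
  (* Squaring removes the roots; the polynomial left is positive from [x = 2] on. *)
  - rewrite !exprMn tx sx -subr_ge0.
    have -> : (x ^+ 2) ^+ 2 * x - (x - 3 / 2) ^+ 2 * ((x + 1) ^+ 2 * (x + 1)) =
        15 / 4 * (x * (x ^+ 2 - 1)) + (5 / 4 * (x ^+ 2 - 1) - 1) by field.
    have x4 : 4 <= x ^+ 2 by rewrite expr2; nra.
    have : 0 <= x * (x ^+ 2 - 1) by rewrite mulr_ge0 ?ltW//; lra.
    lra.
  - by rewrite mulr_ge0 ?mulr_ge0 ?(ltW t0)//; lra.
  - by rewrite mulr_ge0 ?exprn_ge0 ?ltW.
apply: le_trans (lerD (lerD h (lexx _)) h2) _.
apply: le_trans (lerD hc hC); rewrite mulrDr.
by rewrite [X in X + _]addrAC -!addrA.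
Qed.

End Sequences.

(** * The mean square error *)

(** Cauchy-Schwarz against the constant 1; the induction step is the nonnegativity of the sum of
    [(u t - v) ^+ 2], with [v] the new term. *)
Lemma sqr_sum_nat_le (R : realType) (u : nat -> R) (m p : nat) : (m <= p)%N ->
  (\sum_(m <= t < p) u t) ^+ 2 <= (p - m)%:R * \sum_(m <= t < p) u t ^+ 2.
Proof.
move=> /subnKC <-; rewrite addKn; elim: (p - m)%N => [|l IH].
  by rewrite addn0 !big_geq// expr0n mulr0.
rewrite addnS !big_nat_recr ?leq_addr//=.
set S := \sum_(m <= t < m + l) u t in IH *.
set Q := \sum_(m <= t < m + l) u t ^+ 2 in IH *.
set v := u (m + l)%N.
have : 0 <= \sum_(m <= t < m + l) (u t - v) ^+ 2.
  by apply: sumr_ge0 => t _; exact: sqr_ge0.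
have -> : \sum_(m <= t < m + l) (u t - v) ^+ 2 = Q - 2 * v * S + l%:R * v ^+ 2.
  have -> : l%:R * v ^+ 2 = \sum_(m <= t < m + l) v ^+ 2.
    by rewrite sumr_const_nat addKn mulr_natl.
  rewrite mulr_sumr -sumrB -big_split; apply: eq_bigr => t _ /=; ring.
rewrite -natr1; move: IH; lra.
Qed.

Section MeanSquare.
Variables (R : realType) (d n : nat) (E : rel 'I_n).
Variables (wake : 'I_n -> nat -> bool).
Variable delay : 'I_n -> 'I_n -> nat -> option nat.
Variables (f : 'I_n -> 'rV[R]_d -> R) (x0 : 'I_n -> 'rV[R]_d).
Variables (Ldel Lu Lf : nat).
Hypothesis n_gt0 : (0 < n)%N.
Hypothesis Lu_gt0 : (0 < Lu)%N.
Hypothesis comm : communication_assumption E wake delay Ldel Lu Lf.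
Variables (mu L : 'I_n -> R) (zstar : 'rV[R]_d).
Hypothesis hdiff : forall i z, differentiable (f i) z.
Hypothesis hmu : forall i, 0 < mu i.
Hypothesis hconvex : forall i, strongly_convex (mu i) (f i).
Hypothesis hL : forall i, 0 < L i.
Hypothesis hlip : forall i, lipschitz_grad (L i) (f i).
Hypothesis hzstar : forall z, \sum_(i < n) f i zstar <= \sum_(i < n) f i z.
Let mutot := \sum_(i < n) mu i.
Local Notation alpha := (stepsize mu).

(** Stated before the sample space is fixed: it is applied to that space with two different
    sigma-algebras. *)
Lemma mvec_drift (disp' : measure_display) (T' : measurableType disp')
    (e : 'I_n -> nat -> T' -> 'rV[R]_d) k :
  (forall i t, (t < k)%N -> mvec (e i t)) ->
  mvec (fun w => drift E wake delay f x0 mu zstar (fun i t => e i t w) k).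
Proof.
move=> me; apply: mvecB.
  apply: mvecB; last exact: mvec_cst.
  exact: (mvec_center E wake delay alpha x0 hL hlip me (leqnn k)).
apply: mvecZ; apply: mvec_sum => i _; apply: (mvec_grad hL hlip).
exact: (mvec_z E wake delay alpha x0 hL hlip me i (leqnn k)).
Qed.

Variables (disp : measure_display) (T : measurableType disp).
Variable P : probability T R.
Variables (eps : 'I_n -> nat -> T -> 'rV[R]_d) (b : R) (sigma : 'I_n -> R).
Hypothesis b_ge0 : 0 <= b.
Hypothesis eps_rv : forall i k, random_vector (eps i k).
Hypothesis eps_ind : independent_family P (fun p : 'I_n * nat => eps p.1 p.2).
Hypothesis eps_le : forall i k w, enorm (eps i k w) <= b.
Hypothesis eps_mean : forall i k (c : 'I_d), EE P (fun w => eps i k w 0 c) = 0.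
Hypothesis eps_var : forall i k,
  EE P (fun w => enorm (eps i k w) ^+ 2) <= sigma i ^+ 2.

Let path w i t := eps i t w.
Let path_le w : noise_le b (path w).
Proof. by move=> i t; exact: eps_le. Qed.

Let eps_mvec i t : mvec (eps i t).
Proof. exact: random_vector_mvec. Qed.

Local Notation cent k w := (center E wake delay f x0 alpha (path w) k).
Local Notation z i k w := (rasgp_z E wake delay alpha f x0 (path w) i k).
Local Notation dr k w := (drift E wake delay f x0 mu zstar (path w) k).
Local Notation bet i k := (beta wake alpha i k).

Let err k w := enorm (cent k w - zstar).

Let bdd_enorm (X : T -> 'rV[R]_d) :
  mvec X -> rbounded (fun w => enorm (X w)) -> bdd_rv (fun w => enorm (X w)).
Proof. by move=> mX bX; split => //; exact: measurable_enorm. Qed.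

Let bdd_coord (X : T -> 'rV[R]_d) c :
  mvec X -> rbounded (fun w => enorm (X w)) -> bdd_rv (fun w => X w 0 c).
Proof.
move=> mX [M hM]; split; first exact: mX.
exists M => w; apply: le_trans (coord_le_enorm _ _) _.
exact: le_trans (ler_norm _) (hM w).
Qed.

Let bdd_sqr (X : T -> R) : bdd_rv X -> bdd_rv (fun w => X w ^+ 2).
Proof. by move=> bX; exact: bdd_rvM. Qed.

Let eps_rbd i k : rbounded (fun w => enorm (eps i k w)).
Proof. by exists b => w; rewrite ger0_norm ?enorm_ge0. Qed.

Let cent_mvec k : mvec (fun w => cent k w).
Proof.
exact: (mvec_center E wake delay alpha x0 hL hlip (fun i t _ => @eps_mvec i t)
  (leqnn k)).
Qed.

Let err_bdd k : bdd_rv (err k).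
Proof.
apply: bdd_enorm.
  apply: mvecB; [exact: cent_mvec|exact: mvec_cst].
have [r r0 bd] := iterates_bounded x0 n_gt0 Lu_gt0 comm hdiff hmu hconvex hL hlip hzstar b_ge0.
by exists r => w; rewrite ger0_norm ?enorm_ge0//; have [] := bd _ (path_le w) k.
Qed.

Let drift_mvec k : mvec (fun w => dr k w).
Proof. exact: mvec_drift. Qed.

Let drift_rbd k : rbounded (fun w => enorm (dr k w)).
Proof.
have [r r0 bd] := iterates_bounded x0 n_gt0 Lu_gt0 comm hdiff hmu hconvex hL hlip hzstar b_ge0.
have hn := fun w => noise_step_le n_gt0 Lu_gt0 comm hmu b_ge0 k (path_le w).
exists (r + Lu%:R ^+ 2 * (2 * n%:R / mutot) * b / k.+1%:R) => w.
rewrite ger0_norm ?enorm_ge0//.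
have -> : dr k w = (cent k.+1 w - zstar) +
    n%:R^-1 *: \sum_(i | wake i k) bet i k *: path w i k.
  by rewrite center_drift subrK.
apply: le_trans (ler_enormD _ _) (lerD _ (hn w)).
by have [] := bd _ (path_le w) k.+1.
Qed.

(** Pythagoras, one agent at a time: the drift and the noises of the agents in the tail are
    functions of noise vectors other than [eps i k], so the cross term vanishes. *)
Lemma EE_noise_coord k c (a : 'I_n -> R) (s : seq 'I_n) : uniq s ->
  EE P (fun w => (dr k w 0 c - \sum_(i <- s) a i * eps i k w 0 c) ^+ 2) =
  EE P (fun w => dr k w 0 c ^+ 2) +
  \sum_(i <- s) a i ^+ 2 * EE P (fun w => eps i k w 0 c ^+ 2).
Proof.
have bD := bdd_coord c (@drift_mvec k) (drift_rbd k).
have be i : bdd_rv (fun w => eps i k w 0 c) by exact: bdd_coord.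
elim: s => [_|i s IH] /=.
  by rewrite big_nil addr0; congr EE; apply/funext => w; rewrite big_nil subr0.
move=> /andP[si us]; rewrite big_cons addrCA -IH//.
pose Z w := dr k w 0 c - \sum_(j <- s) a j * eps j k w 0 c.
have bZ : bdd_rv Z.
  by apply: bdd_rvB => //; apply: bdd_rv_sum => j; exact: bdd_rvZ.
have EZ : EE P (fun w => Z w * eps i k w 0 c) = 0.
  have rv (p : 'I_n * nat) : random_vector (eps p.1 p.2) by exact: eps_rv.
  have be2 : rbounded (fun w => eps i k w 0 c) := (be i).2.
  apply: (EE_indep0 rv eps_ind (p := (i, k)) be2 (eps_mean i k c)); last first.
    exact: bZ.2.
  have me j t : (j, t) != (i, k) -> mvec (T := g_sigma_algebraType
      (other_cylinders (fun p : 'I_n * nat => eps p.1 p.2) (i, k))) (eps j t).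
    move=> jt; apply: random_vector_mvec => S bS.
    apply: sub_sigma_algebra.
    exact: (other_cylinders1 (fun p : 'I_n * nat => eps p.1 p.2) jt bS).
  apply: measurable_funB.
    apply: (@mvec_drift _ (g_sigma_algebraType
      (other_cylinders (fun p : 'I_n * nat => eps p.1 p.2) (i, k))) eps k).
    by move=> j t tk; apply: me; rewrite xpair_eqE (ltn_eqF tk) andbF.
  (* Measurability is asked of the term at every index, yet [eps i k] need not be measurable for
     this sigma-algebra; as [i] is not in [s], its term may be set to 0. *)
  have -> : (fun w => \sum_(j <- s) a j * eps j k w 0 c) =
      (fun w => \sum_(j <- s) (if j == i then 0 else a j * eps j k w 0 c)).
    apply/funext => w; apply: eq_big_seq => j js; case: eqP => // ji.
    by move: si; rewrite -ji js.
  apply: measurable_sum => j; case: (eqVneq j i) => [_|ji].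
    exact: measurable_cst.
  apply: measurable_funM; first exact: measurable_cst.
  by apply: me; rewrite xpair_eqE (negbTE ji).
rewrite [X in EE P X](_ : _ = fun w =>
  (Z w ^+ 2 + (- (2 * a i)) * (Z w * eps i k w 0 c)) + a i ^+ 2 * eps i k w 0 c ^+ 2).
  have h1 := bdd_sqr bZ; have h2 := bdd_rvZ (- (2 * a i)) (bdd_rvM bZ (be i)).
  have h3 := bdd_rvZ (a i ^+ 2) (bdd_sqr (be i)).
  rewrite (EED P (bdd_rvD h1 h2) h3) (EED P h1 h2) (EEZ P _ (bdd_rvM bZ (be i))).
  by rewrite EZ mulr0 addr0 (EEZ P _ (bdd_sqr (be i))) addrC.
by apply/funext => w; rewrite big_cons /Z; ring.
Qed.

Let EE_enorm_sqr (X : T -> 'rV[R]_d) : mvec X -> rbounded (fun w => enorm (X w)) ->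
  EE P (fun w => enorm (X w) ^+ 2) = \sum_(c < d) EE P (fun w => X w 0 c ^+ 2).
Proof.
move=> mX bX; rewrite -EE_sum; last by move=> c; apply: bdd_sqr; exact: bdd_coord.
by congr EE; apply/funext => w; rewrite sqr_enorm; apply: eq_bigr => c _; rewrite expr2.
Qed.

Lemma EE_noise k : EE P (fun w => err k.+1 w ^+ 2) =
  EE P (fun w => enorm (dr k w) ^+ 2) +
  \sum_(i | wake i k) (bet i k / n%:R) ^+ 2 * EE P (fun w => enorm (eps i k w) ^+ 2).
Proof.
rewrite (EE_enorm_sqr (@drift_mvec k) (drift_rbd k)).
rewrite (EE_enorm_sqr (X := fun w => cent k.+1 w - zstar)); last first.
  exact: (err_bdd k.+1).2.
  by apply: mvecB; [exact: cent_mvec|exact: mvec_cst].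
under [X in _ + X]eq_bigr => i _ do rewrite EE_enorm_sqr// mulr_sumr.
rewrite exchange_big -big_split/=; apply: eq_bigr => c _.
rewrite -[in RHS]big_filter -EE_noise_coord ?filter_uniq ?index_enum_uniq//.
congr EE; apply/funext => w; rewrite center_drift; move: (dr k w) => D.
rewrite !mxE summxE mulr_sumr big_filter; congr ((_ - _) ^+ 2).
by apply: eq_bigr => i _; rewrite mxE; ring.
Qed.

Let sigma2 := \sum_(i < n) sigma i ^+ 2.

Lemma mean_square_step : exists2 C, 0 <= C & forall k, (0 < k)%N ->
  EE P (fun w => err k.+1 w ^+ 2) <=
  (1 - 2 / k%:R) * EE P (fun w => err k w ^+ 2) +
  C / k%:R ^+ 2 * (EE P (fun w => err k w ^+ 2) + EE P (err k)) +
  C / k%:R ^+ 3 +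
  \sum_(i | wake i k) (bet i k / n%:R) ^+ 2 * sigma i ^+ 2.
Proof.
have [C C0 dl] := drift_le x0 n_gt0 Lu_gt0 comm hdiff hmu hconvex hL hlip hzstar b_ge0.
exists C => // k k0; rewrite EE_noise; apply: lerD; last first.
  apply: ler_sum => i _; rewrite ler_wpM2l ?sqr_ge0//.
have be2 := bdd_sqr (err_bdd k).
have bb := bdd_rvD be2 (err_bdd k).
rewrite -EED// -EEZ// -EEZ// -EED; try exact: bdd_rvZ.
rewrite -[C / k%:R ^+ 3](EE_cst P) -EED; last 2 first.
- by apply: bdd_rvD; exact: bdd_rvZ.
- exact: bdd_rv_cst.
apply: ler_EE.
- by apply: bdd_sqr; apply: bdd_enorm => //; exact: drift_rbd.
- by apply: bdd_rvD; [apply: bdd_rvD; exact: bdd_rvZ|exact: bdd_rv_cst].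
by move=> w; exact: dl (path_le w) k k0.
Qed.

(* The variance that the pending noise will contribute at the next wake-ups,
   charged one iteration at a time. *)
Let phi k := Lu%:R * \sum_(i < n) sigma i ^+ 2 *
  \sum_(last_wake wake i k <= t < k) (alpha t / n%:R) ^+ 2.

Let phi_ge0 k : 0 <= phi k.
Proof.
apply: mulr_ge0 => //; apply: sumr_ge0 => i _; apply: mulr_ge0 (sqr_ge0 _) _.
by apply: sumr_ge0 => t _; exact: sqr_ge0.
Qed.

(** At a wake-up of [i] the charge is released: [bet i k] consists of at most [Lu] step sizes, so
    its square is at most [Lu] times the sum of squares charged so far, and the charge restarts from
    0. *)
Lemma phi_step k :
  phi k.+1 + \sum_(i | wake i k) (bet i k / n%:R) ^+ 2 * sigma i ^+ 2 <=
  phi k + Lu%:R * sigma2 * (alpha k / n%:R) ^+ 2.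
Proof.
rewrite /phi.
have -> : Lu%:R * sigma2 * (alpha k / n%:R) ^+ 2 =
    \sum_(i < n) Lu%:R * (sigma i ^+ 2 * (alpha k / n%:R) ^+ 2).
  by rewrite /sigma2 mulr_sumr mulr_suml; apply: eq_bigr => i _; rewrite mulrA.
rewrite 2!mulr_sumr [X in _ + X <= _]big_mkcond -2!big_split/=.
apply: ler_sum => i _; case: (boolP (wake i k)) => wi; last first.
  by rewrite addr0 big_nat_recr ?last_wake_le//= !mulrDr.
rewrite big_geq// mulr0 mulr0 add0r -2!mulrDr [leLHS]mulrC [leRHS]mulrCA.
rewrite ler_wpM2l ?sqr_ge0//.
have -> : \sum_(last_wake wake i k <= t < k) (alpha t / n%:R) ^+ 2 + (alpha k / n%:R) ^+ 2
    = \sum_(last_wake wake i k <= t < k.+1) (alpha t / n%:R) ^+ 2.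
  by rewrite big_nat_recr ?last_wake_le.
rewrite /beta mulr_suml.
apply: le_trans (sqr_sum_nat_le _ (leqW (last_wake_le wake i k))) _.
apply: ler_wpM2r; first by apply: sumr_ge0 => t _; exact: sqr_ge0.
by rewrite ler_nat leq_subLR; exact: last_wake_lag comm i k.
Qed.

Lemma phi_le : exists2 C, 0 <= C & forall k, (0 < k)%N -> phi k <= C / k%:R ^+ 2.
Proof.
pose A := Lu%:R * (2 * n%:R / mutot) / n%:R.
have A0 : 0 <= A by rewrite !mulr_ge0 ?invr_ge0// ltW// mutot_gt0.
exists (Lu%:R * (sigma2 * (Lu%:R * A ^+ 2))).
  have s0 : 0 <= sigma2 by apply: sumr_ge0 => i _; exact: sqr_ge0.
  by apply: mulr_ge0 => //; apply: mulr_ge0 => //; apply: mulr_ge0 (sqr_ge0 _).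
move=> k k0; have kR : 0 < k%:R :> R by rewrite ltr0n.
rewrite -mulrA /phi ler_wpM2l// -mulrA /sigma2 mulr_suml; apply: ler_sum => i _.
rewrite ler_wpM2l ?sqr_ge0//.
have lw := last_wake_lag comm i k; have lk := last_wake_le wake i k.
apply: (@le_trans _ _ (\sum_(last_wake wake i k <= t < k) (A / k%:R) ^+ 2)).
  rewrite big_nat_cond [leRHS]big_nat_cond; apply: ler_sum.
  move=> t /andP[/andP[t1 t2] _].
  have at0 : 0 <= alpha t / n%:R by rewrite divr_ge0// alpha_ge0.
  have atA : alpha t / n%:R <= A / k%:R.
    have h := @alpha_lag R n Lu n_gt0 Lu_gt0 mu b hmu b_ge0 k t (ltnW t2).
    have {}h := h (leq_trans lw _); rewrite /A [leRHS]mulrAC ler_wpM2r ?invr_ge0//.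
    apply: le_trans (h _) _; first by rewrite leq_add2r.
    rewrite ler_wpM2l ?mulr_ge0 ?invr_ge0 ?(ltW (mutot_gt0 n_gt0 hmu))//.
    by rewrite lef_pV2 ?posrE ?ltr0n// ler_nat.
  by rewrite ler_pXn2r ?nnegrE// (le_trans at0).
rewrite sumr_const_nat -[leLHS]mulr_natl.
have AB : 0 <= (A / k%:R) ^+ 2 by exact: sqr_ge0.
rewrite [leRHS](_ : _ = Lu%:R * (A / k%:R) ^+ 2); last first.
  suff H (u v : R) : Lu%:R * u ^+ 2 / v ^+ 2 = Lu%:R * (u / v) ^+ 2 by exact: H.
  by rewrite expr_div_n [RHS]mulrA.
by rewrite ler_wpM2r// ler_nat; lia.
Qed.

Let mse k := EE P (fun w => err k w ^+ 2).

Let mse_ge0 k : 0 <= mse k.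
Proof. by apply: Rintegral_ge0 => w _; exact: sqr_ge0. Qed.

Let lyap k := mse k + phi k.

Let c := Lu%:R * sigma2 / mutot ^+ 2.

Let c_ge0 : 0 <= c.
Proof.
rewrite divr_ge0 ?sqr_ge0// mulr_ge0//.
by apply: sumr_ge0 => i _; exact: sqr_ge0.
Qed.

(** Adding [phi] replaces the irregular variance of the wake-ups by [c / k ^+ 2] at every iteration.
    The factor [1 - 2 / k] then also hits [phi], which costs [2 * D / k ^+ 3] since [phi] is
    O(1/k^2). *)
Lemma lyapunov_step : exists2 C, 0 <= C & forall k, (0 < k)%N ->
  lyap k.+1 <= (1 - 2 / k%:R) * lyap k + c / k%:R ^+ 2 +
  C / k%:R ^+ 2 * (mse k + EE P (err k)) + C / k%:R ^+ 3.
Proof.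
have [C C0 step] := mean_square_step; have [D D0 phiD] := phi_le.
exists (C + 2 * D); first by rewrite addr_ge0 ?mulr_ge0.
move=> k k0; have h1 := step k k0; have h2 := phi_step k; have h3 := phiD k k0.
have kR : 0 < k%:R :> R by rewrite ltr0n.
have m0 : 0 < mutot := mutot_gt0 n_gt0 hmu.
have cE : Lu%:R * sigma2 * (alpha k / n%:R) ^+ 2 = c / k%:R ^+ 2.
  rewrite (a_eq n_gt0 mu k0) -/mutot /c.
  by move: sigma2 mutot m0 => s m m0'; field; rewrite !gt_eqF.
have r0 : 0 <= EE P (err k).
  by apply: Rintegral_ge0 => w _; exact: enorm_ge0.
have h4 : 2 / k%:R * phi k <= 2 * D / k%:R ^+ 3.
  apply: le_trans (ler_wpM2l _ h3) _; first by rewrite divr_ge0// ltW.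
  by rewrite le_eqVlt; apply/orP; left; apply/eqP; field; rewrite gt_eqF.
have h5 : 0 <= 2 * D / k%:R ^+ 2 * (mse k + EE P (err k)).
  by rewrite mulr_ge0 ?addr_ge0// divr_ge0 ?exprn_ge0 ?mulr_ge0// ltW.
rewrite /lyap mulrDr mulrBl mul1r [X in _ <= _ + X + _ + _ + _]mulrBl mul1r.
rewrite [X in _ <= _ + X * _ + _]mulrDl [X in _ <= _ + _ + X]mulrDl.
rewrite [X in _ <= _ + X + _]mulrDl.
move: h1 h2 h4 h5; rewrite cE -/(mse k) -/(mse k.+1) [X in _ <= X + _ + _ + _]mulrBl mul1r.
move: (\sum_(i | _) _) (EE P _) (mse k.+1) (mse k) (phi k.+1) (phi k) => S r m1 m p1 p.
move: (C / k%:R ^+ 2 * (m + r)) (2 * D / k%:R ^+ 2 * (m + r)) (C / k%:R ^+ 3).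
move: (2 * D / k%:R ^+ 3) (c / k%:R ^+ 2) (2 / k%:R * m) (2 / k%:R * p).
move=> *; lra.
Qed.

Theorem mean_square_rate : exists2 C, 0 <= C & forall i k, (0 < k)%N ->
  EE P (fun w => enorm (z i k w - zstar) ^+ 2) <=
  c / k%:R + C / (k%:R * Num.sqrt k%:R).
Proof.
have [C C0 step] := lyapunov_step.
have [B B0 bd] := iterates_bounded x0 n_gt0 Lu_gt0 comm hdiff hmu hconvex hL hlip hzstar b_ge0.
have [Ct Ct0 track] := agents_track x0 n_gt0 Lu_gt0 comm hdiff hmu hconvex hL hlip hzstar b_ge0.
have lyap0 k : 0 <= lyap k by rewrite addr_ge0.
have mseV k : mse k <= lyap k by rewrite lerDl.
have errB k w : err k w <= B by have [] := bd _ (path_le w) k.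
(* First round: boundedness of [err] makes all the terms besides the contraction O(1/k^2). *)
have [C1 C10 coarse] : exists2 C1, 0 <= C1 &
    forall k, (0 < k)%N -> lyap k <= C1 / k%:R.
  apply: (@harmonic_decay R lyap (c + C * (B ^+ 2 + B) + C)) => //.
    exact: (addr_ge0 (addr_ge0 c_ge0 (mulr_ge0 C0 (addr_ge0 (sqr_ge0 B) B0))) C0).
  move=> k k0; apply: le_trans (step k k0) _.
  have kR : 0 < k%:R :> R by rewrite ltr0n.
  have k1 : 1 <= k%:R :> R by rewrite ler1n.
  have m1 : mse k <= B ^+ 2.
    rewrite -[leRHS](EE_cst P); apply: ler_EE; [exact: bdd_sqr|exact: bdd_rv_cst|].
    by move=> w; rewrite ler_pXn2r ?nnegrE ?enorm_ge0.
  have r1 : EE P (err k) <= B.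
    by rewrite -[leRHS](EE_cst P); apply: ler_EE => //; exact: bdd_rv_cst.
  have i2 : 0 <= C / k%:R ^+ 2 by rewrite divr_ge0 ?exprn_ge0 ?(ltW kR).
  have h1 := ler_wpM2l i2 (lerD m1 r1).
  have h2 : C / k%:R ^+ 3 <= C / k%:R ^+ 2.
    rewrite ler_wpM2l// lef_pV2 ?posrE ?exprn_gt0//.
    by rewrite [leRHS]exprS ler_peMl// exprn_ge0// ltW.
  apply: le_trans (lerD (lerD (lexx _) h1) h2) _.
  by rewrite le_eqVlt; apply/orP; left; apply/eqP; ring.
have sk k : (0 < k)%N -> let s : R := Num.sqrt k%:R in
    [/\ 0 < s, s ^+ 2 = k%:R & s <= k%:R].
  move=> k0 s; have kR : 0 < k%:R :> R by rewrite ltr0n.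
  have s0 : 0 < s by rewrite sqrtr_gt0.
  have s2 : s ^+ 2 = k%:R by rewrite sqr_sqrtr// ltW.
  have s1 : 1 <= s by rewrite -sqrtr1 ler_sqrt ?ler1n// ltW.
  by split=> //; rewrite -s2 expr2 ler_peMl// ltW.
(* AM-GM: [2 x <= s x^2 + 1 / s] with [s = sqrt k]. *)
have rle k : (0 < k)%N -> EE P (err k) <= (C1 + 1) / 2 / Num.sqrt k%:R.
  move=> k0; have [] := sk k k0; set s := Num.sqrt _ => s0 s2 sle.
  have bA : bdd_rv (fun w => s / 2 * err k w ^+ 2) by apply: bdd_rvZ; exact: bdd_sqr.
  have bB := bdd_rv_cst T (2 * s)^-1.
  have h1 : EE P (err k) <= s / 2 * mse k + (2 * s)^-1.
    rewrite /mse -EEZ; last exact: bdd_sqr.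
    rewrite -[(2 * s)^-1](EE_cst P) -EED//; apply: ler_EE => //.
      exact: bdd_rvD.
    move=> w; rewrite -subr_ge0.
    have -> : s / 2 * err k w ^+ 2 + (2 * s)^-1 - err k w =
        (2 * s)^-1 * (s * err k w - 1) ^+ 2 by field; rewrite gt_eqF.
    by rewrite mulr_ge0 ?sqr_ge0// invr_ge0 mulr_ge0// ltW.
  apply: le_trans h1 _.
  have h2 : s / 2 * mse k <= s / 2 * (C1 / k%:R).
    rewrite ler_wpM2l ?divr_ge0 ?(ltW s0)//.
    exact: le_trans (mseV k) (coarse k k0).
  apply: le_trans (lerD h2 (lexx _)) _.
  by rewrite -s2 le_eqVlt; apply/orP; left; apply/eqP; field; rewrite gt_eqF.
have mle k : (0 < k)%N -> mse k <= C1 / Num.sqrt k%:R.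
  move=> k0; have [s0 s2 sle] := sk k k0.
  apply: le_trans (le_trans (mseV k) (coarse k k0)) _.
  by rewrite ler_wpM2l// lef_pV2 ?posrE ?ltr0n.
pose C2 := C1 + (C1 + 1) / 2.
have C20 : 0 <= C2 by rewrite /C2; lra.
(* Second round: the factor multiplying [C / k ^+ 2] is now O(k^(-1/2)), so the constant of the main
   term is [c] itself. *)
have [C3 C30 fine3] : exists2 C3, 0 <= C3 & forall k, (0 < k)%N ->
    lyap k <= c / k%:R + C3 / (k%:R * Num.sqrt k%:R).
  apply: (@half_power_decay R lyap c (C * C2 + C)) => //.
    by rewrite addr_ge0 ?mulr_ge0.
  move=> k k0; apply: le_trans (step k k0) _; rewrite -addrA lerD2l.
  have [] := sk k k0; set s := Num.sqrt _ => s0 s2 sle.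
  have kR : 0 < k%:R :> R by rewrite ltr0n.
  have i2 : 0 <= C / k%:R ^+ 2 by rewrite divr_ge0 ?exprn_ge0 ?(ltW kR).
  have h1 := ler_wpM2l i2 (lerD (mle k k0) (rle k k0)).
  have h2 : C / k%:R ^+ 3 <= C / (k%:R ^+ 2 * s).
    rewrite ler_wpM2l// lef_pV2 ?posrE ?mulr_gt0 ?exprn_gt0//.
    by rewrite [leRHS]exprSr ler_wpM2l// exprn_ge0// ltW.
  apply: le_trans (lerD h1 h2) _; rewrite -/s /C2.
  by rewrite le_eqVlt; apply/orP; left; apply/eqP; field; rewrite !gt_eqF.
exists (C3 + Ct * (C1 + 1) + Ct ^+ 2).
  by rewrite !addr_ge0 ?sqr_ge0 ?mulr_ge0 ?addr_ge0.
move=> i k k0.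
have [] := sk k k0; set s := Num.sqrt _ => s0 s2 sle.
have kR : 0 < k%:R :> R by rewrite ltr0n.
have q0 : 0 <= 2 * (Ct / k%:R) by rewrite mulr_ge0 ?divr_ge0 ?(ltW kR).
have be2 := bdd_sqr (err_bdd k).
have bM := bdd_rvZ (2 * (Ct / k%:R)) (err_bdd k).
have pt w : enorm (z i k w - zstar) <= err k w + Ct / k%:R.
  apply: le_trans (ler_enormB _ (cent k w) _) _; rewrite addrC lerD2l.
  apply: le_trans (track _ (path_le w) i k) _.
  by rewrite ler_wpM2l// lef_pV2 ?posrE ?ltr0n// ler_nat.
have bz : bdd_rv (fun w => enorm (z i k w - zstar)).
  apply: bdd_enorm.
    apply: mvecB; last exact: mvec_cst.
    exact: (mvec_z E wake delay alpha x0 hL hlip (fun i t _ => @eps_mvec i t)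
      i (leqnn k)).
  exists (B + Ct / k%:R) => w; rewrite ger0_norm ?enorm_ge0//.
  by apply: le_trans (pt w) _; rewrite lerD2r.
(* From the center to the agent: the cross term is [1/k] times [EE P (err k)], thus O(k^(-3/2)) by
   [rle]. *)
have h : EE P (fun w => enorm (z i k w - zstar) ^+ 2) <=
    mse k + 2 * (Ct / k%:R) * EE P (err k) + (Ct / k%:R) ^+ 2.
  rewrite /mse -EEZ// -EED// -[X in _ + X](EE_cst P) -EED; last 2 first.
  - exact: bdd_rvD.
  - exact: bdd_rv_cst.
  apply: ler_EE; first exact: bdd_sqr.
    by apply: bdd_rvD; [exact: bdd_rvD|exact: bdd_rv_cst].
  move=> w; apply: (@le_trans _ _ ((err k w + Ct / k%:R) ^+ 2)).
    by rewrite ler_pXn2r ?nnegrE ?enorm_ge0// (le_trans (enorm_ge0 _) (pt w)).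
  by rewrite le_eqVlt; apply/orP; left; apply/eqP; ring.
apply: le_trans h _.
have h1 := le_trans (mseV k) (fine3 k k0).
have h2 := ler_wpM2l q0 (rle k k0).
have h3 : (Ct / k%:R) ^+ 2 <= Ct ^+ 2 / (k%:R * s).
  rewrite expr_div_n ler_wpM2l ?sqr_ge0// lef_pV2 ?posrE ?mulr_gt0 ?exprn_gt0//.
  by rewrite expr2 ler_wpM2l// ltW.
apply: le_trans (lerD (lerD h1 h2) h3) _; rewrite -/s.
by rewrite le_eqVlt; apply/orP; left; apply/eqP; field; rewrite !gt_eqF.
Qed.

End MeanSquare.

(** * Reduction to surely bounded noise *)

Section Truncation.
Variables (R : realType) (d : nat).

(** Noise beyond its bound has probability 0. Resetting it to 0 makes the bound hold for every
    sample, as the estimates along paths require, and preserves independence since each vector is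
    transformed separately. *)
Definition truncate (b : R) (v : 'rV[R]_d) : 'rV[R]_d :=
  if enorm v <= b then v else 0.

Lemma truncate_le b v : enorm (truncate b v) <= `|b|.
Proof.
rewrite /truncate; case: ifP => [/le_trans|_]; first by apply; exact: ler_norm.
by rewrite enorm0.
Qed.

Lemma borel_truncate b (A : set 'rV[R]_d) : borel_rV A ->
  borel_rV (truncate b @^-1` A).
Proof.
pose S := g_sigma_algebraType (@open 'rV[R]_d).
move=> bA; pose ballE : set S := [set v : 'rV[R]_d | enorm v <= b].
have mB : measurable ballE.
  have rid : random_vector (T := S) (@id 'rV[R]_d) by [].
  have := measurable_enorm (random_vector_mvec rid).
  move=> /(_ measurableT `]-oo, b]%classic (measurable_itv _)); rewrite setTI.
  by congr measurable; apply/seteqP; split => v; rewrite /= in_itv.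
have -> : truncate b @^-1` A = (A `&` ballE) `|`
    (if `[< A 0 >] then ~` ballE else set0).
  apply/seteqP; split => v; rewrite /ballE /truncate /=.
    case: ifPn => [vb Av|vb A0]; first by left.
    by right; rewrite (asboolT A0); exact/negP.
  case: (boolP (enorm v <= b)) => vb.
    move=> [[Av _ //]|].
    have [A0|A0] := pselect (A 0); last by rewrite asboolF.
    by rewrite asboolT// => nb; case: nb.
  case=> [[_ //]|].
  by have [A0|A0] := pselect (A 0); [rewrite asboolT|rewrite asboolF].
apply: (@measurableU _ S); first exact: (@measurableI _ S).
by case: ifP => _; [exact: (@measurableC _ S)|exact: (@measurable0 _ S)].
Qed.

End Truncation.

Section AlmostEverywhere.
Variables (disp : measure_display) (T : measurableType disp) (R : realType).
Variable P : probability T R.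

Lemma ae_expectation (X Y : T -> R) :
  measurable_fun setT X -> measurable_fun setT Y ->
  {ae P, forall w, X w = Y w} -> ('E_P[X] = 'E_P[Y])%E.
Proof.
move=> mX mY XY; rewrite unlock; apply: ae_eq_integral => //.
- exact/measurable_EFinP.
- exact/measurable_EFinP.
- by apply: filterS XY => w -> _.
Qed.

(** The index set is countable, enumerated through [pickle], so the exceptional sets have a
    negligible union. *)
Lemma ae_forall_ord_nat (n : nat) (Q : 'I_n -> nat -> T -> Prop) :
  (forall i t, {ae P, forall w, Q i t w}) ->
  {ae P, forall w, forall i t, Q i t w}.
Proof.
move=> hQ.
have : {ae P, forall w, forall m : nat, forall p : 'I_n * nat,
    unpickle m = Some p -> Q p.1 p.2 w}.
  apply: ae_foralln => m; case E : (unpickle m) => [[i t]|].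
    by apply: filterS (hQ i t) => w qw p [<-].
  exact: aeW.
apply: filterS => w h i t.
by have := h (pickle (i, t)) (i, t); apply; rewrite pickleK.
Qed.

End AlmostEverywhere.

Theorem theorem15 (R : realType) (d n : nat) (hn : (1 <= n)%N)
  (E : rel 'I_n) (wake : 'I_n -> nat -> bool)
  (delay : 'I_n -> 'I_n -> nat -> option nat)
  (Ldel Lu Lf : nat) (hLdel : (1 <= Ldel)%N) (hLu : (1 <= Lu)%N)
  (hcomm : communication_assumption E wake delay Ldel Lu Lf)
  (disp : measure_display) (T : measurableType disp) (P : probability T R)
  (eps : 'I_n -> nat -> T -> 'rV[R]_d) (b sigma : 'I_n -> R)
  (hnoise : noise_assumption P eps b sigma)
  (f : 'I_n -> 'rV[R]_d -> R) (mu L : 'I_n -> R)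
  (hdiff : forall i z, differentiable (f i) z)
  (hmu : forall i, 0 < mu i)
  (hconvex : forall i, strongly_convex (mu i) (f i))
  (hL : forall i, 0 < L i)
  (hlip : forall i, lipschitz_grad (L i) (f i))
  (zstar : 'rV[R]_d)
  (hzstar : forall z, \sum_(i < n) f i zstar <= \sum_(i < n) f i z)
  (x0 : 'I_n -> 'rV[R]_d) :
  let mutot := \sum_(i < n) mu i in
  let sigma2 := \sum_(i < n) sigma i ^+ 2 in
  let alpha (k : nat) := if k == 0%N then 0 else n%:R / (mutot * k%:R) in
  let z (i : 'I_n) (k : nat) (w : T) := rasgp_z E wake delay alpha f x0 (fun j t => eps j t w) i k in
  forall i : 'I_n, exists C : R, \forall k \near \oo,
    ('E_P[fun w => (enorm (z i k w - zstar) ^+ 2)%R] <=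
     (Lu%:R * sigma2 / (k%:R * mutot ^+ 2)
      + C * k%:R `^ (- (3 / 2)))%R%:E)%E.
Proof.
move=> mutot sigma2 alpha z i.
have [rv ind bd mean var] := hnoise.
pose tr j t w := truncate (b j) (eps j t w).
(* One bound for all agents; the absolute values make it nonnegative whatever the sign of [b j]. *)
pose bmax := \sum_j `|b j|.
have bmax0 : 0 <= bmax by exact: sumr_ge0.
have tr_le j t w : enorm (tr j t w) <= bmax.
  apply: le_trans (truncate_le _ _) _.
  by rewrite /bmax (bigD1 j)//= lerDl sumr_ge0.
have tr_rv j t : random_vector (tr j t).
  move=> A bA; have := rv j t _ (borel_truncate (b j) bA); exact.
have tr_ind : independent_family P (fun p : 'I_n * nat => tr p.1 p.2).
  move=> s A us bA.
  have := ind s (fun p => truncate (b p.1) @^-1` A p) us; apply.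
  by move=> p ps; apply: borel_truncate; exact: bA.
have tr_ae j t : {ae P, forall w, eps j t w = tr j t w}.
  by apply: filterS (bd j t) => w; rewrite /tr /truncate => ->.
have eps_mvec j t : mvec (eps j t) by exact: random_vector_mvec.
have tr_mvec j t : mvec (tr j t) by exact: random_vector_mvec.
have tr_bdd j t : bdd_rv (fun w => enorm (tr j t w)).
  split; first exact: measurable_enorm.
  by exists bmax => w; rewrite ger0_norm ?enorm_ge0.
have tr_mean j t (c : 'I_d) : EE P (fun w => tr j t w 0 c) = 0.
  have bc : bdd_rv (fun w => tr j t w 0 c).
    split; first exact: tr_mvec.
    by exists bmax => w; exact: le_trans (coord_le_enorm _ _) _.
  apply: EFin_inj; rewrite -expectation_EE//; apply: etrans (mean j t c).
  apply: ae_expectation; [exact: tr_mvec|exact: eps_mvec|].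
  by apply: filterS (tr_ae j t) => w ->.
have tr_var j t : EE P (fun w => enorm (tr j t w) ^+ 2) <= sigma j ^+ 2.
  rewrite -lee_fin -expectation_EE; last exact: bdd_rvM.
  rewrite (@ae_expectation _ _ _ _ _ (fun w => enorm (eps j t w) ^+ 2)).
  - exact: var.
  - by apply: measurable_funX; exact: measurable_enorm.
  - by apply: measurable_funX; exact: measurable_enorm.
  - by apply: filterS (tr_ae j t) => w ->.
have [C C0 rate] := mean_square_rate x0 hn hLu hcomm hdiff hmu hconvex hL hlip
  hzstar bmax0 tr_rv tr_ind tr_le tr_mean tr_var.
exists C; near=> k.
have k0 : (0 < k)%N by near: k; exists 1%N.
have kR : 0 < k%:R :> R by rewrite ltr0n.
pose ztr w := rasgp_z E wake delay alpha f x0 (fun j t => tr j t w) i k.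
have mz (e : 'I_n -> nat -> T -> 'rV[R]_d) : (forall j t, mvec (e j t)) ->
    mvec (fun w => rasgp_z E wake delay alpha f x0 (fun j t => e j t w) i k).
  move=> me; exact: (mvec_z E wake delay alpha x0 hL hlip
    (fun j t (_ : (t < k)%N) => me j t) i (leqnn k)).
have mzz (e : 'I_n -> nat -> T -> 'rV[R]_d) : (forall j t, mvec (e j t)) ->
    measurable_fun setT (fun w => enorm
      (rasgp_z E wake delay alpha f x0 (fun j t => e j t w) i k - zstar) ^+ 2).
  move=> me; apply: measurable_funX; apply: measurable_enorm.
  by apply: mvecB; [exact: mz|exact: mvec_cst].
rewrite (@ae_expectation _ _ _ _ _ (fun w => enorm (ztr w - zstar) ^+ 2)).
- rewrite expectation_EE; last first.
    have [r r0 hr] := iterates_bounded x0 hn hLu hcomm hdiff hmu hconvex hL hlip hzstar bmax0.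
    split; first exact: mzz.
    exists (r ^+ 2) => w; rewrite ger0_norm ?sqr_ge0//.
    rewrite ler_pXn2r ?nnegrE ?enorm_ge0//.
    have [_ h] := hr (fun j t => tr j t w) (fun j t => tr_le j t w) k.
    exact: h.
  rewrite lee_fin; apply: le_trans (rate i k k0) _.
  have m0 : 0 < mutot := mutot_gt0 hn hmu.
  rewrite -/mutot -/sigma2 powRN.
  have -> : k%:R `^ (3 / 2) = k%:R * Num.sqrt k%:R :> R.
    have -> : 3 / 2 = 1 + 2^-1 :> R by lra.
    by rewrite powRD ?(gt_eqF kR) ?implybT// powRr1 ?powR12_sqrt// ltW.
  rewrite le_eqVlt; apply/orP; left; apply/eqP; congr (_ + _).
  suff H (s m : R) : s / m / k%:R = s / (k%:R * m) by exact: H.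
  by rewrite [k%:R * _]mulrC invfM mulrA.
- exact: mzz.
- exact: mzz.
(* Almost surely all noise vectors coincide with their truncations at once, and then the two runs
   are the same. *)
- apply: filterS (ae_forall_ord_nat tr_ae) => w hw.
  congr (enorm (rasgp_z E wake delay alpha f x0 _ i k - zstar) ^+ 2).
  by apply/funext => j; apply/funext => t; exact: hw.
Unshelve. all: by end_near. Qed.
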